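(* For every $\ell\ge1$, the reachability problem is decidable for reversible Petri nets with data $\mathcal{Q}^{\otimes\ell}$.
   Context: $\mathcal{Q}=(\mathbb{Q},\le)$ is the rational order. Embeddings of a relational structure are maps preserving and reflecting all relations; $\mathrm{Emb}(\mathcal{C})$ denotes them. The lexicographic product $\mathcal{A}\otimes\mathcal{A}'$ has carrier $A\times A'$; each $k$-ary relation $r$ of $\mathcal{A}$ holds of $((a_1,a'_1),\dots,(a_k,a'_k))$ iff $r(a_1,\dots,a_k)$, and each $k$-ary relation $r'$ of $\mathcal{A}'$ holds iff $a_1=\dots=a_k$ and $r'(a'_1,\dots,a'_k)$; $\mathcal{A}^{\otimes\ell}$ is the $\ell$-fold product and $\mathbf{d}=(\{0,\dots,d-1\},\le)$. $M[\mathcal{C}]$ is the monoid of monomials with variables the elements of $\mathcal{C}$; embeddings act by renaming variables. A Petri net with data $\mathcal{A}$ with $d$ places is a set $\mathcal{T}=\{(\iota(h),\iota(h')):\iota\in\mathrm{Emb}(\mathcal{A}\otimes\mathbf{d}),(h,h')\in T\}$ for a finite $T\subseteq M[\mathcal{A}\otimes\mathbf{d}]^2$ (the presentation); transitions are $g\cdot h\to g\cdot h'$ for $g$ a monomial and $(h,h')\in\mathcal{T}$, and $\to^*$ is the reflexive-transitive closure. The net is reversible if $c\to^*c'$ implies $c'\to^*c$. The reachability problem: given $d$, a presentation $T$ of a reversible net, and monomials $s,t$, decide whether $s\to^*t$. *)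

(* Defs.v *)
From Stdlib Require Import Relation_Operators.
From mathcomp Require Import all_boot all_order all_algebra.
From mathcomp Require Import finmap monalg.

Set Implicit Arguments.
Unset Strict Implicit.
Unset Printing Implicit Defensive.

(** ** Partial recursive functions *)

(* Kleene's mu-recursive functions. Arities are left implicit: a program acts
   on a list of arguments and has no value if too few arguments are given. *)
Inductive murec : Type :=
| MZero
| MSucc
| MProj of nat
| MComp of murec & seq murec
| MRec of murec & murec
| MMin of murec.

(* [meval p xs y]: the partial function computed by [p] is defined at [xs], with
   value [y]. [MRec f g] recurses on its first argument, [g] receiving the
   counter, the previous value and the parameters, in this order; [MMin f] at
   [xs] is the least [n] such that [f] vanishes at [n :: xs], provided that [f]
   is defined at [m :: xs] for every [m < n]. *)
Inductive meval : murec -> seq nat -> nat -> Prop :=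
| EvZero xs : meval MZero xs 0
| EvSucc x xs : meval MSucc (x :: xs) x.+1
| EvProj i xs : i < size xs -> meval (MProj i) xs (nth 0 xs i)
| EvComp f gs xs ys y :
    mevals gs xs ys -> meval f ys y -> meval (MComp f gs) xs y
| EvRec0 f g xs y : meval f xs y -> meval (MRec f g) (0 :: xs) y
| EvRecS f g n xs z y :
    meval (MRec f g) (n :: xs) z -> meval g [:: n, z & xs] y ->
    meval (MRec f g) (n.+1 :: xs) y
| EvMin f n xs :
    meval f (n :: xs) 0 ->
    (forall m, m < n -> exists k, meval f (m :: xs) k.+1) ->
    meval (MMin f) xs n
with mevals : seq murec -> seq nat -> seq nat -> Prop :=
| EvNil xs : mevals [::] xs [::]
| EvCons g gs xs y ys :
    meval g xs y -> mevals gs xs ys -> mevals (g :: gs) xs (y :: ys).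

(** ** Relational structures *)

(* The carrier is a [countType] so that finite data over it can be Godel-numbered
   by [choice.pickle]. *)
Record structure := Structure {
  carrier :> countType;
  symbol : Type;
  arity : symbol -> nat;
  interp : forall r : symbol, (arity r).-tuple carrier -> Prop
}.

Definition embedding (A : structure) (f : A -> A) : Prop :=
  forall (r : symbol A) (x : (arity r).-tuple A),
    interp (map_tuple f x) <-> interp x.

Definition binrel_structure (T : countType) (e : rel T) : structure :=
  @Structure T unit (fun _ => 2)
    (fun _ x => e (tnth x ord0) (tnth x ord_max)).

Definition ratQ : structure := binrel_structure (@Order.le _ rat).

Definition chain (d : nat) : structure :=
  binrel_structure (fun i j : 'I_d => i <= j).

Section LexProduct.
Variables A B : structure.

Definition lex_arity (r : symbol A + symbol B) : nat :=
  match r with inl r => arity r | inr r => arity r end.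

Definition lex_interp (r : symbol A + symbol B) :
    (lex_arity r).-tuple (A * B)%type -> Prop :=
  match r with
  | inl r => fun x => interp (map_tuple fst x : (arity r).-tuple A)
  | inr r => fun x =>
      (forall i j, (tnth x i).1 = (tnth x j).1) /\
      interp (map_tuple snd x : (arity r).-tuple B)
  end.

Definition lexprod : structure :=
  @Structure (A * B)%type (symbol A + symbol B)%type lex_arity lex_interp.
End LexProduct.

(* A * (A * (... * A)) with l factors, for 0 < l; the value at l = 0 is junk. *)
Definition lexpow (A : structure) (l : nat) : structure :=
  iter l.-1 (lexprod A) A.

(** ** Monomials *)

Definition rename (C : choiceType) (f : C -> C) (m : {cmonom C}) : {cmonom C} :=
  \big[mmul/mone]_(x <- finsupp m) expcmn (ucm (f x)) (m x).

(* The monomial x1 * ... * xn written as the word [:: x1; ...; xn]. *)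
Definition monom_of_word (C : choiceType) (w : seq C) : {cmonom C} :=
  \big[mmul/mone]_(x <- w) ucm x.

(** ** Petri nets with data *)

Section Net.
Variables (A : structure) (d : nat).

Let C : structure := lexprod A (chain d).
Let M := {cmonom C}.

Definition net (T : seq (M * M)) (H H' : M) : Prop :=
  exists (f : C -> C) (h h' : M),
    [/\ embedding f, (h, h') \in T, H = rename f h & H' = rename f h'].

Definition step (T : seq (M * M)) (c c' : M) : Prop :=
  exists g H H' : M, [/\ net T H H', c = mmul g H & c' = mmul g H'].

Definition reach (T : seq (M * M)) : M -> M -> Prop :=
  clos_refl_trans M (step T).

Definition reversible (T : seq (M * M)) : Prop :=
  forall c c' : M, reach T c c' -> reach T c' c.
End Net.

(** ** The reachability problem for reversible nets *)

Definition presentation_of_words (C : choiceType) (T : seq (seq C * seq C)) :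
    seq ({cmonom C} * {cmonom C}) :=
  [seq (monom_of_word h.1, monom_of_word h.2) | h <- T].

(* A program deciding the problem is given the Godel numbers of d, T, s and t,
   all monomials being written as words. It must answer 1 or 0 on every instance
   with a reversible net, and may behave arbitrarily on the other inputs.
   [choice.pickle] is a transparent, explicitly computable numbering on the types
   used below when A is a lexicographic power of (Q, <=): it is the identity
   on nat and on 'I_d, a rational is coded through its reduced numerator and
   denominator, and pairs and lists are coded by [CodeSeq.code]. *)
Definition reversible_reachability_decidable (A : structure) : Prop :=
  exists p : murec,
    forall (d : nat)
           (T : seq (seq (lexprod A (chain d)) * seq (lexprod A (chain d))))
           (s t : seq (lexprod A (chain d))),
    let N := presentation_of_words T in
    let input :=
      [:: d; choice.pickle T; choice.pickle s; choice.pickle t] in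
    reversible N ->
    (reach N (monom_of_word s) (monom_of_word t) -> meval p input 1) /\
    (~ reach N (monom_of_word s) (monom_of_word t) -> meval p input 0).

(* Main.v *)
(** Both reachability and unreachability have finite certificates that a program
can check, so a program may search for either. A firing sequence certifies
reachability. In a reversible net reachability is a congruence on monomials,
invariant under embeddings, and unreachability is certified by a Groebner basis.

Fixing the atoms that may occur makes the lexicographic order on monomials
well-founded; since atoms are dense this has to be done by recording, in each
monomial, marks for the allowed atoms, which rules never change. The monomials
that are not minimal in their class are closed under embeddings and
multiplication, so by Higman's lemma, iterated once for each factor of the
lexicographic power, finitely many of them generate the others. Orienting these
towards smaller equivalent monomials gives a finite confluent and terminating
rewriting system; its confluence is witnessed by finitely many critical pairs.

A firing sequence may pass through atoms that do not occur at its ends. Every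
place is therefore split into a visible and a hidden copy, hidden letters being
larger. A monomial without hidden tokens then has a normal form without hidden
tokens, whatever hidden atoms are allowed, and [s] reaches [t] iff the normal
forms of their visible copies agree. *)

From Stdlib Require Import ClassicalEpsilon Relation_Operators Operators_Properties.
Require Import Defs.
From mathcomp Require Import all_boot all_order all_algebra.
From mathcomp Require Import finmap monalg zify.

Set Implicit Arguments.
Unset Strict Implicit.
Unset Printing Implicit Defensive.
Import Order.TTheory GRing.Theory Num.Theory.

Local Notation pickle := choice.pickle.

(** * Computable functions *)

(** Everything rests on homogeneity: a finite map between atoms over the rationals that preserves
    all comparisons extends to an embedding. A finite configuration therefore matters only through
    its order type, which can be written with natural coordinates. This makes applicability of a
    rule decidable and leaves finitely many overlaps to examine.

    The marks serve termination: over a dense order a lexicographic descent may go on forever,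
    trading a letter for smaller ones at new atoms. Every atom of a right side must carry a mark,
    and both sides have the same marks, so no rule creates an atom and only finitely many letters
    are in play.

    Making hidden letters the largest has this effect: a rule whose left side has no hidden token
    decreases at a visible letter, hence leaves the hidden part alone. Its visible part then acts by
    itself, and irreducibility can be tested with hidden marks in unlimited supply, whatever atoms a
    firing sequence visits.

    Certificates are shown to exist by classical and non-effective arguments; only their
    verification is computed. *)

Definition mcomputable k (F : seq nat -> nat) :=
  exists p, forall xs, size xs = k -> meval p xs (F xs).

Lemma mcomputable_ext k F G :
  (forall xs, size xs = k -> F xs = G xs) -> mcomputable k F -> mcomputable k G.
Proof. by move=> FG [p Hp]; exists p => xs sz; rewrite -FG //; apply: Hp. Qed.

Lemma mcomputable_proj k i : i < k -> mcomputable k (fun xs => nth 0 xs i).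
Proof. by move=> lt_ik; exists (MProj i) => xs sz; constructor; rewrite sz. Qed.

Lemma mcomputable_const k n : mcomputable k (fun=> n).
Proof.
elim: n => [|n [p Hp]]; first by exists MZero => xs _; constructor.
exists (MComp MSucc [:: p]) => xs sz; apply: EvComp (EvSucc n [::]).
by repeat constructor; apply: Hp.
Qed.

Definition mcomputable1 (f : nat -> nat) := mcomputable 1 (fun xs => f (nth 0 xs 0)).
Definition mcomputable2 (f : nat -> nat -> nat) :=
  mcomputable 2 (fun xs => f (nth 0 xs 0) (nth 0 xs 1)).

Lemma mcomputable1_app k f G :
  mcomputable1 f -> mcomputable k G -> mcomputable k (fun xs => f (G xs)).
Proof.
move=> [p Hp] [q Hq]; exists (MComp p [:: q]) => xs sz.
apply: (@EvComp _ _ _ [:: G xs]); last exact: (Hp [:: _]).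
by repeat constructor; apply: Hq.
Qed.

Lemma mcomputable2_app k f G H :
  mcomputable2 f -> mcomputable k G -> mcomputable k H ->
  mcomputable k (fun xs => f (G xs) (H xs)).
Proof.
move=> [p Hp] [q Hq] [r Hr]; exists (MComp p [:: q; r]) => xs sz.
apply: (@EvComp _ _ _ [:: G xs; H xs]); last exact: (Hp [:: _; _]).
by repeat constructor; [apply: Hq|apply: Hr].
Qed.

Lemma mcomputable_rec k F G H :
  mcomputable k F -> mcomputable k.+2 G ->
  (forall xs, H (0 :: xs) = F xs) ->
  (forall n xs, H (n.+1 :: xs) = G [:: n, H (n :: xs) & xs]) ->
  mcomputable k.+1 H.
Proof.
move=> [p Hp] [q Hq] H0 HS; exists (MRec p q) => -[//|n xs] [sz].
elim: n => [|n IHn]; first by rewrite H0; constructor; apply: Hp.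
by apply: EvRecS IHn _; rewrite HS; apply: Hq; rewrite /= sz.
Qed.

Lemma mcomputable_min k F H :
  mcomputable k.+1 F -> (forall xs, F (H xs :: xs) = 0) ->
  (forall xs m, m < H xs -> F (m :: xs) != 0) -> mcomputable k H.
Proof.
move=> [p Hp] H0 Hmin; exists (MMin p) => xs sz; constructor.
  by rewrite -(H0 xs); apply: Hp; rewrite /= sz.
move=> m /Hmin ltF; exists (F (m :: xs)).-1; rewrite prednK ?lt0n //.
by apply: Hp; rewrite /= sz.
Qed.

Lemma mcomputable1_succ : mcomputable1 succn.
Proof. by exists MSucc => -[//|x [|//]] _; constructor. Qed.

Lemma mcomputable2_rec f g (h : nat -> nat -> nat) :
  mcomputable1 f -> mcomputable 3 (fun xs => g (nth 0 xs 0) (nth 0 xs 1) (nth 0 xs 2)) ->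
  (forall y, h 0 y = f y) -> (forall n y, h n.+1 y = g n (h n y) y) ->
  mcomputable2 h.
Proof.
move=> Hf Hg h0 hS.
by apply: (mcomputable_rec Hf Hg) => [xs|n xs]; rewrite /= ?h0 ?hS.
Qed.

Lemma mcomputable2_flip f : mcomputable2 f -> mcomputable2 (fun x y => f y x).
Proof. by move=> Hf; apply: (mcomputable2_app Hf); apply: mcomputable_proj. Qed.

Lemma mcomputable2_add : mcomputable2 addn.
Proof.
apply: (@mcomputable2_rec id (fun _ z _ => z.+1)) => //.
- exact: mcomputable_proj.
- by apply: (mcomputable1_app mcomputable1_succ); apply: mcomputable_proj.
Qed.

Lemma mcomputable2_mul : mcomputable2 muln.
Proof.
apply: (@mcomputable2_rec (fun=> 0) (fun _ z y => y + z)) => //.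
- exact: mcomputable_const.
- by apply: (mcomputable2_app mcomputable2_add); apply: mcomputable_proj.
Qed.

Lemma mcomputable1_pred : mcomputable1 predn.
Proof.
have H : mcomputable2 (fun n _ => n.-1).
  apply: (@mcomputable2_rec (fun=> 0) (fun n _ _ => n)) => //.
  - exact: mcomputable_const.
  - exact: mcomputable_proj.
by apply: (mcomputable2_app H) (mcomputable_const _ 0); apply: mcomputable_proj.
Qed.

Lemma mcomputable2_sub : mcomputable2 subn.
Proof.
apply: mcomputable2_flip; apply: (@mcomputable2_rec id (fun _ z _ => z.-1)).
- exact: mcomputable_proj.
- by apply: (mcomputable1_app mcomputable1_pred); apply: mcomputable_proj.
- exact: subn0.
- by move=> n y; exact: subnS.
Qed.

Lemma mcomputable2_leq : mcomputable2 (fun x y => x <= y).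
Proof.
have H : mcomputable2 (fun x y => 1 - (x - y)).
  apply: (mcomputable2_app mcomputable2_sub); first exact: mcomputable_const.
  by apply: (mcomputable2_app mcomputable2_sub); apply: mcomputable_proj.
by apply: mcomputable_ext H => -[|x [|y []]] //= _; rewrite -subn_eq0; case: (x - y).
Qed.

Lemma mcomputable2_eq : mcomputable2 (fun x y => x == y).
Proof.
have H : mcomputable2 (fun x y => (x <= y) * (y <= x)).
  apply: (mcomputable2_app mcomputable2_mul); first exact: mcomputable2_leq.
  exact: (mcomputable2_flip mcomputable2_leq).
by apply: mcomputable_ext H => -[|x [|y []]] //= _; rewrite mulnb -eqn_leq.
Qed.

Lemma mcomputable1_exp2 : mcomputable1 (expn 2).
Proof.
have H : mcomputable2 (fun n _ => 2 ^ n).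
  apply: (@mcomputable2_rec (fun=> 1) (fun _ z _ => 2 * z)) => //.
  - exact: mcomputable_const.
  - apply: (mcomputable2_app mcomputable2_mul); first exact: mcomputable_const.
    exact: mcomputable_proj.
  - by move=> n _; rewrite expnS.
by apply: (mcomputable2_app H) (mcomputable_const _ 0); apply: mcomputable_proj.
Qed.

(** The quotient is the least [q] at which [q.+1 * d <= x] fails; the factor [0 < d] stops the
    search at 0 for a zero divisor, in agreement with [divn]. *)
Lemma mcomputable2_div : mcomputable2 divn.
Proof.
pose F q x d := (0 < d) * (q.+1 * d <= x).
apply: (@mcomputable_min _
  (fun xs => F (nth 0 xs 0) (nth 0 xs 1) (nth 0 xs 2))).
- apply: (mcomputable2_app mcomputable2_mul).
    by apply: (mcomputable2_app mcomputable2_leq);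
      [apply: mcomputable_const|apply: mcomputable_proj].
  apply: (mcomputable2_app mcomputable2_leq); last exact: mcomputable_proj.
  apply: (mcomputable2_app mcomputable2_mul); last exact: mcomputable_proj.
  by apply: (mcomputable1_app mcomputable1_succ); apply: mcomputable_proj.
- move=> xs /=; rewrite /F; case: posnP => // d_gt0.
  by rewrite mul1n leqNgt ltn_ceil.
- move=> xs m /=; rewrite /F; case: posnP => [->|d_gt0]; first by rewrite divn0.
  by rewrite leq_divRL // mul1n => ->.
Qed.

(** * Coding of pairs and lists by natural numbers *)

(** This is the folding step of [CodeSeq.code], so the pickles of pairs and lists are built from it
    by mere computation. *)
Definition ccons n m := 2 ^ n * m.*2.+1.
Definition chead c := if c is 0 then 0 else logn 2 c.
Definition ctail c := c %/ 2 ^ chead c %/ 2.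

Lemma ccons_gt0 n m : 0 < ccons n m.
Proof. by rewrite muln_gt0 expn_gt0. Qed.

Lemma cheadK n m : chead (ccons n m) = n.
Proof.
rewrite /chead; case E: (ccons n m) (ccons_gt0 n m) => [//|k] _; rewrite -E /ccons.
rewrite lognM ?expn_gt0 // pfactorK // lognE /=.
by rewrite dvdn2 /= odd_double addn0.
Qed.

Lemma ctailK n m : ctail (ccons n m) = m.
Proof. by rewrite /ctail cheadK mulKn ?expn_gt0 // divn2 /= uphalf_double. Qed.

Lemma mcomputable2_ccons : mcomputable2 ccons.
Proof.
apply: (mcomputable2_app mcomputable2_mul).
  by apply: (mcomputable1_app mcomputable1_exp2); apply: mcomputable_proj.
apply: (mcomputable1_app mcomputable1_succ).
apply: (@mcomputable_ext _ (fun xs => nth 0 xs 1 + nth 0 xs 1)).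
  by move=> xs _; rewrite addnn.
by apply: (mcomputable2_app mcomputable2_add); apply: mcomputable_proj.
Qed.

(** The exponent of 2 in a positive [c] is the least [n] such that [2 ^ n.+1] does not divide [c];
    divisibility is tested by dividing and multiplying back. *)
Lemma mcomputable1_chead : mcomputable1 chead.
Proof.
pose F n c := (0 < c) * (c %/ 2 ^ n.+1 * 2 ^ n.+1 == c).
have FE n c : F n c = (0 < c) && (n < chead c).
  rewrite /F mulnb; case: c => [//|c]; rewrite /chead -pfactor_dvdn //.
  by rewrite dvdn_eq.
apply: (@mcomputable_min _ (fun xs => F (nth 0 xs 0) (nth 0 xs 1))).
- apply: (mcomputable2_app mcomputable2_mul).
    by apply: (mcomputable2_app mcomputable2_leq);
      [apply: mcomputable_const|apply: mcomputable_proj].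
  have H : mcomputable 2 (fun xs => 2 ^ (nth 0 xs 0).+1).
    apply: (mcomputable1_app mcomputable1_exp2).
    by apply: (mcomputable1_app mcomputable1_succ); apply: mcomputable_proj.
  apply: (mcomputable2_app mcomputable2_eq); last exact: mcomputable_proj.
  apply: (mcomputable2_app mcomputable2_mul) => //.
  by apply: (mcomputable2_app mcomputable2_div) => //; apply: mcomputable_proj.
- by move=> xs; rewrite /= FE ltnn andbF.
- by move=> xs m /= lt_m; rewrite FE lt_m andbT; case: (nth 0 xs 0) lt_m.
Qed.

Lemma mcomputable1_ctail : mcomputable1 ctail.
Proof.
apply: (mcomputable2_app mcomputable2_div); last exact: mcomputable_const.
apply: (mcomputable2_app mcomputable2_div); first exact: mcomputable_proj.
apply: (mcomputable1_app mcomputable1_exp2).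
by apply: (mcomputable1_app mcomputable1_chead); apply: mcomputable_proj.
Qed.

(** * Computable functions between countable types *)

(** Nothing is required of the program on numbers that code no element of [X]. *)
Definition computable (X Y : countType) (f : X -> Y) :=
  exists p, forall x, meval p [:: pickle x] (pickle (f x)).

Lemma pickle_pair (X Y : countType) (x : X) (y : Y) :
  pickle (x, y) = ccons (pickle x) (ccons (pickle y) 0).
Proof. by []. Qed.

Lemma pickle_cons (X : countType) (x : X) (s : seq X) :
  pickle (x :: s) = ccons (pickle x) (pickle s).
Proof. by []. Qed.

Section Computable.
Variables E X Y Z : countType.

Lemma computable_ext (f g : X -> Y) : f =1 g -> computable f -> computable g.
Proof. by move=> fg [p Hp]; exists p => x; rewrite -fg. Qed.

Lemma computable_raw1 (r : nat -> nat) (g : X -> Y) (f : E -> X) :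
  mcomputable1 r -> (forall x, pickle (g x) = r (pickle x)) ->
  computable f -> computable (fun e => g (f e)).
Proof.
move=> [p Hp] rP [q Hq]; exists (MComp p [:: q]) => e.
apply: (@EvComp _ _ _ [:: pickle (f e)]); first by repeat constructor.
by rewrite rP; apply: (Hp [:: _]).
Qed.

Lemma computable_raw2 (r : nat -> nat -> nat) (h : X -> Y -> Z)
    (f : E -> X) (g : E -> Y) :
  mcomputable2 r -> (forall x y, pickle (h x y) = r (pickle x) (pickle y)) ->
  computable f -> computable g -> computable (fun e => h (f e) (g e)).
Proof.
move=> [p Hp] rP [q Hq] [q' Hq']; exists (MComp p [:: q; q']) => e.
apply: (@EvComp _ _ _ [:: pickle (f e); pickle (g e)]); first by repeat constructor.
by rewrite rP; apply: (Hp [:: _; _]).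
Qed.

Lemma computable_id : computable (@id X).
Proof. by exists (MProj 0) => x; apply: (EvProj (xs := [:: _])). Qed.

Lemma computable_const (y : Y) : computable (fun _ : X => y).
Proof. by have [p Hp] := mcomputable_const 1 (pickle y); exists p => x; apply: Hp. Qed.

Lemma computable_comp (g : X -> Y) (f : E -> X) :
  computable g -> computable f -> computable (fun e => g (f e)).
Proof.
move=> [p Hp] [q Hq]; exists (MComp p [:: q]) => e.
by apply: (@EvComp _ _ _ [:: pickle (f e)]); first by repeat constructor.
Qed.
End Computable.

Section ComputablePair.
Variables E X Y Z : countType.

Lemma computable_pair (f : E -> X) (g : E -> Y) :
  computable f -> computable g -> computable (fun e => (f e, g e)).
Proof.
apply: (computable_raw2 (r := fun x y => ccons x (ccons y 0))) => //.
apply: (mcomputable2_app mcomputable2_ccons); first exact: mcomputable_proj.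
apply: (mcomputable2_app mcomputable2_ccons) (mcomputable_const _ _).
exact: mcomputable_proj.
Qed.

Lemma computable_fst (f : E -> X * Y) :
  computable f -> computable (fun e => (f e).1).
Proof.
apply: (computable_raw1 mcomputable1_chead (g := fst)) => -[x y].
by rewrite pickle_pair cheadK.
Qed.

Lemma computable_snd (f : E -> X * Y) :
  computable f -> computable (fun e => (f e).2).
Proof.
apply: (computable_raw1 (r := fun c => chead (ctail c)) (g := snd)).
  by apply: (mcomputable1_app mcomputable1_chead); apply: mcomputable1_ctail.
by move=> [x y]; rewrite pickle_pair ctailK cheadK.
Qed.

(* In [MRec a b] applied to [c :: xs], the second program runs only if [0 < c],
   so that it may be undefined on the inputs of the first branch. *)
Lemma computable_case (c : E -> nat) (f k : E -> Y) :
  computable c -> computable f ->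
  (exists p, forall e, 0 < c e -> meval p [:: pickle e] (pickle (k e))) ->
  (forall e, c e = 0 -> k e = f e) -> computable k.
Proof.
move=> [c' Hc] [f' Hf] [k' Hk] kf.
exists (MComp (MRec f' (MComp k' [:: MProj 2])) [:: c'; MProj 0]) => e.
apply: (@EvComp _ _ _ [:: c e; pickle e]).
  by constructor; [apply: Hc|repeat constructor; apply: (EvProj (xs := [:: _]))].
case: (c e) (Hk e) (kf e) => [|n]; first by move=> _ ->//; constructor; apply: Hf.
move=> /(_ isT) He _.
have H m z : meval (MComp k' [:: MProj 2]) [:: m, z & [:: pickle e]] (pickle (k e)).
  apply: (@EvComp _ _ _ [:: pickle e]) => //.
  by repeat constructor; apply: (@EvProj 2 [:: _; _; _]).
elim: n => [|n IHn]; last by apply: EvRecS IHn _; apply: H.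
by apply: EvRecS; [constructor; apply: Hf|apply: H].
Qed.

Lemma computable_if (b : E -> bool) (f g : E -> Y) :
  computable b -> computable f -> computable g ->
  computable (fun e => if b e then f e else g e).
Proof.
move=> Hb Hf [g' Hg]; have Hb' : computable (fun e => b e : nat).
  apply: (computable_raw1 (r := id) (g := nat_of_bool)) Hb => //.
  exact: mcomputable_proj.
case: Hf => f' Hf.
apply: (computable_case Hb' (ex_intro _ g' Hg)) => [|e]; last by case: (b e).
by exists f' => e; case: (b e).
Qed.

Lemma computable_iter (n : E -> nat) (f : E -> Y -> Y) (z : E -> Y) :
  computable (fun p => f p.1 p.2) -> computable n -> computable z ->
  computable (fun e => iter (n e) (f e) (z e)).
Proof.
move=> [f' Hf] [n' Hn] [z' Hz].
have [c' Hc] := @mcomputable2_app 2 _ _ _ mcomputable2_ccons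
  (mcomputable_proj (isT : 0 < 2)) (mcomputable2_app mcomputable2_ccons
   (mcomputable_proj (isT : 1 < 2)) (mcomputable_const _ 0)).
exists (MComp (MRec z' (MComp f' [:: MComp c' [:: MProj 2; MProj 1]]))
              [:: n'; MProj 0]) => e.
apply: (@EvComp _ _ _ [:: n e; pickle e]).
  by constructor; [apply: Hn|repeat constructor; apply: (EvProj (xs := [:: _]))].
elim: (n e) => [|m IHm]; first by constructor; apply: Hz.
apply: EvRecS IHm _ => /=; set y := iter m _ _.
apply: (@EvComp _ _ _ [:: pickle (e, y)]); last exact: Hf (e, y).
constructor; last by constructor.
apply: (@EvComp _ _ _ [:: pickle e; pickle y]).
  constructor; first exact: (@EvProj 2 [:: _; _; _]).
  by constructor; [exact: (@EvProj 1 [:: _; _; _])|constructor].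
by rewrite pickle_pair; apply: (Hc [:: pickle e; pickle y]).
Qed.
End ComputablePair.

Section ComputableSeq.
Variables E X Y : countType.

Lemma computable_cons (f : E -> X) (s : E -> seq X) :
  computable f -> computable s -> computable (fun e => f e :: s e).
Proof. exact: (computable_raw2 mcomputable2_ccons (h := cons)). Qed.

(** The code of a list vanishes exactly when the list is empty, so it serves itself as the condition
    of [computable_case]; the second branch splits a nonzero code into head and tail. *)
Lemma computable_seqmatch (s : E -> seq X) (f : E -> Y) (g : E -> X -> seq X -> Y) :
  computable s -> computable f ->
  computable (fun p : E * (X * seq X) => g p.1 p.2.1 p.2.2) ->
  computable (fun e => if s e is x :: s' then g e x s' else f e).
Proof.
move=> Hs Hf [g' Hg]; pose c e := pickle (s e).
have Hc : computable c.
  by apply: (computable_raw1 (r := id) (g := pickle)) Hs => //; apply: mcomputable_proj.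
apply: (computable_case Hc Hf) => [|e]; last first.
  by rewrite /c; case: (s e) => // x s'; rewrite pickle_cons => /eqP; rewrite gtn_eqF ?ccons_gt0.
have [s1 Hs1] := Hs.
have [r' Hr] : mcomputable 2 (fun xs => let e := nth 0 xs 0 in let c := nth 0 xs 1 in
    ccons e (ccons (ccons (chead c) (ccons (ctail c) 0)) 0)).
  have P0 := @mcomputable_proj 2 0 isT; have P1 := @mcomputable_proj 2 1 isT.
  apply: (mcomputable2_app mcomputable2_ccons) => //.
  apply: (mcomputable2_app mcomputable2_ccons) (mcomputable_const _ _).
  apply: (mcomputable2_app mcomputable2_ccons).
    exact: (mcomputable1_app mcomputable1_chead).
  apply: (mcomputable2_app mcomputable2_ccons) (mcomputable_const _ _).
  exact: (mcomputable1_app mcomputable1_ctail).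
exists (MComp g' [:: MComp r' [:: MProj 0; s1]]) => e.
case Ese: (s e) => [|x t]; first by rewrite /c Ese.
move=> _; apply: (@EvComp _ _ _ [:: pickle (e, (x, t))]); last exact: Hg (e, (x, t)).
constructor; last by constructor.
apply: (@EvComp _ _ _ [:: pickle e; pickle (s e)]).
  by constructor; [exact: (@EvProj 0 [:: _])|repeat constructor].
have := Hr [:: pickle e; pickle (s e)] erefl.
by rewrite /= {2 3}Ese [pickle (x :: t)]pickle_cons cheadK ctailK !pickle_pair.
Qed.

End ComputableSeq.

Section ComputableFold.
Variables E X Y : countType.

Lemma size_pickle (s : seq X) : size s <= pickle s.
Proof.
elim: s => //= x s IHs; rewrite pickle_cons /ccons.
apply: (@leq_trans (pickle s).*2.+1); last by rewrite leq_pmull ?expn_gt0.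
by rewrite ltnS (leq_trans IHs) // -addnn leq_addr.
Qed.

(** The iteration runs as many times as the code of the list, which bounds its length; once the list
    is used up a step changes nothing, so the excess is harmless. *)
Lemma computable_foldl (f : E -> Y -> X -> Y) (z : E -> Y) (s : E -> seq X) :
  computable (fun p : E * (Y * X) => f p.1 p.2.1 p.2.2) ->
  computable z -> computable s -> computable (fun e => foldl (f e) (z e) (s e)).
Proof.
move=> Hf Hz Hs.
pose step e (st : seq X * Y) := if st.1 is x :: t then (t, f e st.2 x) else st.
have Hn : computable (fun e => pickle (s e)).
  by apply: (computable_raw1 (r := id) (g := pickle)) Hs => //; apply: mcomputable_proj.
have Hstep : computable (fun p => step p.1 p.2).
  apply: (@computable_seqmatch (E * (seq X * Y))%type X (seq X * Y)%type
    (fun p => p.2.1) (fun p => p.2) (fun p x t => (t, f p.1 p.2.2 x))).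
  - by do 2!(apply: computable_fst || apply: computable_snd); apply: computable_id.
  - by apply: computable_snd; apply: computable_id.
  - have Hid := computable_id (E * (seq X * Y) * (X * seq X))%type.
    apply: computable_pair; first by do 2!apply: computable_snd.
    apply: (computable_comp Hf (f := fun p : E * (seq X * Y) * (X * seq X) =>
      (p.1.1, (p.1.2.2, p.2.1)))).
    apply: computable_pair; first by do 2!apply: computable_fst.
    apply: computable_pair; first by do 2!apply: computable_snd; apply: computable_fst.
    by apply: computable_fst; apply: computable_snd.
have H := computable_snd (computable_iter Hstep Hn (computable_pair Hs Hz)).
apply: computable_ext H => e; move: (size_pickle (s e)) (z e) => {Hn Hs}.
move: (pickle _) => n.
elim: n (s e) => [|n IHn] [|x t] // le_n y; rewrite iterSr.
  exact: (IHn [::]).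
exact: IHn.
Qed.
End ComputableFold.

Section ComputableFoldr.
Variables E X Y : countType.

Lemma computable_rev (s : E -> seq X) :
  computable s -> computable (fun e => rev (s e)).
Proof.
move=> Hs.
have H : computable (fun e => foldl (fun t x => x :: t) [::] (s e)).
  apply: (@computable_foldl E X (seq X) (fun _ t x => x :: t) (fun=> [::])) => //.
    apply: computable_cons; first by do 2!apply: computable_snd; apply: computable_id.
    by apply: computable_fst; apply: computable_snd; apply: computable_id.
  exact: computable_const.
apply: computable_ext H => e; rewrite -[s e in LHS]revK foldl_rev.
by elim: (rev _) => //= x t ->.
Qed.

Lemma computable_foldr (f : E -> X -> Y -> Y) (z : E -> Y) (s : E -> seq X) :
  computable (fun p : E * (X * Y) => f p.1 p.2.1 p.2.2) ->
  computable z -> computable s -> computable (fun e => foldr (f e) (z e) (s e)).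
Proof.
move=> Hf Hz Hs.
have H : computable (fun e => foldl (fun y x => f e x y) (z e) (rev (s e))).
  apply: (@computable_foldl E X Y (fun e y x => f e x y)) => //.
    apply: (computable_comp Hf (f := fun p : E * (Y * X) => (p.1, (p.2.2, p.2.1)))).
    have Hid := computable_id (E * (Y * X))%type.
    apply: computable_pair; first exact: computable_fst.
    by apply: computable_pair; [do 2!apply: computable_snd|
       apply: computable_fst; apply: computable_snd].
  exact: computable_rev.
by apply: computable_ext H => e; rewrite foldl_rev.
Qed.
End ComputableFoldr.

Ltac computable_proj :=
  repeat first [exact: computable_id | apply: computable_fst | apply: computable_snd].

Section ComputableNat.
Variables E X Y : countType.
Implicit Types m n : E -> nat.

Lemma computable_add m n :
  computable m -> computable n -> computable (fun e => m e + n e).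
Proof. exact: (computable_raw2 mcomputable2_add (h := addn)). Qed.

Lemma computable_mul m n :
  computable m -> computable n -> computable (fun e => m e * n e).
Proof. exact: (computable_raw2 mcomputable2_mul (h := muln)). Qed.

Lemma computable_sub m n :
  computable m -> computable n -> computable (fun e => m e - n e).
Proof. exact: (computable_raw2 mcomputable2_sub (h := subn)). Qed.

Lemma computable_div m n :
  computable m -> computable n -> computable (fun e => m e %/ n e).
Proof. exact: (computable_raw2 mcomputable2_div (h := divn)). Qed.

Lemma computable_succ n : computable n -> computable (fun e => (n e).+1).
Proof. exact: (computable_raw1 mcomputable1_succ (g := succn)). Qed.

Lemma computable_leq m n :
  computable m -> computable n -> computable (fun e => m e <= n e).
Proof. exact: (computable_raw2 mcomputable2_leq (h := leq)). Qed.

Lemma computable_mod m n :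
  computable m -> computable n -> computable (fun e => m e %% n e).
Proof.
move=> Hm Hn; apply: (computable_ext (f := fun e => m e - m e %/ n e * n e)).
  by move=> e; rewrite {1}(divn_eq (m e) (n e)) addnC addnK.
by apply: computable_sub => //; apply: computable_mul => //; apply: computable_div.
Qed.

Lemma computable_eq (f g : E -> X) :
  computable f -> computable g -> computable (fun e => f e == g e).
Proof.
apply: (computable_raw2 mcomputable2_eq (h := fun x y => x == y)) => x y.
by rewrite (inj_eq (pcan_inj choice.pickleK)).
Qed.

Lemma computable_eqn m n :
  computable m -> computable n -> computable (fun e => m e == n e).
Proof. exact: (computable_raw2 mcomputable2_eq (h := fun x y : nat => x == y)). Qed.

Lemma computable_nat_of_bool (b : E -> bool) :
  computable b -> computable (fun e => b e : nat).
Proof.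
by apply: (computable_raw1 (r := id) (g := nat_of_bool)) => //; apply: mcomputable_proj.
Qed.

Lemma computable_odd n : computable n -> computable (fun e => odd (n e)).
Proof.
move=> Hn; apply: (computable_ext (f := fun e => n e %% 2 == 1)).
  by move=> e; rewrite modn2; case: odd.
apply: (@computable_eqn (fun e => n e %% 2)); last exact: computable_const.
by apply: computable_mod => //; apply: computable_const.
Qed.

Lemma computable_negb (a : E -> bool) : computable a -> computable (fun e => ~~ a e).
Proof.
by move=> Ha; apply: (computable_ext (f := fun e => if a e then false else true)) => [e|];
  [case: (a e)|apply: computable_if => //; apply: computable_const].
Qed.

Lemma computable_andb (a b : E -> bool) :
  computable a -> computable b -> computable (fun e => a e && b e).
Proof. by move=> Ha Hb; apply: computable_if => //; apply: computable_const. Qed.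

Lemma computable_orb (a b : E -> bool) :
  computable a -> computable b -> computable (fun e => a e || b e).
Proof. by move=> Ha Hb; apply: computable_if => //; apply: computable_const. Qed.

Lemma computable_implyb (a b : E -> bool) :
  computable a -> computable b -> computable (fun e => a e ==> b e).
Proof. by move=> Ha Hb; apply: computable_if => //; apply: computable_const. Qed.
End ComputableNat.

Section ComputableList.
Variables E X Y : countType.
Implicit Types s : E -> seq X.

Lemma computable_map (f : E -> X -> Y) s :
  computable (fun p : E * X => f p.1 p.2) -> computable s ->
  computable (fun e => map (f e) (s e)).
Proof.
move=> Hf Hs; apply: (computable_foldr (f := fun e x t => f e x :: t)
  (z := fun=> [::])) => //; last exact: computable_const.
apply: computable_cons; last by computable_proj.
apply: (computable_comp Hf (f := fun p : E * (X * seq Y) => (p.1, p.2.1))).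
by apply: computable_pair; computable_proj.
Qed.

Lemma computable_all (f : E -> pred X) s :
  computable (fun p : E * X => f p.1 p.2) -> computable s ->
  computable (fun e => all (f e) (s e)).
Proof.
move=> Hf Hs; apply: (computable_ext
  (f := fun e => foldr (fun x b => f e x && b) true (s e))).
  by move=> e; elim: (s e) => //= x t ->.
apply: (computable_foldr (f := fun e x b => f e x && b) (z := fun=> true)) => //;
  last exact: computable_const.
apply: computable_andb; last by computable_proj.
apply: (computable_comp Hf (f := fun p : E * (X * bool) => (p.1, p.2.1))).
by apply: computable_pair; computable_proj.
Qed.

Lemma computable_has (f : E -> pred X) s :
  computable (fun p : E * X => f p.1 p.2) -> computable s ->
  computable (fun e => has (f e) (s e)).
Proof.
move=> Hf Hs; apply: (computable_ext (f := fun e => ~~ all (fun x => ~~ f e x) (s e))).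
  move=> e; rewrite -has_predC; apply: eq_has => x /=.
  exact: negbK.
by apply: computable_negb; apply: computable_all => //; apply: computable_negb.
Qed.

Lemma computable_filter (f : E -> pred X) s :
  computable (fun p : E * X => f p.1 p.2) -> computable s ->
  computable (fun e => filter (f e) (s e)).
Proof.
move=> Hf Hs; apply: (computable_ext
  (f := fun e => foldr (fun x t => if f e x then x :: t else t) [::] (s e))).
  by move=> e; elim: (s e) => //= x t ->.
apply: (computable_foldr (f := fun e x t => if f e x then x :: t else t)
  (z := fun=> [::])) => //; last exact: computable_const.
apply: computable_if; last by computable_proj.
  apply: (computable_comp Hf (f := fun p : E * (X * seq X) => (p.1, p.2.1))).
  by apply: computable_pair; computable_proj.
by apply: computable_cons; computable_proj.
Qed.

Lemma computable_size s : computable s -> computable (fun e => size (s e)).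
Proof.
move=> Hs; apply: (computable_ext (f := fun e => foldr (fun _ n => n.+1) 0 (s e))).
  by move=> e; elim: (s e) => //= x t ->.
apply: (computable_foldr (f := fun _ _ n => n.+1) (z := fun=> 0)) => //;
  last exact: computable_const.
by apply: computable_succ; computable_proj.
Qed.

Lemma computable_count (f : E -> pred X) s :
  computable (fun p : E * X => f p.1 p.2) -> computable s ->
  computable (fun e => count (f e) (s e)).
Proof.
move=> Hf Hs; apply: (computable_ext (f := fun e => size (filter (f e) (s e)))).
  by move=> e; rewrite size_filter.
by apply: computable_size; apply: computable_filter.
Qed.

Lemma computable_cat s t :
  computable s -> computable t -> computable (fun e => s e ++ t e).
Proof.
move=> Hs Ht; apply: (computable_ext (f := fun e => foldr cons (t e) (s e))).
  by move=> e; elim: (s e) => //= x t' ->.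
apply: (computable_foldr (f := fun _ x t => x :: t)) => //.
by apply: computable_cons; computable_proj.
Qed.

Lemma computable_head (x0 : X) s :
  computable s -> computable (fun e => head x0 (s e)).
Proof.
move=> Hs; apply: (computable_seqmatch (f := fun=> x0) (g := fun _ x _ => x)) => //.
- exact: computable_const.
- by computable_proj.
Qed.

(** The right fold also carries the untouched suffix, which is what remains after the first
    occurrence has been removed. *)
Lemma computable_rem (x : E -> X) s :
  computable x -> computable s -> computable (fun e => rem (x e) (s e)).
Proof.
move=> Hx Hs; pose f (x : X) y (st : seq X * seq X) :=
  (y :: st.1, if y == x then st.1 else y :: st.2).
apply: (computable_ext (f := fun e => (foldr (f (x e)) ([::], [::]) (s e)).2)).
  move=> e; have E1 t : (foldr (f (x e)) ([::], [::]) t).1 = t.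
    by elim: t => //= y t ->.
  by elim: (s e) => //= y t ->; rewrite E1.
apply: computable_snd; apply: (computable_foldr (f := fun e => f (x e))
   (z := fun=> ([::], [::]))) => //; last exact: computable_const.
apply: computable_pair; first by apply: computable_cons; computable_proj.
apply: computable_if; last by apply: computable_cons; computable_proj.
  apply: computable_eq; first by computable_proj.
  by apply: (computable_comp Hx); computable_proj.
by computable_proj.
Qed.
End ComputableList.

Section ComputableList2.
Variables E X Y : countType.

Lemma computable_flatten (s : E -> seq (seq X)) :
  computable s -> computable (fun e => flatten (s e)).
Proof.
move=> Hs; apply: (computable_foldr (f := fun _ x t => x ++ t) (z := fun=> [::])) => //;
  last exact: computable_const.
by apply: computable_cat; computable_proj.
Qed.

Lemma computable_iota (m n : E -> nat) :
  computable m -> computable n -> computable (fun e => iota (m e) (n e)).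
Proof.
move=> Hm Hn; pose f (m : nat) s := m :: map succn s.
apply: (computable_ext (f := fun e => iter (n e) (f (m e)) [::])).
  move=> e; elim: (n e) => //= k ->; rewrite /f; congr cons.
  by rewrite -[(m e).+1]/(1 + m e) iotaDl.
apply: (computable_iter (f := fun e => f (m e)) (z := fun=> [::])) => //;
  last exact: computable_const.
apply: computable_cons; first by apply: (computable_comp Hm); computable_proj.
apply: (computable_map (f := fun _ => succn)); last by computable_proj.
by apply: computable_succ; computable_proj.
Qed.

Lemma computable_zip (s : E -> seq X) (t : E -> seq Y) :
  computable s -> computable t -> computable (fun e => zip (s e) (t e)).
Proof.
move=> Hs Ht; pose f y (st : seq X * seq (X * Y)) :=
  if st.1 is x :: s' then (s', rcons st.2 (x, y)) else st.
apply: (computable_ext (f := fun e =>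
    (foldl (fun st y => f y st) (s e, [::]) (t e)).2)).
  move=> e; suff H (u : seq (X * Y)) a b :
      (foldl (fun st y => f y st) (a, u) b).2 = u ++ zip a b by rewrite H.
  elim: b a u => [|y b IHb] [|x a] u /=; rewrite ?cats0 //.
    by rewrite [f _ _]/= IHb; case: (b) => *; rewrite cats0.
  by rewrite [f _ _]/= IHb cat_rcons.
apply: computable_snd; apply: (computable_foldl (f := fun _ st y => f y st)
  (z := fun e => (s e, [::]))) => //.
  rewrite /f; apply: (computable_seqmatch (s := fun p : E * (seq X * seq (X * Y) * Y) => p.2.1.1)
    (f := fun p => p.2.1)
    (g := fun p x s' => (s', rcons p.2.1.2 (x, p.2.2)))).
  - by computable_proj.
  - by computable_proj.
  - apply: computable_pair; first by computable_proj.
    have H : computable (fun p : (E * (seq X * seq (X * Y) * Y)) * (X * seq X) =>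
      p.1.2.1.2 ++ [:: (p.2.1, p.1.2.2)]).
      apply: computable_cat; first by computable_proj.
      apply: computable_cons (computable_const _ _).
      by apply: computable_pair; computable_proj.
    by apply: computable_ext H => p; rewrite cats1.
by apply: computable_pair => //; apply: computable_const.
Qed.
End ComputableList2.

(** * Well-quasi-orders *)

Definition wqo_on (X : Type) (D : X -> Prop) (R : X -> X -> Prop) :=
  forall u : nat -> X, (forall n, D (u n)) -> exists i j, i < j /\ R (u i) (u j).

Definition strictly_increasing (phi : nat -> nat) := forall i j, i < j -> phi i < phi j.

Lemma strictly_increasingS phi :
  (forall n, phi n < phi n.+1) -> strictly_increasing phi.
Proof.
move=> phiS i j; elim: j => // j IHj; rewrite ltnS leq_eqVlt => /orP[/eqP->|/IHj] //.
by move=> /ltn_trans->.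
Qed.

(** If infinitely many terms were below no later term, they would form a sequence without a good
    pair. Past the last such term, passing from each term to a later one above it yields the
    subsequence, by transitivity. *)
Lemma wqo_subsequence (X : Type) (D : X -> Prop) (R : X -> X -> Prop) u :
  wqo_on D R -> (forall x y z, R x y -> R y z -> R x z) -> (forall n, D (u n)) ->
  exists phi, strictly_increasing phi /\
    forall i j, i < j -> R (u (phi i)) (u (phi j)).
Proof.
move=> wR trR Du.
have [N HN] : exists N, forall i, N <= i -> exists j, i < j /\ R (u i) (u j).
  apply: NNPP => noN.
  have next N : exists i, N <= i /\ forall j, i < j -> ~ R (u i) (u j).
    apply: NNPP => H; apply: noN; exists N => i le_Ni.
    apply: NNPP => Hj; apply: H; exists i; split=> // j lt_ij Rij.
    by apply: Hj; exists j.
  pose f N := epsilon (inhabits 0) (fun i => N <= i /\ forall j, i < j -> ~ R (u i) (u j)).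
  have fP N := epsilon_spec (inhabits 0) _ (next N).
  pose phi n := iter n (fun k => f k.+1) (f 0).
  have phi_inc : strictly_increasing phi.
    by apply: strictly_increasingS => n; case: (fP (phi n).+1).
  have [i [j [lt_ij Rij]]] := wR (u \o phi) (fun n => Du (phi n)).
  have : forall k, phi i < k -> ~ R (u (phi i)) (u k).
    by case: (i) => [|k]; [case: (fP 0)|case: (fP (phi k).+1)].
  by move=> /(_ _ (phi_inc _ _ lt_ij)).
pose f i := epsilon (inhabits 0) (fun j => i < j /\ R (u i) (u j)).
have fP i : N <= i -> i < f i /\ R (u i) (u (f i)).
  by move=> /HN; apply: (epsilon_spec (inhabits 0)).
pose phi n := iter n f N.
have leN n : N <= phi n.
  elim: n => //= n IHn; have [lt_f _] := fP _ IHn.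
  exact: leq_trans IHn (ltnW lt_f).
exists phi; split.
  by apply: strictly_increasingS => n; case: (fP _ (leN n)).
move=> i j; elim: j => // j IHj; rewrite ltnS leq_eqVlt.
have [_ Rj] := fP _ (leN j).
by case/predU1P => [->|/IHj Rij] //; apply: trR Rij Rj.
Qed.

Lemma wqo_leq : wqo_on (fun=> True) leq.
Proof.
move=> u _; apply: NNPP => H.
have dec i : u i.+1 < u i.
  by rewrite ltnNge; apply/negP => le_u; apply: H; exists i, i.+1.
suff : forall n, u n + n <= u 0 by move=> /(_ (u 0).+1); lia.
by elim=> [|n]; [lia|have := dec n; lia].
Qed.

(** One letter of [F] at a time: a subsequence that is monotone at one letter stays so under further
    extraction. *)
Lemma dickson (X : eqType) (F : seq X) (u : nat -> X -> nat) :
  exists phi, strictly_increasing phi /\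
    forall i j x, i < j -> x \in F -> u (phi i) x <= u (phi j) x.
Proof.
elim: F => [|x F [phi [phiI IH]]]; first by exists id; split.
have [psi [psiI Hpsi]] := wqo_subsequence (u := fun n => u (phi n) x) wqo_leq
  (fun x y z xy yz => leq_trans xy yz) (fun _ => I).
exists (phi \o psi); split=> [i j lt_ij|i j y lt_ij].
  by apply: phiI; apply: psiI.
rewrite in_cons => /predU1P[->|Fy]; first exact: Hpsi.
by apply: IH => //; apply: psiI.
Qed.

(** * Higman's lemma *)

Section Higman.
Variables (X : Type) (D : X -> Prop) (R : X -> X -> Prop).

Inductive subword : seq X -> seq X -> Prop :=
| SubwordNil : subword [::] [::]
| SubwordSkip s y t : subword s t -> subword s (y :: t)
| SubwordKeep x y s t : R x y -> subword s t -> subword (x :: s) (y :: t).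

Fixpoint Forall_seq (s : seq X) : Prop := if s is x :: t then D x /\ Forall_seq t else True.

Lemma subword_nil t : subword [::] t.
Proof. by elim: t => [|y t IHt]; constructor. Qed.

Let bad (u : nat -> seq X) :=
  (forall n, Forall_seq (u n)) /\ (forall i j, i < j -> ~ subword (u i) (u j)).

Let bad_prefix (p : seq (seq X)) :=
  exists u, bad u /\ forall i, i < size p -> u i = nth [::] p i.

(** Nash-Williams' minimal bad sequence: each term has least length among those that prolong the
    previous terms to a bad sequence. No term is empty, and the heads have an ascending subsequence;
    cutting them off along it contradicts minimality. *)
Lemma higman :
  wqo_on D R -> (forall x y z, R x y -> R y z -> R x z) ->
  wqo_on Forall_seq subword.
Proof.
move=> wR trR u0 Du0; apply: NNPP => nou.
have bad0 : bad_prefix [::].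
  by exists u0; split=> //; split=> // i j lt_ij H; apply: nou; exists i, j.
pose minimal p x := bad_prefix (rcons p x) /\
  forall y, bad_prefix (rcons p y) -> size x <= size y.
have next p : bad_prefix p -> exists x, minimal p x.
  move=> [u [bu pu]].
  have: exists n x, bad_prefix (rcons p x) /\ size x = n.
    exists (size (u (size p))), (u (size p)); split=> //; exists u; split=> // i.
    rewrite size_rcons ltnS nth_rcons leq_eqVlt => /predU1P[->|lt_i].
      by rewrite ltnn eqxx.
    by rewrite lt_i pu.
  have {bu pu}: forall n, (exists x, bad_prefix (rcons p x) /\ size x = n) ->
      exists x, minimal p x.
    elim/ltn_ind=> n IHn [x [bx sx]].
    have [[y [b_y lt_y]]|noy] := classic (exists y, bad_prefix (rcons p y) /\ size y < n).
      by apply: (IHn _ lt_y); exists y.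
    exists x; split=> // y b_y; rewrite leqNgt; apply/negP => lt_y.
    by apply: noy; exists y; rewrite -sx.
  by move=> H [n]; apply: H.
pose f p := epsilon (inhabits [::]) (minimal p).
have fP p : bad_prefix p -> minimal p (f p).
  by move=> /next; apply: epsilon_spec.
pose p n := iter n (fun p => rcons p (f p)) [::].
have bp n : bad_prefix (p n) by elim: n => //= n /fP[].
have sp n : size (p n) = n by elim: n => //= n; rewrite size_rcons => ->.
pose m n := f (p n).
have pm n i : i < n -> nth [::] (p n) i = m i.
  elim: n => // n IHn; rewrite ltnS /= nth_rcons sp leq_eqVlt.
  by case/predU1P => [->|lt_i]; [rewrite ltnn eqxx|rewrite lt_i IHn].
have bm : bad m.
  split=> [n|i j lt_ij].
    have [u [[Du _] pu]] := bp n.+1.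
    by rewrite -(@pm n.+1) // -pu ?sp.
  have [u [[_ bu] pu]] := bp j.+1.
  have ui : u i = m i by rewrite pu ?sp ?pm // ltnS ltnW.
  have uj : u j = m j by rewrite pu ?sp ?pm.
  by rewrite -ui -uj; apply: bu.
have [Dm bad_m] := bm.
have m_cons n : exists a s, m n = a :: s.
  case E: (m n) => [|a s]; last by exists a, s.
  by case: (bad_m n n.+1); rewrite ?E //; apply: subword_nil.
have [a0 _] := m_cons 0.
pose a n := head a0 (m n); pose s n := behead (m n).
have mE n : m n = a n :: s n by rewrite /a /s; case: (m_cons n) => ? [? ->].
have Da n : D (a n) by have := Dm n; rewrite mE => -[].
have Ds n : Forall_seq (s n) by have := Dm n; rewrite mE => -[].
have [phi [phiI Ra]] := wqo_subsequence wR trR Da.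
(* The minimal sequence up to [phi 0], then the tails along the subsequence: still bad, but shorter
   at index [phi 0]. *)
pose w n := if n < phi 0 then m n else s (phi (n - phi 0)).
have phi0 n : phi 0 <= phi n by case: n => // n; apply/ltnW/phiI.
have w_bad : bad_prefix (rcons (p (phi 0)) (s (phi 0))).
  exists w; split; last first.
    move=> i; rewrite size_rcons sp ltnS nth_rcons sp /w leq_eqVlt.
    case/predU1P => [->|lt_i]; first by rewrite ltnn eqxx subnn.
    by rewrite lt_i pm.
  split=> [n|i j lt_ij]; rewrite /w; first by case: ifP.
  case: (ltnP j) => [lt_j|le_j]; first by rewrite (ltn_trans lt_ij lt_j); apply: bad_m.
  have key i' k : phi 0 <= phi k -> i' < phi k -> subword (m i') (s (phi k)) -> False.
    move=> _ lt_i H; apply: (bad_m _ _ lt_i); rewrite [m (phi k)]mE.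
    exact: SubwordSkip.
  case: ltnP => [lt_i|le_i] H.
    by apply: key H => //; apply: leq_trans lt_i _.
  have lt_sub : i - phi 0 < j - phi 0 by rewrite ltn_sub2r // (leq_ltn_trans le_i).
  apply: (bad_m _ _ (phiI _ _ lt_sub)); rewrite !mE; apply: SubwordKeep H.
  exact: Ra.
have [_ /(_ _ w_bad)] := fP _ (bp (phi 0)).
by rewrite -/(m (phi 0)) mE /= ltnn.
Qed.
End Higman.

(** If no finite list generated [P], elements of [P] above none of the previous ones could be chosen
    forever, giving a sequence without a good pair. *)
Lemma wqo_finite_basis (X : eqType) (D P : X -> Prop) (R : X -> X -> Prop) :
  wqo_on D R -> (forall x, P x -> D x) ->
  exists b : seq X, (forall x, x \in b -> P x) /\ forall x, P x -> exists2 y, y \in b & R y x.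
Proof.
move=> wR PD; apply: NNPP => nob.
have next (b : seq X) : exists x, (forall x, x \in b -> P x) ->
    P x /\ forall y, y \in b -> ~ R y x.
  have [Pb|nPb] := classic (forall x, x \in b -> P x); last first.
    have [[x _]|nox] := classic (exists x : X, True); first by exists x => /nPb.
    by case: nob; exists [::]; split=> // x; case: nox; exists x.
  apply: NNPP => nox; apply: nob; exists b; split=> // x Px.
  apply: NNPP => noy; apply: nox; exists x => _; split=> // y b_y Ryx.
  by apply: noy; exists y.
have [x0 _] := next [::].
pose f (b : seq X) := epsilon (inhabits x0) (fun x => (forall x, x \in b -> P x) ->
    P x /\ forall y, y \in b -> ~ R y x).
have fP b : (forall x, x \in b -> P x) -> P (f b) /\ forall y, y \in b -> ~ R y (f b).
  exact: (epsilon_spec (inhabits x0) _ (next b)).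
pose b n := iter n (fun b => f b :: b) [::].
have Pb n : forall x, x \in b n -> P x.
  elim: n => // n IHn x; rewrite in_cons => /predU1P[->|/IHn] //.
  by case: (fP _ IHn).
have [i [j [lt_ij Rij]]] := wR (f \o b) (fun n => PD _ (proj1 (fP _ (Pb n)))).
have [_ /(_ (f (b i)))] := fP _ (Pb j); apply=> //.
elim: j lt_ij {Rij} => // j IHj; rewrite ltnS leq_eqVlt in_cons.
by case/predU1P => [->|/IHj->]; rewrite ?eqxx ?orbT.
Qed.

(** * Atoms *)

Section Compare.
Context {d : Order.disp_t} {K : orderType d}.

(* Each common leading component counts 3; 1 and 2 give the direction of the first
   difference. On lists of equal length this is the quantifier-free type of the
   pair in the lexicographic power. *)
Definition cmp (a b : seq K) : nat :=
  foldr (fun p r => if (p.1 < p.2)%O then 1 else if (p.2 < p.1)%O then 2 else r.+3)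
    0 (zip a b).

Lemma cmp_nill b : cmp [::] b = 0. Proof. by case: b. Qed.
Lemma cmp_nilr a : cmp a [::] = 0. Proof. by case: a. Qed.

Lemma cmp_cons x a y b : cmp (x :: a) (y :: b) =
  if (x < y)%O then 1 else if (y < x)%O then 2 else (cmp a b).+3.
Proof. by []. Qed.

Lemma cmp_consE x a b : cmp (x :: a) (x :: b) = (cmp a b).+3.
Proof. by rewrite cmp_cons ltxx. Qed.

Lemma cmp_self a : cmp a a = 3 * size a.
Proof. by elim: a => // x a IHa; rewrite cmp_consE IHa /=; lia. Qed.

Lemma cmp_eq a b : size a = size b -> cmp a b = 3 * size a -> a = b.
Proof.
elim: a b => [|x a IHa] [|y b] //= [sz]; rewrite cmp_cons.
by case: ltgtP => [_|_|->] H; [lia|lia|congr cons; apply: IHa => //; lia].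
Qed.

(** On lists of equal length the residue of [cmp] modulo 3 is the lexicographic comparison: 0 for
    equal, 1 for smaller, 2 for larger. *)
Lemma cmp_mod3 a b : size a = size b -> cmp a b %% 3 = 0 -> a = b.
Proof.
elim: a b => [|x a IHa] [|y b] //= [sz]; rewrite cmp_cons.
by case: ltgtP => [_|_|->] // H; congr cons; apply: IHa => //; lia.
Qed.

Lemma cmp_swap a b : cmp b a %% 3 = (3 - cmp a b %% 3) %% 3.
Proof.
elim: a b => [|x a IHa] [|y b] //=; rewrite ?cmp_nill ?cmp_nilr //.
rewrite !cmp_cons; case: ltgtP => // _.
by have := IHa b; lia.
Qed.

Lemma cmp_lt_trans a b c : size a = size b -> size b = size c ->
  cmp a b %% 3 = 1 -> cmp b c %% 3 = 1 -> cmp a c %% 3 = 1.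
Proof.
elim: a b c => [|x a IHa] [|y b] [|z c] //= [sab] [sbc]; rewrite !cmp_cons.
case: (ltgtP x y) => [xy|_ /eqP//|<-{y}]; case: (ltgtP _ z) => [yz|_ ? /eqP//|yz].
- by rewrite (lt_trans xy yz).
- by rewrite -yz xy.
- by [].
move=> H1 H2; have := IHa b c sab sbc.
by move: H1 H2; lia.
Qed.
End Compare.

(** On lists of a fixed positive length these are the embeddings of the lexicographic power. All
    lengths are treated at once; as [cmp a a] is three times the length of [a], lengths are
    preserved. *)
Definition atom_embedding d d' (K : orderType d) (K' : orderType d')
  (F : seq K -> seq K') := forall a b, cmp (F a) (F b) = cmp a b.

Lemma size_atom_embedding d d' (K : orderType d) (K' : orderType d')
  (F : seq K -> seq K') a : atom_embedding F -> size (F a) = size a.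
Proof. by move=> /(_ a a); rewrite !cmp_self; lia. Qed.

Lemma atom_embedding_inj d d' (K : orderType d) (K' : orderType d')
  (F : seq K -> seq K') : atom_embedding F -> injective F.
Proof.
move=> HF a b Fab; have sab : size a = size b.
  by rewrite -(size_atom_embedding a HF) Fab size_atom_embedding.
by apply: cmp_eq => //; rewrite -HF -Fab HF cmp_self.
Qed.

Lemma atom_embedding_map d d' (K : orderType d) (K' : orderType d') (f : K -> K') :
  {mono f : x y / (x < y)%O} -> atom_embedding (map f).
Proof.
move=> Hf; elim=> [|x a IHa] [|y b] //=.
by rewrite !cmp_cons !Hf IHa.
Qed.

Lemma cmp_map_in d d' (K : orderType d) (K' : orderType d') (f : K -> K') (L : seq K) a b :
  {in L &, {mono f : x y / (x < y)%O}} -> {subset a <= L} -> {subset b <= L} ->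
  cmp (map f a) (map f b) = cmp a b.
Proof.
move=> Hf; elim: a b => [|x a IHa] [|y b] //= aL bL.
have xL : x \in L by rewrite aL ?mem_head.
have yL : y \in L by rewrite bL ?mem_head.
rewrite !cmp_cons !Hf // IHa // => u ua.
  by rewrite aL // in_cons ua orbT.
by rewrite bL // in_cons ua orbT.
Qed.

Lemma seq_min d (K : orderType d) (T : eqType) (f : T -> K) (s : seq T) :
  s != [::] -> exists2 x, x \in s & forall y, y \in s -> (f x <= f y)%O.
Proof.
elim: s => // x [|y s] IHs _; first by exists x; rewrite ?mem_head // => ?; rewrite inE => /eqP->.
have [z zs Hz] := IHs isT.
case: (leP (f x) (f z)) => [xz|/ltW zx].
  exists x; rewrite ?mem_head // => u; rewrite in_cons => /predU1P[->//|/Hz].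
  exact: le_trans.
exists z; first by rewrite in_cons zs orbT.
by move=> u; rewrite in_cons => /predU1P[->|/Hz].
Qed.

(** Induction on the number of points. With [p] the leftmost point and [q] the next one, the
    extension [G] found for the points right of [p] is kept from [q] on and replaced further left by
    the line through [p] and [q]. When nothing lies right of [p], a translation does. *)
Lemma extend_increasing (z : seq (rat * rat)) :
  {in z &, forall p q, (p.1 < q.1)%R = (p.2 < q.2)%R} ->
  exists2 G : rat -> rat, {mono G : x y / (x < y)%O} &
    forall p, p \in z -> G p.1 = p.2.
Proof.
have [n] := ubnP (size z); elim: n z => // n IHn z lt_n Hz.
case: (eqVneq z [::]) => [->|nz]; first by exists id.
have [p pz pmin] := seq_min (fun q => q.1) nz.
pose z' := [seq q <- z | (p.1 < q.1)%R].
have eq_p q : q \in z -> q \notin z' -> q.1 = p.1 /\ q.2 = p.2.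
  move=> qz; rewrite mem_filter qz andbT => npq.
  have E1 : q.1 = p.1 by apply/eqP; rewrite eq_le pmin // andbT leNgt.
  split=> //; apply/eqP; rewrite eq_le !leNgt -!Hz //.
  by rewrite E1 ltxx.
have lt_z' : size z' < n.
  rewrite -ltnS; apply: leq_trans lt_n; rewrite size_filter ltnS.
  rewrite -(count_predC (fun q => (p.1 < q.1)%R) z) -[X in X < _]addn0 ltn_add2l.
  by rewrite -has_count; apply/hasP; exists p => //=; rewrite ltxx.
have [q1 q2|G GM Gz] := IHn _ lt_z'.
  by rewrite !mem_filter => /andP[_ ?] /andP[_ ?]; apply: Hz.
have [z'0|nz'] := eqVneq z' [::].
  exists (fun x => x - p.1 + p.2)%R => [x y|q qz]; first by rewrite ltrD2r ltrD2r.
  have [|-> ->] := eq_p q qz; first by rewrite z'0.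
  by rewrite subrr add0r.
have [q qz' qmin] := seq_min (fun q => q.1) nz'.
have [qz lt_pq] : q \in z /\ (p.1 < q.1)%R by move: qz'; rewrite mem_filter => /andP[].
have lt_pq2 : (p.2 < q.2)%R by rewrite -Hz.
pose s := ((q.2 - p.2) / (q.1 - p.1))%R.
have s_gt0 : (0 < s)%R by rewrite divr_gt0 ?subr_gt0.
pose H x := if (x < q.1)%R then (q.2 - (q.1 - x) * s)%R else G x.
have HH x y : (x < y)%R -> (H x < H y)%R.
  move=> lt_xy; rewrite /H; case: (ltP y q.1) => [lt_y|le_y].
    rewrite (lt_trans lt_xy lt_y) ltrD2l ltrN2 ltr_pM2r //.
    by rewrite ltrD2l ltrN2.
  case: (ltP x q.1) => [lt_x|_]; last by rewrite GM.
  apply: (@lt_le_trans _ _ (G q.1)); last by rewrite leNgt GM -leNgt.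
  by rewrite Gz // ltrBlDr ltrDl mulr_gt0 // subr_gt0.
exists H => [x y|r rz].
  case: (ltgtP x y) => [/HH->//|/HH|->]; last by rewrite ltxx.
  by move=> /ltW; rewrite leNgt => /negbTE.
case rz': (r \in z').
  by rewrite /H ltNge qmin // Gz.
have [|-> ->] := eq_p r rz; first by rewrite rz'.
rewrite /H lt_pq /s mulrCA divff ?mulr1; last by rewrite subr_eq0 gt_eqF.
by rewrite opprB addrC subrK.
Qed.

Definition consistent d d' (K : orderType d) (K' : orderType d')
    (z : seq (seq K * seq K')) :=
  forall p q, p \in z -> q \in z -> cmp p.1 q.1 = cmp p.2 q.2.

(** Homogeneity of the lexicographic powers, by induction on the length: the heads form a finite
    increasing map of rationals, and the tails of the pairs with a given head [q] form a consistent
    family of their own, extended by an embedding [Fq q] that may vary with [q]. *)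
Lemma extend_atom_embedding (z : seq (seq rat * seq rat)) :
  consistent z ->
  exists2 F : seq rat -> seq rat, atom_embedding F & forall p, p \in z -> F p.1 = p.2.
Proof.
have [n] : exists n, forall p, p \in z -> size p.1 < n.
  exists (\max_(p <- z) (size p.1)).+1 => p pz; rewrite ltnS.
  by rewrite (leq_bigmax_seq (F := fun p : seq rat * seq rat => size p.1)).
elim: n z => [|n IHn] z lt_n Hz.
  by exists id => // p /lt_n.
have szz p : p \in z -> size p.1 = size p.2.
  by move=> pz; have := Hz p p pz pz; rewrite !cmp_self => /eqP; rewrite eqn_pmul2l // => /eqP.
pose heads := [seq (head 0%R p.1, head 0%R p.2) | p <- z & p.1 != [::]].
have headsP h : h \in heads -> exists x y a b, h = (x, y) /\ (x :: a, y :: b) \in z.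
  move=> /mapP[[[|x a] [|y b]]]; rewrite mem_filter //= => pz; have := szz _ pz => //.
  by move=> _ ->; exists x, y, a, b; split.
have [|G GM Gz] := @extend_increasing heads.
  move=> h h' /headsP[x [y [a [b [-> pz]]]]] /headsP[x' [y' [a' [b' [-> pz']]]]] /=.
  have := Hz _ _ pz pz' => /=; rewrite !cmp_cons.
  by case: (ltgtP x x'); case: (ltgtP y y').
pose zq q := [seq (behead p.1, behead p.2) | p <- z & (p.1 != [::]) && (head 0%R p.1 == q)].
have zqP q h : h \in zq q -> exists y a b, h = (a, b) /\ (q :: a, y :: b) \in z.
  move=> /mapP[[[|x a] [|y b]]]; rewrite mem_filter //= => /andP[/eqP qx pz];
    have := szz _ pz => //.
  by move=> _ ->; exists y, a, b; rewrite -qx; split.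
have Gxy x y a b : (x :: a, y :: b) \in z -> G x = y.
  move=> H; apply: (Gz (x, y)); apply/mapP; exists (x :: a, y :: b) => //.
  by rewrite mem_filter.
have Hzq q : exists F : seq rat -> seq rat,
    atom_embedding F /\ forall p, p \in zq q -> F p.1 = p.2.
  have [||F FE Fz] := IHn (zq q); last by exists F.
    by move=> h /zqP[y [a [b [-> /lt_n]]]].
  move=> h h' /zqP[y [a [b [-> H]]]] /zqP[y' [a' [b' [-> H']]]] /=.
  have := Hz _ _ H H'; rewrite /= -(Gxy _ _ _ _ H) -(Gxy _ _ _ _ H') !cmp_consE.
  by case.
pose Fq q := proj1_sig (constructive_indefinite_description _ (Hzq q)).
have FqP q : atom_embedding (Fq q) /\ forall p, p \in zq q -> Fq q p.1 = p.2.
  exact: (proj2_sig (constructive_indefinite_description _ (Hzq q))).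
exists (fun a => if a is q :: a' then G q :: Fq q a' else [::]).
  move=> [|x a] [|y b]; rewrite ?cmp_nill ?cmp_nilr //.
  rewrite !cmp_cons !GM; case: ltgtP => // ->.
  by rewrite (proj1 (FqP y)).
move=> [[|x a] [|y b]] pz; have := szz _ pz => //= _.
congr cons; first exact: Gxy pz.
apply: (proj2 (FqP x) (a, b)); apply/mapP; exists (x :: a, y :: b) => //.
by rewrite mem_filter /= eqxx.
Qed.

(** * Words and rewriting *)

(* A word represents a monomial; its letters pair an atom with a place. *)
Notation word K := (seq (seq K * nat)).

Definition rename_word (K K' : Type) (F : seq K -> seq K') (w : word K) : word K' :=
  [seq (F x.1, x.2) | x <- w].

Lemma rename_word_cat K K' (F : seq K -> seq K') u v :
  rename_word F (u ++ v) = rename_word F u ++ rename_word F v.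
Proof. exact: map_cat. Qed.

Lemma rename_word_comp K K' K'' (F : seq K -> seq K') (G : seq K' -> seq K'') w :
  rename_word G (rename_word F w) = rename_word (G \o F) w.
Proof. by rewrite /rename_word -map_comp. Qed.

(** Words are compared position by position, by places and by [cmp] on all pairs of positions. This
    is the decidable substitute for the existence of an embedding that carries one word to the
    other. *)
Definition same_type d d' (K : orderType d) (K' : orderType d') (u : word K) (v : word K') :=
  (size u == size v) &&
  all (fun p => (p.1.2 == p.2.2) &&
    all (fun q => cmp p.1.1 q.1.1 == cmp p.2.1 q.2.1) (zip u v)) (zip u v).

Section SameType.
Context d d' (K : orderType d) (K' : orderType d').
Implicit Types (u : word K) (v : word K').
Let a0 : seq K * nat := ([::], 0).
Let b0 : seq K' * nat := ([::], 0).

Lemma same_type_nth u v : same_type u v <->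
  size u = size v /\ forall i j, i < size u -> j < size u ->
    (nth a0 u i).2 = (nth b0 v i).2 /\
    cmp (nth a0 u i).1 (nth a0 u j).1 = cmp (nth b0 v i).1 (nth b0 v j).1.
Proof.
split=> [/andP[/eqP sz /(all_nthP (a0, b0)) H]|[sz H]].
  have szz : size (zip u v) = size u by rewrite size1_zip // sz.
  split=> // i j lt_i lt_j; have := H i; rewrite szz => /(_ lt_i).
  rewrite nth_zip //= => /andP[/eqP-> /(all_nthP (a0, b0)) /(_ j)].
  by rewrite szz => /(_ lt_j); rewrite nth_zip //= => /eqP.
have szz : size (zip u v) = size u by rewrite size1_zip // sz.
rewrite /same_type sz eqxx; apply/(all_nthP (a0, b0)) => i; rewrite szz => lt_i.
rewrite nth_zip //= (proj1 (H i i lt_i lt_i)) eqxx.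
apply/(all_nthP (a0, b0)) => j; rewrite szz => lt_j.
by rewrite nth_zip //= (proj2 (H i j lt_i lt_j)).
Qed.

Lemma same_type_rename (F : seq K -> seq K') u :
  {in [seq x.1 | x <- u] &, forall a b, cmp (F a) (F b) = cmp a b} ->
  same_type u (rename_word F u).
Proof.
move=> HF; apply/same_type_nth; rewrite size_map; split=> // i j lt_i lt_j.
rewrite !(nth_map a0) //=; split=> //; rewrite HF //.
  by apply/mapP; exists (nth a0 u i); rewrite ?mem_nth.
by apply/mapP; exists (nth a0 u j); rewrite ?mem_nth.
Qed.
End SameType.

Lemma same_type_sym d d' (K : orderType d) (K' : orderType d') (u : word K) (v : word K') :
  same_type u v -> same_type v u.
Proof.
move=> /same_type_nth[sz H]; apply/same_type_nth; split=> // i j lt_i lt_j.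
by rewrite -sz in lt_i lt_j; have [-> ->] := H i j lt_i lt_j.
Qed.

Lemma same_type_trans d d' d'' (K : orderType d) (K' : orderType d') (K'' : orderType d'')
    (u : word K) (v : word K') (w : word K'') :
  same_type u v -> same_type v w -> same_type u w.
Proof.
move=> /same_type_nth[sz H] /same_type_nth[sz' H']; apply/same_type_nth.
split=> [|i j lt_i lt_j]; first by rewrite sz.
have [-> ->] := H i j lt_i lt_j; rewrite sz in lt_i lt_j.
by have [-> ->] := H' i j lt_i lt_j.
Qed.

Lemma same_type_embedding d d' (K : orderType d) (K' : orderType d')
    (F : seq K -> seq K') u :
  atom_embedding F -> same_type u (rename_word F u).
Proof. by move=> HF; apply: same_type_rename => a b _ _; apply: HF. Qed.

(** Matching the atoms at equal positions is a consistent finite family, to which homogeneity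
    applies. *)
Lemma same_typeP (u v : word rat) :
  same_type u v -> exists2 F, atom_embedding F & v = rename_word F u.
Proof.
move=> /same_type_nth[sz H].
have [|F FE Fz] := @extend_atom_embedding (zip (map fst u) (map fst v)).
  have szm : size (map fst u) = size (map fst v) by rewrite !size_map.
  have szz : size (zip (map fst u) (map fst v)) = size u by rewrite size1_zip ?size_map ?sz.
  move=> p q /(nthP ([::], [::]))[i]; rewrite szz => lt_i <-.
  move=> /(nthP ([::], [::]))[j]; rewrite szz => lt_j <-.
  have [_] := H i j lt_i lt_j.
  by rewrite !nth_zip //= !(nth_map ([::], 0)) -?sz.
exists F => //; apply: (@eq_from_nth _ ([::], 0)) => [|i]; first by rewrite size_map sz.
rewrite -sz => lt_i.
rewrite (nth_map ([::], 0)) //.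
have [E _] := H i i lt_i lt_i.
rewrite [LHS]surjective_pairing -E; congr pair.
symmetry; apply: (Fz (_, _)).
have -> : ((nth ([::], 0) u i).1, (nth ([::], 0) v i).1) =
   nth ([::], [::]) (zip (map fst u) (map fst v)) i.
  by rewrite nth_zip ?size_map //= !(nth_map ([::], 0)) -?sz.
by rewrite mem_nth // size1_zip !size_map // sz.
Qed.

(** * The order on letters and on monomials *)

(** Parity of the place comes first so that every hidden letter, at an odd place, exceeds every
    visible one; atoms come next and places last. *)
Definition letter_lt d (K : orderType d) (x y : seq K * nat) :=
  (odd x.2 < odd y.2) || (odd x.2 == odd y.2) &&
    ((cmp x.1 y.1 %% 3 == 1) || (cmp x.1 y.1 %% 3 == 0) && (x.2 < y.2)).

Section LetterOrder.
Context d (K : orderType d).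
Implicit Types x y z : seq K * nat.

Lemma letter_lt_irr x : ~~ letter_lt x x.
Proof. by rewrite /letter_lt ltnn eqxx cmp_self modnMr ltnn. Qed.

Lemma letter_lt_total x y : size x.1 = size y.1 -> x != y ->
  letter_lt x y || letter_lt y x.
Proof.
case: x y => [a p] [b q] /= sab; rewrite /letter_lt /=.
have swap := cmp_swap a b; have lt3 : cmp a b %% 3 < 3 by rewrite ltn_mod.
case: (odd p); case: (odd q) => //=; (have [E|nE _] := eqVneq (cmp a b %% 3) 0;
  last by rewrite swap; move: (cmp a b %% 3) lt3 nE => c; lia);
have ab : a = b by apply: cmp_mod3.
all: by rewrite -ab cmp_self modnMr xpair_eqE eqxx /= neq_ltn.
Qed.

Lemma letter_lt_trans x y z : size x.1 = size y.1 -> size y.1 = size z.1 ->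
  letter_lt x y -> letter_lt y z -> letter_lt x z.
Proof.
case: x y z => [a p] [b q] [c r] /= sab sbc; rewrite /letter_lt /=.
case: (odd p); case: (odd q); case: (odd r) => //=.
all: case/orP => [/eqP H1|/andP[/eqP H1 pq]]; case/orP => [/eqP H2|/andP[/eqP H2 qr]].
all: try by rewrite (cmp_lt_trans sab sbc).
all: try by rewrite -(cmp_mod3 sbc H2) H1.
all: rewrite (cmp_mod3 sab H1) H2 //.
all: by rewrite (ltn_trans pq qr) orbT.
Qed.

Lemma letter_lt_rename d' (K' : orderType d') (F : seq K -> seq K') x y :
  atom_embedding F -> letter_lt (F x.1, x.2) (F y.1, y.2) = letter_lt x y.
Proof. by move=> HF; rewrite /letter_lt /= HF. Qed.
End LetterOrder.

(* [word_lt w' w] means that w' is below w in the lexicographic order on exponent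
   vectors, the letters at odd (hidden) places being the most significant. *)
Definition word_lt d (K : orderType d) (w' w : word K) :=
  has (fun x => (count_mem x w' < count_mem x w) &&
    all (fun y => letter_lt x y ==> (count_mem y w' == count_mem y w)) (w' ++ w)) w.

Definition wf_word d (K : orderType d) l D (w : word K) :=
  all (fun x => (size x.1 == l) && (x.2 < D)) w.

Section WordOrder.
Context d (K : orderType d).
Implicit Types u v w : word K.

Lemma word_ltP w' w : reflect
  (exists x, count_mem x w' < count_mem x w /\
    forall y, letter_lt x y -> count_mem y w' = count_mem y w) (word_lt w' w).
Proof.
apply: (iffP hasP) => [[x _ /andP[lt_x /allP H]]|[x [lt_x H]]].
  exists x; split=> // y xy; have [ys|nys] := boolP (y \in w' ++ w).
    by apply/eqP; have := H y ys; rewrite xy.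
  by move: nys; rewrite mem_cat negb_or => /andP[/count_memPn-> /count_memPn->].
exists x; first by rewrite -has_pred1 has_count (leq_ltn_trans _ lt_x).
by rewrite lt_x; apply/allP => y _; apply/implyP => /H->.
Qed.

Lemma word_lt_perm u u' v v' : perm_eq u u' -> perm_eq v v' -> word_lt u v -> word_lt u' v'.
Proof.
move=> /permP Pu /permP Pv /word_ltP[x [lt_x H]]; apply/word_ltP; exists x.
by rewrite -Pu -Pv; split=> // y /H; rewrite Pu Pv.
Qed.

Lemma word_lt_cat g u v : word_lt (g ++ u) (g ++ v) = word_lt u v.
Proof.
apply/word_ltP/word_ltP => -[x [lt_x H]]; exists x.
  move: lt_x; rewrite !count_cat ltn_add2l; split=> // y /H.
  by rewrite !count_cat => /addnI.
by rewrite !count_cat ltn_add2l; split=> // y /H E; rewrite !count_cat E.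
Qed.

Lemma count_rename d' (K' : orderType d') (F : seq K -> seq K') x w :
  atom_embedding F -> count_mem (F x.1, x.2) (rename_word F w) = count_mem x w.
Proof.
move=> HF; rewrite count_map; apply: eq_count => y /=.
rewrite xpair_eqE (inj_eq (atom_embedding_inj HF)).
by rewrite -xpair_eqE -!surjective_pairing.
Qed.

End WordOrder.

Section WordOrderTheory.
Context d (K : orderType d).
Implicit Types u v w : word K.

Lemma word_lt_rename d' (K' : orderType d') (F : seq K -> seq K') u v :
  atom_embedding F -> word_lt (rename_word F u) (rename_word F v) = word_lt u v.
Proof.
move=> HF; apply/word_ltP/word_ltP => -[x [lt_x H]].
  have /mapP[z zv xz] : x \in rename_word F v.
    by rewrite -has_pred1 has_count (leq_ltn_trans _ lt_x).
  exists z; move: lt_x; rewrite xz !count_rename //; split=> // y zy.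
  by rewrite -!(count_rename _ _ HF); apply: H; rewrite xz letter_lt_rename.
exists (F x.1, x.2); rewrite !count_rename //; split=> // y xy.
have [[z zE]|noz] := classic (exists z, y = (F z.1, z.2)).
  by rewrite zE !count_rename //; apply: H; rewrite -(letter_lt_rename _ _ HF) -zE.
by rewrite !(count_memPn _) //; apply/negP => /mapP[z _ zE]; apply: noz; exists z.
Qed.

(** The larger of the two deciding letters decides for the outer pair. Letters are linearly ordered
    only among atoms of one length, whence the well-formedness. *)
Lemma word_lt_trans l D u v w : wf_word l D u -> wf_word l D v -> wf_word l D w ->
  word_lt u v -> word_lt v w -> word_lt u w.
Proof.
move=> /allP wu /allP wv /allP ww /word_ltP[x [lt_x Hx]] /word_ltP[y [lt_y Hy]].
have sz (t : word K) z : (forall x, x \in t -> (size x.1 == l) && (x.2 < D)) ->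
    0 < count_mem z t -> size z.1 = l.
  by move=> Ht; rewrite -has_count has_pred1 => /Ht/andP[/eqP].
have sx : size x.1 = l by apply: (sz v) => //; apply: leq_ltn_trans lt_x.
have sy : size y.1 = l by apply: (sz w) => //; apply: leq_ltn_trans lt_y.
have count0 (t : word K) z : (forall x, x \in t -> (size x.1 == l) && (x.2 < D)) ->
    size z.1 <> l -> count_mem z t = 0.
  by move=> Ht Hz; apply/count_memPn/negP => /Ht/andP[/eqP].
have [xy|nxy] := eqVneq x y.
  apply/word_ltP; exists y; rewrite -xy in lt_y Hy *.
  split; first exact: ltn_trans lt_y.
  by move=> z xz; rewrite Hx // Hy.
have := letter_lt_total (etrans sx (esym sy)) nxy.
case/orP => [lt_xy|lt_yx]; apply/word_ltP; [exists y|exists x].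
  split; first by rewrite Hx.
  move=> z yz; have [sz_z|nz] := eqVneq (size z.1) l; last by rewrite !count0 //; apply/eqP.
  by rewrite Hx ?Hy //; apply: letter_lt_trans yz; rewrite ?sx ?sy.
split; first by rewrite -Hy.
move=> z xz; have [sz_z|nz] := eqVneq (size z.1) l; last by rewrite !count0 //; apply/eqP.
by rewrite Hx ?Hy //; apply: letter_lt_trans xz; rewrite ?sx ?sy.
Qed.

Lemma seq_max_letter l (s : word K) : (forall x, x \in s -> size x.1 = l) -> s != [::] ->
  exists2 x, x \in s & forall y, y \in s -> ~~ letter_lt x y.
Proof.
elim: s => // x [|y s] IHs Hs _.
  by exists x; rewrite ?mem_head // => y; rewrite inE => /eqP->; apply: letter_lt_irr.
have Hs' z : z \in y :: s -> size z.1 = l by move=> Hz; apply: Hs; rewrite in_cons Hz orbT.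
have [z zs Hz] := IHs Hs' isT.
have sx : size x.1 = l by apply: Hs; rewrite mem_head.
have [lt_zx|nlt] := boolP (letter_lt z x); last first.
  exists z; first by rewrite in_cons zs orbT.
  by move=> u; rewrite in_cons => /predU1P[->|/Hz].
exists x; first exact: mem_head.
move=> u; rewrite in_cons => /predU1P[->|us]; first exact: letter_lt_irr.
apply: contra (Hz u us); apply: letter_lt_trans lt_zx; rewrite ?sx ?Hs' //.
Qed.

(** The largest letter with different multiplicities decides. *)
Lemma word_lt_total l D u v : wf_word l D u -> wf_word l D v ->
  ~~ perm_eq u v -> word_lt u v || word_lt v u.
Proof.
move=> /allP wu /allP wv.
rewrite /perm_eq -has_predC has_filter => /(@seq_max_letter l).
case=> [x|x]; first by rewrite mem_filter mem_cat => /andP[_ /orP[/wu|/wv]] /andP[/eqP].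
rewrite mem_filter /= => /andP[nx _] Hx.
have Hy y : letter_lt x y -> count_mem y u = count_mem y v.
  move=> xy; apply/eqP; apply: contraT => ny.
  have := Hx y; rewrite mem_filter /= ny xy /= => H; apply: H.
  rewrite -[_ \in _]has_pred1 has_count count_cat addn_gt0 !lt0n -negb_and.
  by apply: contraNN ny => /andP[/eqP-> /eqP->].
by move: nx; rewrite neq_ltn => /orP[] lt_x; apply/orP; [left|right];
  apply/word_ltP; exists x; split=> // y /Hy.
Qed.
End WordOrderTheory.

Lemma wf_word_rename d d' (K : orderType d) (K' : orderType d') l D
    (F : seq K -> seq K') (w : word K) :
  atom_embedding F -> wf_word l D (rename_word F w) = wf_word l D w.
Proof.
move=> HF; rewrite /wf_word all_map; apply: eq_all => x /=.
by rewrite (size_atom_embedding _ HF).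
Qed.

Lemma wf_word_perm d (K : orderType d) l D (u v : word K) :
  perm_eq u v -> wf_word l D u = wf_word l D v.
Proof. exact: perm_all. Qed.

(** * Rewriting of monomials up to embedding *)

Definition word_step (R : seq (word rat * word rat)) (w w' : word rat) :=
  exists (r : word rat * word rat) F (g : word rat),
  [/\ r \in R, atom_embedding F, perm_eq w (g ++ rename_word F r.1) &
      perm_eq w' (g ++ rename_word F r.2)].

Inductive star R : word rat -> word rat -> Prop :=
| StarPerm w w' : perm_eq w w' -> star R w w'
| StarStep w w1 w2 : word_step R w w1 -> star R w1 w2 -> star R w w2.

Section Star.
Variable R : seq (word rat * word rat).

Lemma step_perm u u' v v' : perm_eq u u' -> perm_eq v v' -> word_step R u v -> word_step R u' v'.
Proof.
move=> uu' vv' [r [F [g [rR HF Hu Hv]]]]; exists r, F, g; split=> //.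
  by apply: perm_trans Hu; rewrite perm_sym.
by apply: perm_trans Hv; rewrite perm_sym.
Qed.

Lemma star_refl w : star R w w. Proof. exact: StarPerm. Qed.

Lemma star_perml u u' v : perm_eq u u' -> star R u v -> star R u' v.
Proof.
move=> uu' H; case: H uu' => [w w' ww'|w w1 w2 H1 H2] wu.
  by apply: StarPerm; apply: perm_trans ww'; rewrite perm_sym.
by apply: StarStep H2; apply: step_perm H1.
Qed.

Lemma star_trans u v w : star R u v -> star R v w -> star R u w.
Proof.
elim=> [x y xy|x x1 x2 Hx _ IH] H; last by apply: StarStep Hx (IH H).
by apply: star_perml H; rewrite perm_sym.
Qed.

Lemma star_permr u v v' : perm_eq v v' -> star R u v -> star R u v'.
Proof. by move=> vv' /star_trans; apply; apply: StarPerm. Qed.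

Lemma star_step u v : word_step R u v -> star R u v.
Proof. by move=> H; apply: StarStep H (star_refl _). Qed.

Lemma step_cat g u v : word_step R u v -> word_step R (g ++ u) (g ++ v).
Proof.
move=> [r [F [h [rR HF Hu Hv]]]]; exists r, F, (g ++ h); split=> //.
  by rewrite -catA perm_cat2l.
by rewrite -catA perm_cat2l.
Qed.

Lemma star_cat g u v : star R u v -> star R (g ++ u) (g ++ v).
Proof.
elim=> [x y xy|x x1 x2 Hx _ IH]; first by apply: StarPerm; rewrite perm_cat2l.
exact: StarStep (step_cat _ Hx) IH.
Qed.

Lemma step_rename F u v : atom_embedding F -> word_step R u v ->
  word_step R (rename_word F u) (rename_word F v).
Proof.
move=> HF [r [G [h [rR HG Hu Hv]]]]; exists r, (F \o G), (rename_word F h); split=> //.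
- by move=> a b; rewrite /= HF.
- by rewrite -rename_word_comp -rename_word_cat perm_map.
- by rewrite -rename_word_comp -rename_word_cat perm_map.
Qed.

Lemma star_rename F u v : atom_embedding F -> star R u v ->
  star R (rename_word F u) (rename_word F v).
Proof.
move=> HF; elim=> [x y xy|x x1 x2 Hx _ IH]; first by apply: StarPerm; apply: perm_map.
exact: StarStep (step_rename HF Hx) IH.
Qed.

Definition joinable u v := exists w, star R u w /\ star R v w.

Lemma joinable_refl u : joinable u u. Proof. by exists u; split; apply: star_refl. Qed.

Lemma joinable_sym u v : joinable u v -> joinable v u.
Proof. by move=> [w []]; exists w. Qed.

Lemma joinable_perm u u' v v' :
  perm_eq u u' -> perm_eq v v' -> joinable u v -> joinable u' v'.
Proof. by move=> uu' vv' [w [H1 H2]]; exists w; split; apply: star_perml; eauto. Qed.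

Lemma joinable_cat g u v : joinable u v -> joinable (g ++ u) (g ++ v).
Proof. by move=> [w [H1 H2]]; exists (g ++ w); split; apply: star_cat. Qed.

Lemma joinable_rename F u v : atom_embedding F -> joinable u v ->
  joinable (rename_word F u) (rename_word F v).
Proof. by move=> HF [w [H1 H2]]; exists (rename_word F w); split; apply: star_rename. Qed.

(** The usual well-founded induction, relative to a property kept by the steps, because termination
    will be known for well-formed words. *)
Lemma newman (P : word rat -> Prop) :
  (forall u v, P u -> word_step R u v -> P v) ->
  (forall u, P u -> Acc (fun v u => word_step R u v) u) ->
  (forall u v w, P u -> word_step R u v -> word_step R u w -> joinable v w) ->
  forall u v w, P u -> star R u v -> star R u w -> joinable v w.
Proof.
move=> Pstep Pacc lc u v w Pu; have acc := Pacc u Pu.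
elim: acc v w Pu => {Pacc}u _ IH v w Pu H1 H2.
case: H1 IH Pu H2 => {u v}[u v uv|u u1 v Hu1 H1] IH Pu H2.
  by exists w; split; [apply: star_perml H2|apply: star_refl].
case: H2 IH Pu Hu1 => {u w}[u w uw|u u2 w Hu2 H2] IH Pu Hu1.
  exists v; split; first exact: star_refl.
  by apply: star_perml uw _; apply: StarStep Hu1 H1.
have [x [Hx1 Hx2]] := lc _ _ _ Pu Hu1 Hu2.
have [y [Hy1 Hy2]] := IH u1 Hu1 v x (Pstep _ _ Pu Hu1) H1 Hx1.
have [z [Hz1 Hz2]] := IH u2 Hu2 y w (Pstep _ _ Pu Hu2) (star_trans Hx2 Hy2) H2.
by exists z; split=> //; apply: star_trans Hz1.
Qed.

(* Termination: by Dickson's lemma a strictly decreasing sequence of monomials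
   in finitely many letters is finite. *)
Variables l D : nat.
Hypothesis R_wf : forall r : word rat * word rat, r \in R -> [/\ wf_word l D r.1, wf_word l D r.2,
  word_lt r.2 r.1 & {subset map fst r.2 <= map fst r.1}].

Lemma step_wf u v : word_step R u v -> wf_word l D u -> wf_word l D v.
Proof.
move=> [r [F [g [/R_wf[w1 w2 _ _] HF Hu Hv]]]].
rewrite (wf_word_perm _ _ Hu) (wf_word_perm _ _ Hv) /wf_word !all_cat => /andP[-> _].
by rewrite -[all _ _]/(wf_word l D _) wf_word_rename.
Qed.

Lemma step_lt u v : word_step R u v -> word_lt v u.
Proof.
move=> [r [F [g [/R_wf[_ _ lt_r _] HF Hu Hv]]]].
apply: (@word_lt_perm _ _ (g ++ rename_word F r.2) _ (g ++ rename_word F r.1)).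
- by rewrite perm_sym.
- by rewrite perm_sym.
by rewrite word_lt_cat word_lt_rename.
Qed.

Lemma step_atoms u v : word_step R u v -> {subset map fst v <= map fst u}.
Proof.
move=> [r [F [g [/R_wf[_ _ _ sub] HF /(perm_map fst)/perm_mem Hu
  /(perm_map fst)/perm_mem Hv]]]] a.
rewrite Hu Hv !map_cat !mem_cat => /orP[->//|/mapP[_ /mapP[x xr ->] ->]] /=.
have /sub/mapP[y yr xy] : x.1 \in map fst r.2 by apply: map_f.
by rewrite xy; apply/orP; right; apply/mapP; exists (F y.1, y.2) => //; apply: map_f.
Qed.

(** Steps create no atom, so an infinite derivation uses only the letters of the finite list [F].
    Dickson's lemma finds two of its words, the later with no multiplicity smaller, whereas the
    later one, being below the other, has fewer occurrences of some letter. *)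
Lemma step_acc u : wf_word l D u -> Acc (fun v u => word_step R u v) u.
Proof.
move=> wu; apply: NNPP => nacc.
have next w : exists w', ~ Acc (fun v u => word_step R u v) w ->
    word_step R w w' /\ ~ Acc (fun v u => word_step R u v) w'.
  have [|nw] := classic (Acc (fun v u => word_step R u v) w); first by exists w.
  apply: NNPP => H; apply: nw; constructor => w' ww'; apply: NNPP => nw'.
  by apply: H; exists w' => _.
pose f w := epsilon (inhabits u) (fun w' => ~ Acc (fun v u => word_step R u v) w ->
    word_step R w w' /\ ~ Acc (fun v u => word_step R u v) w').
have fP w := epsilon_spec (inhabits u) _ (next w).
pose s n := iter n f u.
have nacc_s n : ~ Acc (fun v u => word_step R u v) (s n).
  by elim: n => // n /fP[].
have step_s n : word_step R (s n) (s n.+1) by have [] := fP _ (nacc_s n).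
have wf_s n : wf_word l D (s n) by elim: n => // n; apply: step_wf.
have sub_s n : {subset map fst (s n) <= map fst u}.
  by elim: n => // n IHn a /(step_atoms (step_s n))/IHn.
have lt_s i j : i < j -> word_lt (s j) (s i).
  elim: j => // j IHj; rewrite ltnS leq_eqVlt => /predU1P[->|/IHj lt_ij].
    exact: step_lt.
  by apply: word_lt_trans lt_ij => //; apply: step_lt.
pose F := [seq (a, p) | a <- map fst u, p <- iota 0 D].
have [phi [phiI Hphi]] := dickson F (fun n x => count_mem x (s n)).
have /word_ltP[x [lt_x _]] := lt_s _ _ (phiI 0 1 isT).
have xs : x \in s (phi 0) by rewrite -has_pred1 has_count (leq_ltn_trans _ lt_x).
have xF : x \in F.
  apply/allpairsP; exists x; split; last exact: surjective_pairing.
    by apply: (sub_s (phi 0)); apply: map_f.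
  by have /allP/(_ _ xs)/andP[_] := wf_s (phi 0); rewrite mem_iota.
by have := Hphi 0 1 x isT xF; rewrite leqNgt lt_x.
Qed.
End Star.

(** * Well-quasi-ordering of words *)

Definition seq_diff (T : eqType) (s t : seq T) := foldr (fun x s => rem x s) s t.

Lemma count_seq_diff (T : eqType) (s t : seq T) x :
  count_mem x (seq_diff s t) = count_mem x s - count_mem x t.
Proof.
elim: t => [|y t IHt] /=; first by rewrite subn0.
rewrite count_rem -/(seq_diff s t) IHt /=; have [->|nyx] := eqVneq y x; last first.
  by rewrite andbF subn0.
rewrite andbT; have [E|/count_memPn] := boolP (x \in seq_diff s t); first by lia.
by rewrite IHt; lia.
Qed.

Lemma perm_seq_diff (T : eqType) (s t : seq T) :
  (forall x, count_mem x t <= count_mem x s) -> perm_eq s (seq_diff s t ++ t).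
Proof.
by move=> le_ts; apply/allP => x _; rewrite /= count_cat count_seq_diff subnK.
Qed.

Definition divides (u v : word rat) := exists F g,
  atom_embedding F /\ perm_eq v (g ++ rename_word F u).

Lemma divides_trans u v w : divides u v -> divides v w -> divides u w.
Proof.
move=> [F [g [HF uv]]] [G [h [HG vw]]].
exists (G \o F), (h ++ rename_word G g); split; first by move=> a b; rewrite /= HG.
rewrite -rename_word_comp -catA -rename_word_cat.
by apply: (perm_trans vw); rewrite perm_cat2l perm_map.
Qed.

Lemma divides_count (F : seq rat -> seq rat) u v : atom_embedding F ->
  (forall x, count_mem x (rename_word F u) <= count_mem x v) -> divides u v.
Proof.
move=> HF H; exists F, (seq_diff v (rename_word F u)); split=> //.
exact: perm_seq_diff.
Qed.

Lemma wf_word_size0 D (u : word rat) x :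
  wf_word 0 D u -> x \notin [seq ([::] : seq rat, p) | p <- iota 0 D] -> count_mem x u = 0.
Proof.
move=> /allP wu nx; apply/count_memPn; apply: contra nx => /wu /andP[].
rewrite size_eq0 => /eqP x0 ltD; apply/mapP; exists x.2; first by rewrite mem_iota.
by rewrite -x0 -surjective_pairing.
Qed.

(** The empty list is the only atom of length 0, so this is Dickson's lemma for [D] letters. *)
Lemma wqo_words0 D : wqo_on (fun w => wf_word 0 D w) divides.
Proof.
move=> u wu; pose F := [seq ([::] : seq rat, p) | p <- iota 0 D].
have [phi [phiI Hphi]] := dickson F (fun n x => count_mem x (u n)).
exists (phi 0), (phi 1); split; first exact: phiI.
have E (w : word rat) : rename_word id w = w by rewrite -[RHS]map_id; apply: eq_map => -[].
apply: (@divides_count id) => // x; rewrite E.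
have [xF|nxF] := boolP (x \in F); first exact: Hphi.
by rewrite (wf_word_size0 (wu _) nxF).
Qed.

Section Blocks.
Variables l D : nat.
Implicit Types w : word rat.

Definition block w q : word rat :=
  [seq (behead x.1, x.2) | x <- w & head 0%R x.1 == q].

Definition block_heads w : seq rat := sort <=%R (undup [seq head 0%R x.1 | x <- w]).

Lemma wf_block w q : wf_word l.+1 D w -> wf_word l D (block w q).
Proof.
move=> /allP ww; apply/allP => _ /mapP[x + ->]; rewrite mem_filter => /andP[_ /ww].
by rewrite /= size_behead; case: (size x.1) => //= n; rewrite eqSS.
Qed.

Lemma block_heads_sorted w : sorted <%R (block_heads w).
Proof.
by rewrite lt_sorted_uniq_le sort_uniq undup_uniq sort_sorted //; apply: le_total.
Qed.

Lemma count_block_rename (G : rat -> rat) (Fq : rat -> seq rat -> seq rat) w q a p :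
  injective G -> wf_word l.+1 D w ->
  count_mem (G q :: a, p) (rename_word (fun a => if a is h :: t then G h :: Fq h t else [::]) w) =
  count_mem (a, p) (rename_word (Fq q) (block w q)).
Proof.
move=> injG /allP ww; rewrite !count_map count_filter.
apply: eq_in_count => -[[|h t] r] /ww //= _.
rewrite !xpair_eqE eqseq_cons (inj_eq injG).
by have [->|_] := eqVneq h q; rewrite ?andbF // andbT.
Qed.

Lemma count_block w q a p : wf_word l.+1 D w ->
  count_mem (q :: a, p) w = count_mem (a, p) (block w q).
Proof.
move=> /(count_block_rename (fun=> id) q a p (@inj_id _)).
set F := (fun a => _); have -> : rename_word F w = w.
  by rewrite -[RHS]map_id; apply: eq_map => -[[]].
by move=> ->; congr count; rewrite /rename_word -[RHS]map_id; apply: eq_map => -[].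
Qed.

Lemma subword_matching (bu bv : rat -> word rat) (hs ks : seq rat) :
  sorted <%R hs -> sorted <%R ks -> subword divides (map bu hs) (map bv ks) ->
  exists z : seq (rat * rat), [/\ forall q, q \in hs -> exists k, (q, k) \in z,
    forall p, p \in z -> [/\ p.1 \in hs, p.2 \in ks & divides (bu p.1) (bv p.2)] &
    {in z &, forall p q, (p.1 < q.1)%R = (p.2 < q.2)%R}].
Proof.
elim: ks hs => [|k ks IHks] [|h hs] //=; try by move=> *; exists [::].
  by move=> _ _ H; inversion H.
move=> sh sk H; have sk' := path_sorted sk.
inversion H as [|s y t Hskip|x y s t Rhk Hkeep].
  have [z [z1 z2 z3]] := IHks (h :: hs) sh sk' Hskip.
  exists z; split=> // p /z2[p1 p2 p3]; split=> //.
  by rewrite in_cons p2 orbT.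
have [z [z1 z2 z3]] := IHks hs (path_sorted sh) sk' Hkeep.
have minh := allP (order_path_min lt_trans sh).
have mink := allP (order_path_min lt_trans sk).
exists ((h, k) :: z); split.
- move=> q; rewrite in_cons => /predU1P[->|/z1[k' zk]].
    by exists k; rewrite mem_head.
  by exists k'; rewrite in_cons zk orbT.
- move=> p; rewrite in_cons => /predU1P[->|/z2[p1 p2 p3]]; first by rewrite !mem_head.
  by rewrite !in_cons p1 p2 !orbT.
move=> p q; rewrite !in_cons => /predU1P[->|pz] /predU1P[->|qz] /=; last exact: z3.
- by rewrite !ltxx.
- by have [q1 q2 _] := z2 _ qz; rewrite minh // mink.
have [p1 p2 _] := z2 _ pz; have := minh _ p1; have := mink _ p2.
by move=> /lt_gtF-> /lt_gtF->.
Qed.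

(** The matching of heads extends to an increasing map [G] of the rationals. It acts on first
    coordinates, while the tails over each head [q] are moved by the embedding that makes the block
    at [q] divide its partner. *)
Lemma divides_blocks u v : wf_word l.+1 D u -> wf_word l.+1 D v ->
  subword divides (map (block u) (block_heads u)) (map (block v) (block_heads v)) ->
  divides u v.
Proof.
move=> wu wv.
move=> /(subword_matching (block_heads_sorted u) (block_heads_sorted v)).
move=> [z [z1 z2 z3]].
have [G GM Gz] := extend_increasing z3.
have G_inj : injective G.
  by move=> x y Gxy; apply/eqP; rewrite eq_le !leNgt -(GM x y) -(GM y x) Gxy ltxx.
have HF q : exists F : seq rat -> seq rat, atom_embedding F /\ forall x,
    count_mem x (rename_word F (block u q)) <= count_mem x (block v (G q)).
  (* A value that heads no letter of [u] has an empty block, and any embedding will do. *)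
  have [qu|nqu] := boolP (q \in block_heads u); last first.
    exists id; split=> // x; suff -> : block u q = [::] by [].
    rewrite /block; case E: [seq x <- u | _] => [//|y s]; case/negP: nqu.
    have : y \in [seq x <- u | head 0%R x.1 == q] by rewrite E mem_head.
    rewrite mem_filter => /andP[/eqP <- yu].
    by rewrite mem_sort mem_undup; apply/mapP; exists y.
  have [k zk] := z1 q qu; have [_ _ /= [F [g [HF Hg]]]] := z2 _ zk.
  exists F; split=> // x; rewrite (Gz _ zk) /= (permP Hg) count_cat.
  exact: leq_addl.
pose Fq q := proj1_sig (constructive_indefinite_description _ (HF q)).
have FqP q := proj2_sig (constructive_indefinite_description _ (HF q)).
pose F a := if a is h :: t then G h :: Fq h t else [::].
have FE : atom_embedding F.
  move=> [|x a] [|y b]; rewrite ?cmp_nill ?cmp_nilr //.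
  rewrite !cmp_cons !GM; case: ltgtP => // ->.
  by rewrite (proj1 (FqP y)).
apply: (divides_count FE) => -[[|q a] p].
  rewrite (_ : count_mem _ _ = 0) //; apply/count_memPn/mapP => -[[[|h t] r]] //.
  by move=> /(allP wu).
have [[q' ->]|nq] := classic (exists q', q = G q').
  by rewrite (count_block_rename Fq q' a p G_inj wu) (count_block _ _ _ wv) (proj2 (FqP q')).
rewrite (_ : count_mem _ _ = 0) //; apply/count_memPn/mapP => -[[[|h t] r]] // _ [qE _ _].
by apply: nq; exists h.
Qed.
End Blocks.

(** A monomial over atoms of length [l.+1] is read as the sequence of its blocks in increasing order
    of heads, each block being a monomial over atoms of length [l]. *)
Lemma wqo_words l D : wqo_on (fun w => wf_word l D w) divides.
Proof.
elim: l => [|l IHl]; first exact: wqo_words0.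
move=> u wu.
have [n|i [j [lt_ij H]]] := higman IHl divides_trans
    (u := fun n => map (block (u n)) (block_heads (u n))).
  by elim: (block_heads _) => //= q hs IHhs; split=> //; apply: wf_block.
by exists i, j; split=> //; apply: divides_blocks H.
Qed.

(** * Soundness of Groebner bases *)

(* Counting at one fixed type: [lia] compares atoms syntactically, and the types
   of equal words may agree only up to unfolding of canonical structures. *)
Definition cnt (p : pred (seq rat * nat)) (w : word rat) : nat := count p w.

Lemma cnt_perm p (u v : word rat) : perm_eq u v -> cnt p u = cnt p v.
Proof. by move/permP. Qed.

Lemma perm_cnt (u v : word rat) : (forall p, cnt p u = cnt p v) -> perm_eq u v.
Proof. by move=> H; apply/permP. Qed.

Lemma cnt_cat p (u v : word rat) : cnt p (u ++ v) = cnt p u + cnt p v.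
Proof. exact: count_cat. Qed.

Lemma cnt_cons p x (u : word rat) : cnt p (x :: u) = p x + cnt p u.
Proof. by []. Qed.

Lemma cnt_nil p : cnt p [::] = 0. Proof. by []. Qed.

Ltac count_lia := rewrite ?cnt_cat; repeat match goal with
  |- context [cnt ?p ?s] => generalize (cnt p s) end; clear; lia.

(* Place i of the net becomes a visible place 2i+2 and a hidden place 2i+3; places
   0 and 1 hold the marks of visible and of hidden atoms. *)
Section Places.
Context (K : Type).
Implicit Types w : word K.

Definition visible_copy w := [seq (x.1, x.2.*2.+2) | x <- w].
Definition hidden_copy w := [seq (x.1, x.2.*2.+3) | x <- w].
Definition marks p w : word K := [seq (x.1, p) | x <- w].

Definition visible w := [seq x <- w | ~~ odd x.2].
Definition hidden w := [seq x <- w | odd x.2].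
Definition mark_part w := [seq x <- w | x.2 < 2].
Definition hidden_marks_only w := all (fun x => odd x.2 ==> (x.2 == 1)) w.

Definition visible_rules (B : seq (word K * word K)) :=
  [seq (visible r.1, visible r.2) | r <- B & hidden_marks_only r.1].

End Places.

(** Every letter needs a mark of its own colour at its atom; the places of marks, 0 and 1, are the
    two parities, so a mark is its own witness. *)
Definition has_marks (K : eqType) (w : word K) :=
  all (fun x => (x.1, odd x.2 : nat) \in w) w.

Lemma perm_visible_hidden (K : eqType) (w : word K) : perm_eq w (visible w ++ hidden w).
Proof.
by rewrite /visible /hidden perm_sym perm_catC; apply: permEl; apply: perm_filterC.
Qed.

(** The last clause concerns rules without hidden tokens on the left: their hidden part is not
    touched, which is what makes [visible_rules] meaningful. *)
Definition rule_ok d (K : orderType d) l D (r : word K * word K) :=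
  [&& wf_word l D r.1, wf_word l D r.2, word_lt r.2 r.1,
      perm_eq (mark_part r.1) (mark_part r.2), has_marks r.2 &
      hidden_marks_only r.1 ==> perm_eq (hidden r.1) (hidden r.2)].

(** An atom of the right side carries a mark there, and both sides have the same marks. *)
Lemma rule_ok_atoms d (K : orderType d) l D (r : word K * word K) :
  rule_ok l D r -> {subset map fst r.2 <= map fst r.1}.
Proof.
move=> /and5P[_ _ _ Hm /andP[/allP Hh _]] _ /mapP[x xr ->].
have : (x.1, odd x.2 : nat) \in mark_part r.2.
  by rewrite mem_filter Hh // andbT /=; case: odd.
rewrite -(perm_mem Hm) mem_filter => /andP[_ H].
by apply/mapP; exists (x.1, odd x.2 : nat).
Qed.

Lemma rule_ok_visible_atoms d (K : orderType d) l D (r : word K * word K) :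
  rule_ok l D r -> {subset map fst (visible r.2) <= map fst (visible r.1)}.
Proof.
move=> /and5P[_ _ _ Hm /andP[/allP Hh _]] _ /mapP[x + ->].
rewrite mem_filter => /andP[/negbTE ex xr].
have : (x.1, 0) \in mark_part r.2 by rewrite mem_filter /=; have := Hh _ xr; rewrite ex.
rewrite -(perm_mem Hm) mem_filter => /andP[_ H].
by apply/mapP; exists (x.1, 0); rewrite // mem_filter.
Qed.

Section RenamePlaces.
Variables (K K' : Type) (F : seq K -> seq K').
Implicit Types w : word K.

Lemma visible_rename w : visible (rename_word F w) = rename_word F (visible w).
Proof. by rewrite /visible filter_map. Qed.
Lemma hidden_rename w : hidden (rename_word F w) = rename_word F (hidden w).
Proof. by rewrite /hidden filter_map. Qed.
Lemma mark_part_rename w : mark_part (rename_word F w) = rename_word F (mark_part w).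
Proof. by rewrite /mark_part filter_map. Qed.
Lemma visible_copy_rename w : visible_copy (rename_word F w) = rename_word F (visible_copy w).
Proof. by rewrite /visible_copy /rename_word -!map_comp. Qed.
Lemma hidden_copy_rename w : hidden_copy (rename_word F w) = rename_word F (hidden_copy w).
Proof. by rewrite /hidden_copy /rename_word -!map_comp. Qed.
Lemma marks_rename p w : marks p (rename_word F w) = rename_word F (marks p w).
Proof. by rewrite /marks /rename_word -!map_comp. Qed.
End RenamePlaces.

Lemma hidden_copy_cat (K : Type) (u v : word K) :
  hidden_copy (u ++ v) = hidden_copy u ++ hidden_copy v.
Proof. exact: map_cat. Qed.
Lemma marks_cat (K : Type) p (u v : word K) : marks p (u ++ v) = marks p u ++ marks p v.
Proof. exact: map_cat. Qed.

Lemma wf_word_cat d (K : orderType d) l D (u v : word K) :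
  wf_word l D (u ++ v) = wf_word l D u && wf_word l D v.
Proof. exact: all_cat. Qed.

(* [B] is a Groebner basis of a congruence containing [T] on hidden copies, in
   which hidden and visible copies of a marked atom are interchangeable, and it
   tells the visible copies of [s] and [t] apart. [visible_rules B] is the action
   of [B] on monomials without hidden tokens, the marks of hidden atoms being
   available in any number. *)
Definition separates l d (B T : seq (word rat * word rat)) (s t : word rat) :=
  let D := d.*2.+2 in
  [/\ forall r : word rat * word rat, r \in B -> rule_ok l D r,
      forall (r1 r2 : word rat * word rat) F1 F2,
        r1 \in B -> r2 \in B -> atom_embedding F1 -> atom_embedding F2 ->
        let k1 := rename_word F1 r1.1 in let k2 := rename_word F2 r2.1 in
        joinable B (seq_diff k2 k1 ++ rename_word F1 r1.2)
                   (seq_diff k1 k2 ++ rename_word F2 r2.2),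
      forall r : word rat * word rat, r \in T ->
        joinable B (hidden_copy r.1 ++ marks 1 (r.1 ++ r.2))
                   (hidden_copy r.2 ++ marks 1 (r.1 ++ r.2)),
      forall a i, size a = l -> i < d ->
        joinable B [:: (a, i.*2.+3); (a, 0); (a, 1)] [:: (a, i.*2.+2); (a, 0); (a, 1)] &
      exists s0 t0,
        [/\ star (visible_rules B) (visible_copy s ++ marks 0 (s ++ t)) s0,
            star (visible_rules B) (visible_copy t ++ marks 0 (s ++ t)) t0,
            forall x, ~ word_step (visible_rules B) s0 x,
            forall x, ~ word_step (visible_rules B) t0 x & ~~ perm_eq s0 t0]].

(** [seq_diff k2 k1 ++ k1] is the least common multiple of [k1] and [k2]. A word divisible by both
    is this multiple times a context, and [seq_diff g1 (seq_diff k2 k1)] is that context. *)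
Lemma perm_critical (X : eqType) (u v g1 g2 k1 k2 k1' : seq X) :
  perm_eq u (g1 ++ k1) -> perm_eq u (g2 ++ k2) -> perm_eq v (g1 ++ k1') ->
  perm_eq (seq_diff g1 (seq_diff k2 k1) ++ seq_diff k2 k1 ++ k1') v.
Proof.
move=> /permP H1 /permP H2 /permP H3; apply/allP => x _ /=; apply/eqP.
rewrite H3 !count_cat !count_seq_diff.
by have := H1 (pred1 x); rewrite H2 !count_cat; lia.
Qed.

Lemma perm_critical_context (X : eqType) (u g1 g2 k1 k2 : seq X) :
  perm_eq u (g1 ++ k1) -> perm_eq u (g2 ++ k2) ->
  perm_eq (seq_diff g1 (seq_diff k2 k1)) (seq_diff g2 (seq_diff k1 k2)).
Proof.
move=> /permP H1 /permP H2; apply/allP => x _ /=; apply/eqP.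
rewrite !count_seq_diff.
by have := H1 (pred1 x); rewrite H2 !count_cat; lia.
Qed.

Section Soundness.
Variables l d : nat.
Variables (B T : seq (word rat * word rat)).
Let D := d.*2.+2.
Implicit Types u v w : word rat.
Hypothesis B_ok : forall r : word rat * word rat, r \in B -> rule_ok l D r.
Hypothesis T_wf : forall r : word rat * word rat, r \in T -> wf_word l d r.1 && wf_word l d r.2.

Lemma rules_wf (r : word rat * word rat) : r \in B -> [/\ wf_word l D r.1, wf_word l D r.2,
  word_lt r.2 r.1 & {subset map fst r.2 <= map fst r.1}].
Proof. by move=> /B_ok rok; have := rule_ok_atoms rok; case/and5P: rok. Qed.

Hypothesis B_critical :
  forall (r1 r2 : word rat * word rat) F1 F2,
    r1 \in B -> r2 \in B -> atom_embedding F1 -> atom_embedding F2 ->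
    let k1 := rename_word F1 r1.1 in let k2 := rename_word F2 r2.1 in
    joinable B (seq_diff k2 k1 ++ rename_word F1 r1.2)
               (seq_diff k1 k2 ++ rename_word F2 r2.2).

(** Two steps from one word are a critical pair in a common context, even when the two factors do
    not overlap; local confluence follows, then Newman's lemma. *)
Lemma confluent u v w : wf_word l D u -> star B u v -> star B u w -> joinable B v w.
Proof.
apply: (@newman B (fun w => wf_word l D w)).
- by move=> x y wx xy; apply: (step_wf rules_wf) xy wx.
- exact: (step_acc rules_wf).
move=> {}u {}v {}w wu [r1 [F1 [g1 [r1B HF1 Hu1 Hv]]]] [r2 [F2 [g2 [r2B HF2 Hu2 Hw]]]].
set k1 := rename_word F1 r1.1 in Hu1; set k2 := rename_word F2 r2.1 in Hu2.
have H := B_critical r1B r2B HF1 HF2; rewrite /= -/k1 -/k2 in H.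
pose g := seq_diff g1 (seq_diff k2 k1).
apply: joinable_perm (joinable_cat g H); first exact: (perm_critical Hu1 Hu2 Hv).
apply: perm_trans (perm_critical Hu2 Hu1 Hw); rewrite perm_cat2r.
exact: perm_critical_context Hu1 Hu2.
Qed.

(** Confluence brings together the two reducts of the middle word. *)
Lemma joinable_trans u v w : wf_word l D v ->
  joinable B u v -> joinable B v w -> joinable B u w.
Proof.
move=> wv [x [ux vx]] [y [vy wy]]; have [z [xz yz]] := confluent wv vx vy.
by exists z; split; [apply: star_trans xz|apply: star_trans yz].
Qed.

Lemma wf_hidden_copy w : wf_word l d w -> wf_word l D (hidden_copy w).
Proof.
rewrite /wf_word all_map; apply: sub_all => x /= /andP[-> /=]; rewrite /D; lia.
Qed.

Lemma wf_visible_copy w : wf_word l d w -> wf_word l D (visible_copy w).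
Proof.
rewrite /wf_word all_map; apply: sub_all => x /= /andP[-> /=]; rewrite /D; lia.
Qed.

Lemma wf_marks p w : p < 2 -> wf_word l d w -> wf_word l D (marks p w).
Proof.
move=> lt_p; rewrite /wf_word all_map; apply: sub_all => x /= /andP[-> /=]; rewrite /D; lia.
Qed.

Hypothesis T_joinable : forall r : word rat * word rat, r \in T ->
  joinable B (hidden_copy r.1 ++ marks 1 (r.1 ++ r.2))
             (hidden_copy r.2 ++ marks 1 (r.1 ++ r.2)).
Hypothesis copy_joinable : forall a i, size a = l -> i < d ->
  joinable B [:: (a, i.*2.+3); (a, 0); (a, 1)] [:: (a, i.*2.+2); (a, 0); (a, 1)].

(** A supply of marks of hidden atoms: the only extra context that derivations will require. *)
Definition pile (K : word rat) := wf_word l D K && all (fun x => x.2 == 1) K.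

Lemma pile_cat K K' : pile (K ++ K') = pile K && pile K'.
Proof. by rewrite /pile /wf_word !all_cat andbACA. Qed.

Lemma pile_marks w : wf_word l d w -> pile (marks 1 w).
Proof.
by move=> ww; rewrite /pile wf_marks //= /marks all_map; apply/allP.
Qed.

(** Each firing is joinable on hidden copies once the atoms it uses are marked as hidden. [K]
    collects these marks along the sequence, including those of atoms absent from both ends. *)
Lemma star_hidden u v : star T u v -> wf_word l d u -> wf_word l d v /\
  exists2 K, pile K & joinable B (hidden_copy u ++ K) (hidden_copy v ++ K).
Proof.
elim=> [x y xy|x x1 x2 [r [F [g [rT HF Hx Hx1]]]] _ IH] wx.
  rewrite -(wf_word_perm _ _ xy); split=> //; exists [::] => //.
  rewrite !cats0; exists (hidden_copy x); split; first exact: star_refl.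
  by apply: StarPerm; rewrite perm_sym; apply: perm_map.
have /andP[wr1 wr2] := T_wf rT.
move: wx (wx); rewrite {1}(wf_word_perm _ _ Hx) wf_word_cat => /andP[wg _] wx.
have wx1 : wf_word l d x1.
  by rewrite (wf_word_perm _ _ Hx1) wf_word_cat wg wf_word_rename.
have [wx2 [K pK HK]] := IH wx1; split=> //.
pose K1 := marks 1 (rename_word F r.1 ++ rename_word F r.2).
have pK1 : pile K1 by rewrite pile_marks // wf_word_cat !wf_word_rename ?wr1.
exists (K ++ K1); first by rewrite pile_cat pK.
apply: (@joinable_trans _ (hidden_copy x1 ++ K ++ K1)).
- rewrite !wf_word_cat wf_hidden_copy //=.
  by move: pK pK1 => /andP[-> _] /andP[-> _].
- have : joinable B (hidden_copy g ++ K ++ hidden_copy (rename_word F r.1) ++ K1)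
                    (hidden_copy g ++ K ++ hidden_copy (rename_word F r.2) ++ K1).
    rewrite !(catA (hidden_copy g)); apply: joinable_cat.
    rewrite /K1 -rename_word_cat !hidden_copy_rename !marks_rename -!rename_word_cat.
    exact: (joinable_rename HF (T_joinable rT)).
  have H1 : perm_eq (hidden_copy x) (hidden_copy g ++ hidden_copy (rename_word F r.1)).
    by rewrite -hidden_copy_cat; apply: perm_map.
  have H2 : perm_eq (hidden_copy x1) (hidden_copy g ++ hidden_copy (rename_word F r.2)).
    by rewrite -hidden_copy_cat; apply: perm_map.
  by apply: joinable_perm; apply: perm_cnt => p; move: (cnt_perm p H1) (cnt_perm p H2); count_lia.
have := joinable_cat K1 HK.
by apply: joinable_perm; apply: perm_cnt => p; count_lia.
Qed.

(** The tokens change colour one by one; both marks of the atom concerned stay available. *)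
Lemma recolor w : wf_word l d w ->
  joinable B (hidden_copy w ++ marks 0 w ++ marks 1 w)
             (visible_copy w ++ marks 0 w ++ marks 1 w).
Proof.
elim: w => [|[a i] w IHw] /=; first by move=> _; apply: joinable_refl.
move=> /andP[/= /andP[/eqP sa lt_i] ww].
pose m := [:: (a, 0); (a, 1)].
apply: (@joinable_trans _ ((a, i.*2.+2) :: m ++ hidden_copy w ++ marks 0 w ++ marks 1 w)).
- have Hi : i.*2.+2 < D by rewrite /D; lia.
  have wfx p : p < D -> wf_word l D [:: (a, p)] by rewrite /wf_word /= sa eqxx => ->.
  rewrite -(cat1s (a, _)) /m -(cat1s (a, 0) [:: _]) !wf_word_cat !wfx //.
  by rewrite wf_hidden_copy // !wf_marks.
- have := joinable_cat (hidden_copy w ++ marks 0 w ++ marks 1 w) (copy_joinable sa lt_i).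
  by apply: joinable_perm; apply: perm_cnt => p;
    rewrite /m ?cat_cons !(cnt_cons, cnt_cat, cnt_nil); count_lia.
have := joinable_cat ((a, i.*2.+2) :: m) (IHw ww).
by apply: joinable_perm; apply: perm_cnt => p;
    rewrite /m ?cat_cons !(cnt_cons, cnt_cat, cnt_nil); count_lia.
Qed.

(** The hidden part of the rule consists of marks and is the same on both sides. Supplied as the
    pile [K], it turns the step into one of [B]. *)
Lemma step_visible u v : word_step (visible_rules B) u v -> all (fun x => ~~ odd x.2) u ->
  all (fun x => ~~ odd x.2) v /\ exists2 K, pile K & word_step B (u ++ K) (v ++ K).
Proof.
move=> [_ [F [g [/mapP[r + ->] HF Hu Hv]]]] /=; rewrite mem_filter => /andP[hm rB].
rewrite (perm_all _ Hu) (perm_all _ Hv) !all_cat => /andP[-> _]; split.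
  by rewrite -visible_rename; apply: filter_all.
have /and5P[wr _ _ _ /andP[_]] := B_ok rB; rewrite hm /= => hh.
exists (rename_word F (hidden r.1)).
  rewrite /pile wf_word_rename //; apply/andP; split.
    by rewrite /wf_word all_filter; apply: sub_all wr => x /= ->; rewrite implybT.
  rewrite all_map all_filter; apply: sub_all hm => x /=.
  by move=> /implyP H; apply/implyP.
exists r, F, g; split=> //.
  have H1 : perm_eq (rename_word F r.1)
      (rename_word F (visible r.1) ++ rename_word F (hidden r.1)).
    by rewrite -rename_word_cat; apply: perm_map; apply: perm_visible_hidden.
  by apply: perm_cnt => p; move: (cnt_perm p H1) (cnt_perm p Hu) => /=; count_lia.
have H1 : perm_eq (rename_word F r.2)
    (rename_word F (visible r.2) ++ rename_word F (hidden r.1)).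
  rewrite -rename_word_cat; apply: perm_map; apply: perm_trans (perm_visible_hidden _) _.
  by rewrite perm_cat2l perm_sym.
by apply: perm_cnt => p; move: (cnt_perm p H1) (cnt_perm p Hv) => /=; count_lia.
Qed.

Lemma star_visible u v : star (visible_rules B) u v -> all (fun x => ~~ odd x.2) u ->
  all (fun x => ~~ odd x.2) v /\ exists2 K, pile K & star B (u ++ K) (v ++ K).
Proof.
elim=> [x y xy|x x1 x2 Hx _ IH] vx.
  rewrite -(perm_all _ xy); split=> //; exists [::] => //.
  by rewrite !cats0; apply: StarPerm.
have [vx1 [K pK HK]] := step_visible Hx vx.
have [vx2 [K' pK' HK']] := IH vx1; split=> //; exists (K ++ K'); first by rewrite pile_cat pK.
apply: (@star_trans _ _ (x1 ++ K ++ K')).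
  have := star_cat K' (star_step HK).
  move=> /(star_permr (v' := x1 ++ K ++ K')) H; apply: star_perml (H _).
    by apply: perm_cnt => p; count_lia.
  by apply: perm_cnt => p; count_lia.
have := star_cat K HK'.
move=> /(star_permr (v' := x2 ++ K ++ K')) H; apply: star_perml (H _).
  by apply: perm_cnt => p; count_lia.
by apply: perm_cnt => p; count_lia.
Qed.

(** A rule applicable to [u ++ K] finds only marks as hidden letters, so it has a visible version,
    and this version already applies to [u]. *)
Lemma irreducible_visible u K : all (fun x => ~~ odd x.2) u -> pile K ->
  (forall x, ~ word_step (visible_rules B) u x) -> forall x, ~ word_step B (u ++ K) x.
Proof.
move=> vu /andP[_ pK] irr x [r [F [g [rB HF Hu _]]]].
have sub y : y \in rename_word F r.1 -> y \in u ++ K.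
  by move=> yr; rewrite (perm_mem Hu) mem_cat yr orbT.
have hm : hidden_marks_only r.1.
  apply/allP => y yr; apply/implyP => oy.
  have : (F y.1, y.2) \in u ++ K by apply: sub; apply/mapP; exists y.
  rewrite mem_cat => /orP[/(allP vu)|/(allP pK)] //=.
  by rewrite oy.
have Kv : [seq x <- K | ~~ odd x.2] = [::].
  apply/eqP; rewrite -[_ == _]negbK -has_filter; apply/hasPn => y /(allP pK) /eqP->.
  by [].
apply: (irr (visible g ++ rename_word F (visible r.2))).
exists (visible r.1, visible r.2), F, (visible g); split=> //.
  by apply/mapP; exists r; rewrite // mem_filter hm.
rewrite -visible_rename -filter_cat.
have -> : u = [seq x <- u ++ K | ~~ odd x.2].
  by rewrite filter_cat Kv cats0; apply/esym/all_filterP.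
exact: perm_filter.
Qed.

Lemma star_irreducible u v : (forall x, ~ word_step B u x) -> star B u v -> perm_eq u v.
Proof. by move=> irr H; case: H irr => [//|w w1 w2 H _ /(_ _ H)]. Qed.

(** With enough marks added, the visible copy of [s] is joinable with its hidden copy, this with the
    hidden copy of [t], and this with the visible copy of [t]. Confluence makes the two normal forms
    meet, and piles of hidden marks do not make them reducible, so they would agree. *)
Lemma separates_sound s t : wf_word l d s -> wf_word l d t ->
  (exists s0 t0,
    [/\ star (visible_rules B) (visible_copy s ++ marks 0 (s ++ t)) s0,
        star (visible_rules B) (visible_copy t ++ marks 0 (s ++ t)) t0,
        forall x, ~ word_step (visible_rules B) s0 x, forall x, ~ word_step (visible_rules B) t0 x &
        ~~ perm_eq s0 t0]) -> ~ star T s t.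
Proof.
move=> ws wt [s0 [t0 [Hs Ht irs irt /negP nst]]] st; apply: nst.
have vis w : all (fun x => ~~ odd x.2) (visible_copy w ++ marks 0 (s ++ t)).
  by rewrite all_cat !all_map; apply/andP; split; apply/allP => x _ //=; rewrite negbK odd_double.
have [vs0 [Ks pKs HKs]] := star_visible Hs (vis s).
have [vt0 [Kt pKt HKt]] := star_visible Ht (vis t).
have [_ [K pK HK]] := star_hidden st ws.
have wM p : p < 2 -> wf_word l D (marks p (s ++ t)).
  by move=> lt_p; rewrite wf_marks // wf_word_cat ws.
pose M := marks 0 (s ++ t) ++ marks 1 (s ++ t) ++ K ++ Ks ++ Kt.
have wfM : wf_word l D M.
  by rewrite !wf_word_cat !wM //=; move: pK pKs pKt => /andP[-> _] /andP[-> _] /andP[-> _].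
have rec w : wf_word l d w -> (exists w', perm_eq (s ++ t) (w ++ w')) ->
    joinable B (hidden_copy w ++ M) (visible_copy w ++ M).
  move=> ww [w' Hw']; pose G := marks 0 w' ++ marks 1 w' ++ K ++ Ks ++ Kt.
  have : joinable B (G ++ hidden_copy w ++ marks 0 w ++ marks 1 w)
                    (G ++ visible_copy w ++ marks 0 w ++ marks 1 w).
    by apply: joinable_cat; apply: recolor.
  have H0 p : perm_eq (marks p (s ++ t)) (marks p w ++ marks p w').
    by rewrite -marks_cat; apply: perm_map.
  by apply: joinable_perm; apply: perm_cnt => p;
    move: (cnt_perm p (H0 0)) (cnt_perm p (H0 1)); rewrite /M /G; count_lia.
have key : joinable B (visible_copy s ++ M) (visible_copy t ++ M).
  apply: (@joinable_trans _ (hidden_copy s ++ M)).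
  - by rewrite wf_word_cat wf_hidden_copy.
  - by apply: joinable_sym; apply: rec => //; exists t.
  apply: (@joinable_trans _ (hidden_copy t ++ M)).
  - by rewrite wf_word_cat wf_hidden_copy.
  - pose G := marks 0 (s ++ t) ++ marks 1 (s ++ t) ++ Ks ++ Kt.
    have : joinable B (G ++ hidden_copy s ++ K) (G ++ hidden_copy t ++ K).
      exact: joinable_cat.
    by apply: joinable_perm; apply: perm_cnt => p; rewrite /M /G; count_lia.
  by apply: rec => //; exists s; rewrite perm_catC.
(* [M] without the visible marks: these belong to the words that were normalized, hence are already
   contained in [s0] and [t0]. *)
pose M' := marks 1 (s ++ t) ++ K ++ Ks ++ Kt.
have pM' : pile M' by rewrite !pile_cat pK pKs pKt pile_marks // wf_word_cat ws.
have lift w w0 L L' : star B ((visible_copy w ++ marks 0 (s ++ t)) ++ L) (w0 ++ L) ->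
    perm_eq M' (L' ++ L) -> star B (visible_copy w ++ M) (w0 ++ M').
  move=> /(star_cat L') H HM; apply: star_permr (star_perml _ H).
    by apply: perm_cnt => p; move: (cnt_perm p HM); count_lia.
  by apply: perm_cnt => p; move: (cnt_perm p HM); rewrite /M /M'; count_lia.
have Hs0 : star B (visible_copy s ++ M) (s0 ++ M').
  apply: (lift _ _ _ (marks 1 (s ++ t) ++ K ++ Kt) HKs).
  by apply: perm_cnt => p; count_lia.
have Ht0 : star B (visible_copy t ++ M) (t0 ++ M').
  apply: (lift _ _ _ (marks 1 (s ++ t) ++ K ++ Ks) HKt).
  by apply: perm_cnt => p; count_lia.
have [x [sx tx]] := key.
have ws' : wf_word l D (visible_copy s ++ M) by rewrite wf_word_cat wf_visible_copy.
have wt' : wf_word l D (visible_copy t ++ M) by rewrite wf_word_cat wf_visible_copy.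
have [y [s0y xy]] := confluent ws' Hs0 sx.
have [z [t0z yz]] := confluent wt' Ht0 (star_trans tx xy).
have /star_irreducible Es := irreducible_visible vs0 pM' irs.
have /star_irreducible Et := irreducible_visible vt0 pM' irt.
rewrite -(perm_cat2r M'); apply: perm_trans (Es _ (star_trans s0y yz)) _.
by rewrite perm_sym; apply: Et.
Qed.
End Soundness.

Theorem separates_not_star l d B T s t :
  (forall r : word rat * word rat, r \in T -> wf_word l d r.1 && wf_word l d r.2) ->
  wf_word l d s -> wf_word l d t -> separates l d B T s t -> ~ star T s t.
Proof.
move=> T_wf ws wt [H1 H2 H3 H4 H5].
exact: (separates_sound H1 T_wf H2 H3 H4 ws wt H5).
Qed.

(** * Existence of Groebner bases *)

Lemma perm_seq_diffC (X : eqType) (s t : seq X) :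
  perm_eq (seq_diff s t ++ t) (seq_diff t s ++ s).
Proof.
by apply/allP => x _; rewrite /= !count_cat !count_seq_diff; apply/eqP; lia.
Qed.

Lemma mem_seq_diff (X : eqType) (s t : seq X) x : x \in seq_diff s t -> x \in s.
Proof.
rewrite -!has_pred1 !has_count count_seq_diff => H.
by apply: leq_trans H _; apply: leq_subr.
Qed.

Lemma rename_word_id (K : Type) (w : word K) : rename_word id w = w.
Proof. by rewrite -[RHS]map_id; apply: eq_map => -[]. Qed.

Lemma mark_part_hidden_copy (K : Type) (w : word K) : mark_part (hidden_copy w) = [::].
Proof. by elim: w. Qed.

Section Completeness.
Variables l d : nat.
Variable T : seq (word rat * word rat).
Let D := d.*2.+2.
Implicit Types u v w : word rat.
Hypothesis T_wf : forall r : word rat * word rat,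
  r \in T -> wf_word l d r.1 && wf_word l d r.2.
Hypothesis T_sym : forall u v, wf_word l d u -> wf_word l d v -> star T u v -> star T v u.

(** Forgets marks and colours: [(p - 2)./2] takes both 2i+2 and 2i+3 back to i. *)
Definition erase w : word rat := [seq (x.1, (x.2 - 2)./2) | x <- w & 1 < x.2].

Lemma erase_cat u v : erase (u ++ v) = erase u ++ erase v.
Proof. by rewrite /erase filter_cat map_cat. Qed.

Lemma erase_perm u v : perm_eq u v -> perm_eq (erase u) (erase v).
Proof. by move=> uv; apply: perm_map; apply: perm_filter. Qed.

Lemma erase_rename F w : erase (rename_word F w) = rename_word F (erase w).
Proof. by rewrite /erase filter_map /rename_word -!map_comp. Qed.

Lemma erase_wf w : wf_word l D w -> wf_word l d (erase w).
Proof.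
move=> ww; rewrite /wf_word /erase all_map all_filter; apply: sub_all ww => x /=.
by move=> /andP[-> lt_x] /=; apply/implyP; rewrite /D in lt_x; lia.
Qed.

Lemma erase_visible_copy w : erase (visible_copy w) = w.
Proof.
rewrite /erase; elim: w => //= -[a i] w IHw /=; rewrite IHw; congr cons; congr pair; lia.
Qed.

Lemma erase_hidden_copy w : erase (hidden_copy w) = w.
Proof.
rewrite /erase; elim: w => //= -[a i] w IHw /=; rewrite IHw; congr cons; congr pair; lia.
Qed.

Lemma erase_marks p w : p < 2 -> erase (marks p w) = [::].
Proof. by move=> lt_p; rewrite /erase; elim: w => //= x w IHw; rewrite ltnNge -ltnS lt_p. Qed.

Definition dom w := wf_word l D w /\ has_marks w.

(** The congruence that the basis must present: equal marks, and one reachability class once colours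
    are forgotten. The two copies of a token are thus equivalent. *)
Definition sim u v := perm_eq (mark_part u) (mark_part v) /\ star T (erase u) (erase v).

Lemma sim_refl u : sim u u. Proof. by split=> //; apply: star_refl. Qed.

Lemma sim_trans u v w : sim u v -> sim v w -> sim u w.
Proof. by move=> [m1 s1] [m2 s2]; split; [apply: perm_trans m2|apply: star_trans s2]. Qed.

Lemma sim_sym u v : wf_word l D u -> wf_word l D v -> sim u v -> sim v u.
Proof.
move=> wu wv [m1 s1]; split; first by rewrite perm_sym.
by apply: T_sym => //; apply: erase_wf.
Qed.

Lemma sim_perm u v : perm_eq u v -> sim u v.
Proof. by move=> uv; split; [apply: perm_filter|apply: StarPerm; apply: erase_perm]. Qed.

Lemma sim_cat g u v : sim u v -> sim (g ++ u) (g ++ v).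
Proof.
move=> [m1 s1]; split; first by rewrite /mark_part !filter_cat perm_cat2l.
by rewrite !erase_cat; apply: star_cat.
Qed.

Lemma sim_rename F u v : atom_embedding F -> sim u v -> sim (rename_word F u) (rename_word F v).
Proof.
move=> HF [m1 s1]; split; first by rewrite !mark_part_rename; apply: perm_map.
by rewrite !erase_rename; apply: star_rename.
Qed.

Lemma has_marks_perm u v : perm_eq u v -> has_marks u = has_marks v.
Proof.
move=> uv; rewrite /has_marks (perm_all _ uv); apply: eq_all => x.
exact: perm_mem.
Qed.

Lemma dom_perm u v : perm_eq u v -> dom u -> dom v.
Proof.
by move=> uv [wu mu]; split; [rewrite -(wf_word_perm _ _ uv)|rewrite -(has_marks_perm uv)].
Qed.

Lemma dom_rename F u : atom_embedding F -> dom u -> dom (rename_word F u).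
Proof.
move=> HF [wu mu]; split; first by rewrite wf_word_rename.
apply/allP => _ /mapP[x xu ->] /=; apply/mapP.
by exists (x.1, odd x.2 : nat) => //; apply: (allP mu).
Qed.

Lemma dom_replace g u v : wf_word l D v -> has_marks v ->
  perm_eq (mark_part u) (mark_part v) -> dom (g ++ u) -> dom (g ++ v).
Proof.
move=> wv mv muv [+ mgu]; rewrite !wf_word_cat => /andP[wg _].
split; first by rewrite wf_word_cat wg.
apply/allP => x; rewrite mem_cat => /orP[xg|/(allP mv) H]; last by rewrite mem_cat H orbT.
have : (x.1, odd x.2 : nat) \in g ++ u by apply: (allP mgu); rewrite mem_cat xg.
rewrite !mem_cat => /orP[->//|H]; apply/orP; right.
have : (x.1, odd x.2 : nat) \in mark_part u by rewrite mem_filter H andbT /=; case: odd.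
by rewrite (perm_mem muv) mem_filter => /andP[].
Qed.

Definition reducible w := dom w /\ exists w', [/\ dom w', sim w w' & word_lt w' w].

(** The hidden parts of the two sides agree and can be cancelled from the inequality between
    them. *)
Lemma visible_rules_wf (B : seq (word rat * word rat)) :
  (forall r : word rat * word rat, r \in B -> rule_ok l D r) ->
  forall r : word rat * word rat, r \in visible_rules B ->
    [/\ wf_word l D r.1, wf_word l D r.2,
        word_lt r.2 r.1 & {subset map fst r.2 <= map fst r.1}].
Proof.
move=> B_ok _ /mapP[r + ->]; rewrite mem_filter => /andP[hm /B_ok rok] /=.
have /and5P[w1 w2 lt12 mm /andP[hm2]] := rok; rewrite hm /= => hh.
have wv u : wf_word l D u -> wf_word l D (visible u).
  by rewrite /wf_word all_filter; apply: sub_all => x /= ->; rewrite implybT.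
split; [exact: wv|exact: wv| |].
  rewrite -(word_lt_cat (hidden r.1)).
  apply: word_lt_perm lt12.
    apply: perm_trans (perm_visible_hidden _) _; rewrite perm_catC perm_cat2r.
    by rewrite perm_sym.
  by apply: perm_trans (perm_visible_hidden _) _; rewrite perm_catC.
exact: rule_ok_visible_atoms rok.
Qed.

(** The payoff of ranking hidden letters highest. The deciding letter occurs in [u]; were it hidden
    it would be a mark, but marks have equal multiplicities in [u] and [v]. So it is visible, all
    hidden letters lie above it, and their multiplicities agree. *)
Lemma hidden_perm u v : hidden_marks_only u -> perm_eq (mark_part u) (mark_part v) ->
  word_lt v u -> perm_eq (hidden u) (hidden v).
Proof.
move=> hu muv /word_ltP[x [lt_x Hx]].
have ex : ~~ odd x.2.
  apply/negP => ox.
  have xu : x \in u by rewrite -has_pred1 has_count (leq_ltn_trans _ lt_x).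
  have /eqP x1 : x.2 == 1 by have := allP hu _ xu; rewrite ox.
  have E w : count_mem x w = count_mem x (mark_part w).
    rewrite count_filter; apply: eq_count => y /=.
    by case: eqVneq => [->|//]; rewrite x1.
  by move: lt_x; rewrite (E u) (E v) (permP muv) ltnn.
apply/allP => y _; rewrite /= !count_filter; apply/eqP.
have [oy|ey] := boolP (odd y.2).
  have E w : count (predI (pred1 y) (fun x => odd x.2)) w = count_mem y w.
    by apply: eq_count => z /=; case: eqVneq => [->|//].
  by rewrite !E Hx // /letter_lt oy (negbTE ex).
have E w : count (predI (pred1 y) (fun x => odd x.2)) w = 0.
  apply/eqP; rewrite -leqn0 leqNgt -has_count; apply/hasPn => z _ /=.
  by case: eqVneq => [->|//].
by rewrite !E.
Qed.

(** Reduction preserves [sim] and ends in words that are not [reducible]. As the order is total, two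
    equivalent words of this kind are equal up to permutation, so equivalent words of [dom] are
    always joinable and the joinability conditions amount to equivalences. Equal visible normal
    forms would erase to a derivation from [s] to [t]. *)
Theorem separates_complete s t : wf_word l d s -> wf_word l d t -> ~ star T s t ->
  exists B, separates l d B T s t.
Proof.
move=> ws wt nst.
have [b [bred bP]] := wqo_finite_basis (P := reducible) (wqo_words (l := l) (D := D))
  (fun w H => proj1 (proj1 H)).
have Hc w : exists w', reducible w -> [/\ dom w', sim w w' & word_lt w' w].
  have [[_ [w' H]]|nr] := classic (reducible w); first by exists w'.
  by exists w.
pose c w := proj1_sig (constructive_indefinite_description _ (Hc w)).
have cP w : reducible w -> [/\ dom (c w), sim w (c w) & word_lt (c w) w].
  exact: (proj2_sig (constructive_indefinite_description _ (Hc w))).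
pose B := [seq (w, c w) | w <- b].
have BP (r : word rat * word rat) : r \in B ->
    [/\ dom r.1, dom r.2, sim r.1 r.2 & word_lt r.2 r.1].
  move=> /mapP[w wb ->] /=; have rw := bred _ wb; have [dw' sw lw] := cP _ rw.
  by split=> //; case: rw.
have B_ok (r : word rat * word rat) : r \in B -> rule_ok l D r.
  move=> /BP[[w1 _] [w2 m2] [m12 _] lt12]; rewrite /rule_ok w1 w2 lt12 m12 m2 /=.
  by apply/implyP => hm; apply: hidden_perm.
exists B.
have B_step u v : dom u -> word_step B u v -> dom v /\ sim u v.
  move=> du [r [F [g [rB HF Hu Hv]]]]; have [d1 d2 s12 _] := BP _ rB.
  have [w2 m2] := dom_rename HF d2; have [mm ss] := sim_rename HF s12.
  have dv := dom_replace w2 m2 mm (dom_perm Hu du).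
  split; first by apply: dom_perm dv; rewrite perm_sym.
  apply: sim_trans (sim_perm Hu) _; apply: sim_trans (sim_cat g (sim_rename HF s12)) _.
  by apply: sim_perm; rewrite perm_sym.
have nf u : dom u -> exists v, [/\ star B u v, dom v, sim u v & ~ reducible v].
  move=> du; have := step_acc (rules_wf B_ok) (proj1 du).
  move=> acc; elim: acc du => {}u _ IH du.
  have [ru|nru] := classic (reducible u); last first.
    by exists u; split=> //; [apply: star_refl|apply: sim_refl].
  have [y yb [F [g [HF Hu]]]] := bP _ ru.
  have uv : word_step B u (g ++ rename_word F (c y)).
    by exists (y, c y), F, g; split=> //; apply/mapP; exists y.
  have [dv suv] := B_step _ _ du uv; have [v [vv dv' svv nv]] := IH _ uv dv.
  by exists v; split=> //; [apply: StarStep vv|apply: sim_trans svv].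
have sim_joinable u v : dom u -> dom v -> sim u v -> joinable B u v.
  move=> du dv suv; have [u' [uu' du' su' nu']] := nf _ du.
  have [v' [vv' dv' sv' nv']] := nf _ dv.
  have suv' : sim u' v'.
    apply: sim_trans (sim_sym (proj1 du) (proj1 du') su') _.
    exact: sim_trans suv sv'.
  exists u'; split=> //; apply: star_permr vv'; rewrite perm_sym.
  apply: contraT => nuv; have := word_lt_total (proj1 du') (proj1 dv') nuv.
  case/orP => lt; [case: nv'|case: nu']; split=> //; [exists u'|exists v'] => //.
  by split=> //; apply: sim_sym suv'; [apply: (proj1 du')|apply: (proj1 dv')].
split=> //.
- move=> r1 r2 F1 F2 r1B r2B HF1 HF2; set k1 := rename_word F1 r1.1; set k2 := rename_word F2 r2.1.
  have [d1 _ _ _] := BP _ r1B; have [d2 _ _ _] := BP _ r2B.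
  have dk1 := dom_rename HF1 d1; have dk2 := dom_rename HF2 d2.
  have Lperm : perm_eq (seq_diff k2 k1 ++ k1) (seq_diff k1 k2 ++ k2).
    exact: perm_seq_diffC.
  have dL : dom (seq_diff k2 k1 ++ k1).
    split; first rewrite wf_word_cat (proj1 dk1) andbT.
      by apply/allP => x /mem_seq_diff xk; apply: (allP (proj1 dk2)).
    apply/allP => x; rewrite mem_cat => /orP[/mem_seq_diff xk|xk].
      by rewrite (perm_mem Lperm) mem_cat (allP (proj2 dk2) _ xk) orbT.
    by rewrite mem_cat (allP (proj2 dk1) _ xk) orbT.
  have st1 : word_step B (seq_diff k2 k1 ++ k1) (seq_diff k2 k1 ++ rename_word F1 r1.2).
    by exists r1, F1, (seq_diff k2 k1).
  have st2 : word_step B (seq_diff k2 k1 ++ k1) (seq_diff k1 k2 ++ rename_word F2 r2.2).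
    by exists r2, F2, (seq_diff k1 k2).
  have [da sa] := B_step _ _ dL st1; have [db sb] := B_step _ _ dL st2.
  apply: sim_joinable => //; apply: sim_trans sb.
  exact: sim_sym (proj1 dL) (proj1 da) sa.
- move=> r rT; have /andP[w1 w2] := T_wf rT; set M := marks 1 (r.1 ++ r.2).
  have MP w : wf_word l d w -> {subset w <= r.1 ++ r.2} -> dom (hidden_copy w ++ M).
    move=> ww sub; split.
      by rewrite wf_word_cat wf_hidden_copy // wf_marks // wf_word_cat w1.
    apply/allP => x; rewrite !mem_cat => /orP[/mapP[y yw ->]|/mapP[y yM ->]] /=.
      by rewrite odd_double /=; apply/orP; right; apply/mapP; exists y => //; apply: sub.
    by apply/orP; right; apply/mapP; exists y.
  apply: sim_joinable.
  + by apply: MP => // x xr; rewrite mem_cat xr.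
  + by apply: MP => // x xr; rewrite mem_cat xr orbT.
  have S : sim (M ++ hidden_copy r.1) (M ++ hidden_copy r.2).
    apply: sim_cat; split; first by rewrite !mark_part_hidden_copy.
    rewrite !erase_hidden_copy; apply: star_step; exists r, id, [::].
    by rewrite /= !rename_word_id; split; rewrite ?perm_refl // => x y.
  apply: (@sim_trans _ (M ++ hidden_copy r.1)).
    by apply: sim_perm; rewrite perm_catC.
  by apply: (sim_trans S); apply: sim_perm; rewrite perm_catC.
- move=> a i sa lt_i; apply: sim_joinable.
  + split; first by rewrite /wf_word /= sa eqxx /D; lia.
    by rewrite /has_marks /= !in_cons !eqxx ?orbT /= odd_double /= !eqxx !orbT.
  + split; first by rewrite /wf_word /= sa eqxx /D; lia.
    by rewrite /has_marks /= !in_cons !eqxx ?orbT /= odd_double /= !eqxx !orbT.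
  + split; first by [].
    have E : (i.*2.+3 - 2)./2 = (i.*2.+2 - 2)./2 by lia.
    by apply: StarPerm; move: E; rewrite /erase /= => ->.
(* The hidden part of such a rule consists of marks, which [erase] drops, so the rule and its
   visible part have the same erasures. *)
have vis_step u v : word_step (visible_rules B) u v -> sim u v.
  move=> [_ [F [g [/mapP[r + ->] HF Hu Hv]]]] /=; rewrite mem_filter => /andP[hm rB].
  have [d1 d2 [m12 s12] lt12] := BP _ rB; have hh := hidden_perm hm m12 lt12.
  have Hr : sim (visible r.1) (visible r.2).
    split.
      by rewrite /mark_part /visible -!filter_predI !(eq_filter (a1 := predI _ _)
        (a2 := predI (fun x => ~~ odd x.2) (fun x => x.2 < 2))) ?filter_predI;
        [apply: perm_filter|move=> x /=; rewrite andbC|move=> x /=; rewrite andbC].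
    have E1 : erase (hidden r.1) = [::].
      rewrite /erase /hidden -filter_predI (eq_in_filter (a2 := pred0)) ?filter_pred0 //.
      move=> x xr /=; have := allP hm _ xr.
      by case: (odd x.2) => /=; rewrite ?andbF // => /eqP->.
    have E (r0 : word rat) : perm_eq (hidden r.1) (hidden r0) ->
        perm_eq (erase (visible r0)) (erase r0).
      move=> H; have := erase_perm (perm_visible_hidden r0); rewrite perm_sym erase_cat.
      have : perm_eq (erase (hidden r0)) [::] by rewrite -E1 perm_sym; apply: erase_perm.
      by move=> /perm_nilP ->; rewrite cats0.
    apply: star_perml (star_permr _ s12); first by rewrite perm_sym; apply: E.
    by rewrite perm_sym; apply: E.
  apply: sim_trans (sim_perm Hu) _; apply: sim_trans (sim_cat g (sim_rename HF Hr)) _.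
  by apply: sim_perm; rewrite perm_sym.
have vis_nf u : wf_word l D u -> exists v, [/\ star (visible_rules B) u v, wf_word l D v,
    sim u v & forall x, ~ word_step (visible_rules B) v x].
  move=> wu; have acc := step_acc (visible_rules_wf B_ok) wu.
  elim: acc wu => {}u _ IH wu.
  have [[v uv]|nuv] := classic (exists v, word_step (visible_rules B) u v); last first.
    exists u; split=> //; [exact: star_refl|exact: sim_refl|].
    by move=> v uv; apply: nuv; exists v.
  have wv := step_wf (visible_rules_wf B_ok) uv wu.
  have [w [vw ww svw irw]] := IH _ uv wv.
  by exists w; split=> //; [apply: StarStep vw|apply: sim_trans svw; apply: vis_step uv].
have wM w : wf_word l d w -> wf_word l D (visible_copy w ++ marks 0 (s ++ t)).
  by move=> ww; rewrite wf_word_cat wf_visible_copy // wf_marks // wf_word_cat ws.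
have [s0 [ss0 ws0 sims irs]] := vis_nf _ (wM s ws).
have [t0 [tt0 wt0 simt irt]] := vis_nf _ (wM t wt).
exists s0, t0; split=> //; apply/negP => st0; apply: nst.
have E w : erase (visible_copy w ++ marks 0 (s ++ t)) = w.
  by rewrite erase_cat erase_visible_copy erase_marks // cats0.
have [_ H] := sim_trans sims (sim_trans (sim_perm st0) (sim_sym (wM t wt) wt0 simt)).
by rewrite !E in H; apply: H.
Qed.
End Completeness.

(** * Natural coordinates *)

Notation rule K := (word K * word K)%type.

Definition words_over (T : Type) (L : seq T) n : seq (seq T) :=
  iter n (fun ws => [seq x :: w | x <- L, w <- ws]) [:: [::]].

Lemma mem_words_over (T : eqType) (L : seq T) n w :
  (w \in words_over L n) = (size w == n) && all (mem L) w.
Proof.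
elim: n w => [|n IHn] w; first by case: w.
apply/allpairsP/idP => [[[x u] /= [xL + ->]]|].
  by rewrite -/(words_over L n) IHn => /andP[/eqP<- /= ->]; rewrite xL eqxx.
case: w => [|x w] //= /andP[sz /andP[xL wL]]; exists (x, w); split=> //=.
by rewrite -/(words_over L n) IHn wL andbT.
Qed.

Definition nat_atom (a : seq nat) : seq rat := map (fun n => n%:R%R) a.
Notation nat_word := (rename_word nat_atom).
Definition nat_rules (R : seq (rule nat)) : seq (rule rat) :=
  [seq (nat_word r.1, nat_word r.2) | r <- R].

Lemma nat_atom_embedding : atom_embedding nat_atom.
Proof. by apply: atom_embedding_map => m n; rewrite ltr_nat ltEnat. Qed.

Lemma perm_rename (K K' : eqType) (F : seq K -> seq K') u v : injective F ->
  perm_eq (rename_word F u) (rename_word F v) -> perm_eq u v.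
Proof.
by move=> injF; apply: perm_map_inj => -[a p] [b q] [/injF-> ->].
Qed.

Lemma perm_nat_word u v : perm_eq (nat_word u) (nat_word v) -> perm_eq u v.
Proof. exact: perm_rename (atom_embedding_inj nat_atom_embedding). Qed.

Lemma rename_seq_diff (K K' : eqType) (F : seq K -> seq K') (u v : word K) : injective F ->
  rename_word F (seq_diff u v) = seq_diff (rename_word F u) (rename_word F v).
Proof.
move=> injF; elim: v => //= x v <-; elim: (seq_diff u v) => //= y w IHw.
rewrite xpair_eqE (inj_eq injF) -[(_ == _) && _]xpair_eqE -!surjective_pairing.
by case: eqP => // _; rewrite /= IHw.
Qed.

Definition coordinates (ws : seq (word rat)) : seq rat := flatten (map fst (flatten ws)).

Definition rank (L : seq rat) (q : rat) := count (fun q' => (q' < q)%R) L.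

Lemma rank_lt (L : seq rat) x y : x \in L -> (x < y)%R -> rank L x < rank L y.
Proof.
move=> + xy; elim: L => //= z L IHL; rewrite in_cons => /predU1P[<-|/IHL].
  rewrite ltxx xy add0n add1n ltnS; apply: sub_count => u /= ux.
  exact: lt_trans xy.
rewrite -addnS; apply: leq_add; case: ltP => //= zx.
by rewrite (lt_trans zx xy).
Qed.

Lemma rank_mono (L : seq rat) : {in L &, {mono rank L : x y / (x < y)%O}}.
Proof.
move=> x y xL yL; rewrite ltEnat /=; case: (ltgtP x y) => [/(rank_lt xL)//|/(rank_lt yL)|->].
  by move=> H; apply/negbTE; rewrite -leqNgt ltnW.
by rewrite ltnn.
Qed.

Lemma rank_size (L : seq rat) x : x \in L -> rank L x < size L.
Proof.
move=> xL; rewrite /rank -(count_predC (fun q => (q < x)%R) L) -[X in X < _]addn0.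
by rewrite ltn_add2l -has_count; apply/hasP; exists x; rewrite //= ltxx.
Qed.

(** Ranks preserve the joint type of finitely many words, so homogeneity gives embeddings that
    realize the passage to ranks and back on all of them at once. The bound on the ranks is what
    makes the list of critical pairs finite. *)
Lemma compress (ws : seq (word rat)) :
  let L := coordinates ws in let rho := map (rank L) in
  exists G H, [/\ atom_embedding G, atom_embedding H,
    forall w, w \in ws -> nat_word (rename_word rho w) = rename_word G w,
    forall w, w \in ws -> rename_word H (nat_word (rename_word rho w)) = w &
    forall w x, w \in ws -> x \in rename_word rho w -> all (fun n => n < size L) x.1].
Proof.
move=> L rho.
have subL a : a \in map fst (flatten ws) -> {subset a <= L}.
  by move=> aw x xa; apply/flattenP; exists a.
have st : same_type (flatten ws) (rename_word rho (flatten ws)).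
  apply: same_type_rename => a b aw bw; apply: (cmp_map_in (@rank_mono L)).
    exact: subL.
  exact: subL.
have st' : same_type (flatten ws) (nat_word (rename_word rho (flatten ws))).
  exact: same_type_trans st (same_type_embedding _ nat_atom_embedding).
have [G GE HG] := same_typeP st'; have [H HE HH] := same_typeP (same_type_sym st').
exists G, H.
have inw w x : w \in ws -> x \in w -> x \in flatten ws.
  by move=> wws xw; apply/flattenP; exists w.
have eqG x : x \in flatten ws -> nat_atom (rho x.1) = G x.1.
  move=> xws; have := HG; rewrite rename_word_comp => /eq_in_map /(_ x xws).
  by case.
have eqH x : x \in flatten ws -> H (nat_atom (rho x.1)) = x.1.
  move=> xws; have := HH; rewrite !rename_word_comp -[LHS]map_id => /eq_in_map /(_ x xws).
  by rewrite [x in LHS]surjective_pairing => -[].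
split=> // [w wws|w wws|w x wws /mapP[y yw ->]].
- by rewrite rename_word_comp; apply/eq_in_map => x xw; rewrite /= eqG // (inw w).
- rewrite !rename_word_comp -[RHS]map_id; apply/eq_in_map => x xw.
  by rewrite /= eqH ?(inw w) // -surjective_pairing.
apply/allP => _ /mapP[q qy ->]; apply: rank_size; apply: subL qy.
by apply: map_f; apply: (inw w).
Qed.

(** No embedding is searched for: the instance of the rule is spelled with letters of [w] and [w'],
    its type tells whether an embedding produces it, and the context is forced. *)
Definition step_check (R : seq (rule nat)) (w w' : word nat) : bool :=
  has (fun r => has (fun k => has (fun k' =>
    [&& same_type (r.1 ++ r.2) (k ++ k'), perm_eq w (seq_diff w k ++ k) &
        perm_eq w' (seq_diff w k ++ k')])
    (words_over w' (size r.2))) (words_over w (size r.1))) R.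

Lemma nat_word_sub (u : word rat) (w : word nat) :
  {subset u <= nat_word w} -> exists2 k, u = nat_word k & {subset k <= w}.
Proof.
elim: u => [|x u IHu] sub; first by exists [::].
have [|k -> kw] := IHu; first by move=> y yu; apply: sub; rewrite in_cons yu orbT.
have /mapP[y yw ->] : x \in nat_word w by apply: sub; rewrite mem_head.
by exists (y :: k) => // z; rewrite in_cons => /predU1P[->|/kw].
Qed.

Lemma same_type_nat (u v : word nat) :
  same_type u v -> same_type (nat_word u) (nat_word v).
Proof.
move=> uv; apply: same_type_trans (same_type_sym (same_type_embedding u nat_atom_embedding)) _.
exact: same_type_trans uv (same_type_embedding v nat_atom_embedding).
Qed.

Lemma nat_same_type (u v : word nat) (F : seq rat -> seq rat) : atom_embedding F ->
  nat_word v = rename_word F (nat_word u) -> same_type u v.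
Proof.
move=> HF E; apply: (same_type_trans (same_type_embedding u nat_atom_embedding)).
apply: (same_type_trans (same_type_embedding (nat_word u) HF)); rewrite -E.
exact: same_type_sym (same_type_embedding v nat_atom_embedding).
Qed.

Lemma step_check_sound R w w' :
  step_check R w w' -> word_step (nat_rules R) (nat_word w) (nat_word w').
Proof.
move=> /hasP[r rR] /hasP[k kw] /hasP[k' kw'] /and3P[/same_type_nat st Hw Hw'].
have [F HF] := same_typeP st.
rewrite !rename_word_cat => /eqP; rewrite eqseq_cat; last first.
  by move: kw; rewrite mem_words_over !size_map => /andP[/eqP].
move=> /andP[/eqP E1 /eqP E2].
exists (nat_word r.1, nat_word r.2), F, (nat_word (seq_diff w k)); split=> //.
- by apply/mapP; exists r.
- by rewrite -E1 -rename_word_cat; apply: perm_map.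
- by rewrite -E2 -rename_word_cat; apply: perm_map.
Qed.

Lemma step_check_complete R w w' :
  word_step (nat_rules R) (nat_word w) (nat_word w') -> step_check R w w'.
Proof.
move=> [_ [F [g [/mapP[r rR ->] HF Hw Hw']]]]; rewrite /= in Hw Hw'.
have [|k Ek kw] := @nat_word_sub (rename_word F (nat_word r.1)) w.
  by move=> x xr; rewrite (perm_mem Hw) mem_cat xr orbT.
have [|k' Ek' kw'] := @nat_word_sub (rename_word F (nat_word r.2)) w'.
  by move=> x xr; rewrite (perm_mem Hw') mem_cat xr orbT.
have sk : size k = size r.1 by have := congr1 size Ek; rewrite !size_map.
have sk' : size k' = size r.2 by have := congr1 size Ek'; rewrite !size_map.
have cnt_w x : count_mem x k <= count_mem x w.
  rewrite -!(count_rename _ _ nat_atom_embedding) (permP Hw) count_cat Ek.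
  exact: leq_addl.
have Hk : perm_eq w (seq_diff w k ++ k) by apply: perm_seq_diff.
apply/hasP; exists r => //; apply/hasP; exists k.
  by rewrite mem_words_over sk eqxx; apply/allP.
apply/hasP; exists k'; first by rewrite mem_words_over sk' eqxx; apply/allP.
rewrite Hk /=; apply/andP; split.
  by apply: (nat_same_type HF); rewrite !rename_word_cat Ek Ek'.
apply: perm_nat_word; rewrite rename_word_cat -Ek'; apply: perm_trans Hw' _.
rewrite perm_cat2r -(perm_cat2r (nat_word k)) -rename_word_cat.
apply: (@perm_trans _ (nat_word w)); last exact: perm_map.
by rewrite perm_sym -Ek.
Qed.

Lemma path_sound R w p : path (step_check R) w p ->
  star (nat_rules R) (nat_word w) (nat_word (last w p)).
Proof.
elim: p w => [|x p IHp] w /=; first by move=> _; apply: star_refl.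
by move=> /andP[/step_check_sound H /IHp]; apply: StarStep.
Qed.

(** Rules that create no atom keep a derivation within the atoms of its first word, so natural
    coordinates persist. *)
Lemma path_complete R w v :
  (forall r : rule nat, r \in R -> {subset map fst r.2 <= map fst r.1}) ->
  star (nat_rules R) (nat_word w) v ->
  exists2 p, path (step_check R) w p & perm_eq v (nat_word (last w p)).
Proof.
move=> R_atoms; move E: (nat_word w) => u H.
elim: H w E => {u v}[u v uv|u u1 v Hu _ IH] w E.
  by exists [::] => //; rewrite /= E perm_sym.
have [|k Ek kw] := @nat_word_sub u1 [seq (a, p) | a <- map fst w, p <- map snd u1].
  move: Hu => [_ [F [g [/mapP[r rR ->] HF Hw Hu1]]]] x xu1.
  have : x.1 \in map fst u.
    rewrite (perm_mem (perm_map fst Hw)) map_cat mem_cat.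
    have : x \in u1 by [].
    rewrite (perm_mem Hu1) mem_cat => /orP[xg|]; first by rewrite map_f.
    move=> /mapP[_ /mapP[y yr ->] ->] /=; apply/orP; right.
    have /(R_atoms _ rR)/mapP[z zr E2] : y.1 \in map fst r.2 by apply: map_f.
    apply/mapP; exists (F (nat_atom z.1), z.2); last by rewrite /= E2.
    by rewrite /rename_word -map_comp; apply/mapP; exists z.
  rewrite -E => /mapP[_ /mapP[y yw ->] xE] /=.
  apply/mapP; exists (y.1, x.2); last by move: xE => /= <-; rewrite -surjective_pairing.
  by apply/allpairsP; exists (y.1, x.2); split=> //=; apply: map_f.
have [p pp vp] := IH k (esym Ek); exists (k :: p) => //=.
by rewrite pp andbT; apply: step_check_complete; rewrite -Ek E.
Qed.

(** * Certificates *)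

(** A firing sequence may pass through atoms lying between consecutive natural coordinates of [s]
    and [t]. It is therefore run between other words, of the same joint type, whose coordinates
    leave enough room. *)
Definition positive_check (T : seq (rule nat)) (s t : word nat)
    (c : word nat * (seq (word nat) * word nat)) : bool :=
  [&& size s == size c.1, same_type (s ++ t) (c.1 ++ c.2.2), path (step_check T) c.1 c.2.1 &
      perm_eq (last c.1 c.2.1) c.2.2].

Lemma rename_word_cat_inv d d' (K : orderType d) (K' : orderType d') (F : seq K -> seq K')
    (u v : word K) (u' v' : word K') :
  size u = size u' -> u' ++ v' = rename_word F (u ++ v) ->
  u' = rename_word F u /\ v' = rename_word F v.
Proof.
move=> sz /eqP; rewrite rename_word_cat eqseq_cat ?size_map //.
by move=> /andP[/eqP-> /eqP->].
Qed.

Fixpoint derivation R (u : word rat) p v : Prop :=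
  if p is w :: p' then word_step R u w /\ derivation R w p' v else perm_eq u v.

Lemma star_derivation R u v : star R u v -> exists p, derivation R u p v.
Proof.
elim=> [x y xy|x x1 x2 Hx _ [p Hp]]; first by exists [::].
by exists (x1 :: p).
Qed.

Lemma derivation_path T (G : seq rat -> seq rat) rho u p v : atom_embedding G ->
  (forall w, w \in u :: p -> nat_word (rename_word rho w) = rename_word G w) ->
  derivation (nat_rules T) u p v ->
  path (step_check T) (rename_word rho u) (map (rename_word rho) p) &&
  perm_eq (last (rename_word rho u) (map (rename_word rho) p)) (rename_word rho v).
Proof.
move=> HG; elim: p u => [|w p IHp] u EG /=; first exact: perm_map.
move=> [uw wv]; rewrite step_check_complete /=; last first.
  by rewrite !EG ?in_cons ?eqxx ?orbT //; apply: step_rename.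
by apply: IHp => // x xp; apply: EG; rewrite in_cons xp orbT.
Qed.

(** For completeness all words of a derivation are ranked together; conversely, homogeneity carries
    the certified sequence back to [s] and [t]. *)
Lemma positive_checkP T s t :
  (exists c, positive_check T s t c) <-> star (nat_rules T) (nat_word s) (nat_word t).
Proof.
split=> [[[s' [p t']] /and4P[/= /eqP sz st /path_sound H Hp]]|H].
  have [F HF] := same_typeP (same_type_nat (same_type_sym st)).
  rewrite [nat_word (s' ++ t')]rename_word_cat [nat_word (s ++ t)]rename_word_cat.
  move=> /rename_word_cat_inv[|-> ->]; first by rewrite !size_map.
  apply: star_permr (star_rename HF H); apply: perm_map; exact: perm_map.
have [p] := star_derivation H => {H}; set u := nat_word s; set v := nat_word t.
have [G [_ [HG _ EG _ _]]] := compress [:: u, v & p].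
set rho := map _ in EG => Hp.
exists (rename_word rho u, (map (rename_word rho) p, rename_word rho v)).
have Eu := EG u; have Ev := EG v.
have st : same_type (s ++ t) (rename_word rho u ++ rename_word rho v).
  apply: (nat_same_type HG); rewrite !rename_word_cat Eu ?Ev ?in_cons ?eqxx ?orbT //.
rewrite /positive_check !size_map eqxx st /=.
apply: (derivation_path HG) Hp => w; rewrite in_cons => /predU1P[->|wp]; apply: EG.
  exact: mem_head.
by rewrite !in_cons wp !orbT.
Qed.

(** * Certificates of unreachability *)

Definition letters l D N : word nat :=
  [seq (a, p) | a <- words_over (iota 0 N) l, p <- iota 0 D].

Definition instances (L : word nat) (r : rule nat) : seq (rule nat) :=
  [seq k <- [seq (k1, k2) | k1 <- words_over L (size r.1), k2 <- words_over L (size r.2)]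
     | same_type (r.1 ++ r.2) (k.1 ++ k.2)].

(* All overlaps of instances of the two rules occur, up to a change of atoms,
   among the instances over this finite set of letters. *)
Definition critical_pairs l D (r1 r2 : rule nat) : seq (rule nat) :=
  let L := letters l D (l * (size r1.1 + size r1.2 + (size r2.1 + size r2.2))) in
  [seq (seq_diff k2.1 k1.1 ++ k1.2, seq_diff k1.1 k2.1 ++ k2.2)
     | k1 <- instances L r1, k2 <- instances L r2].

(** The joinability conditions of [separates], up to embeddings. A single atom suffices for the
    exchange of colours, since every atom of length [l] is its image under some embedding. *)
Definition obligations l d (B T : seq (rule nat)) : seq (rule nat) :=
  flatten [seq critical_pairs l d.*2.+2 r1 r2 | r1 <- B, r2 <- B] ++
  [seq (hidden_copy r.1 ++ marks 1 (r.1 ++ r.2), hidden_copy r.2 ++ marks 1 (r.1 ++ r.2))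
     | r <- T] ++
  [seq let a := nseq l 0 in
       ([:: (a, i.*2.+3); (a, 0); (a, 1)], [:: (a, i.*2.+2); (a, 0); (a, 1)])
     | i <- iota 0 d].

Definition meets (B : seq (rule nat)) (o : rule nat) (j : seq (word nat) * seq (word nat)) :=
  [&& path (step_check B) o.1 j.1, path (step_check B) o.2 j.2 &
      perm_eq (last o.1 j.1) (last o.2 j.2)].

Definition irreducible_check (R : seq (rule nat)) (w : word nat) : bool :=
  all (fun r => all (fun k => ~~ (same_type r.1 k && perm_eq w (seq_diff w k ++ k)))
    (words_over w (size r.1))) R.

(** [c.1] is the basis, [c.2.1] an unordered pool in which each obligation must find a pair of
    joining paths, and [c.2.2] holds reductions of the visible copies of [s] and [t] to normal
    form. *)
Definition negative_check l d (T : seq (rule nat)) (s t : word nat)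
    (c : seq (rule nat) *
         (seq (seq (word nat) * seq (word nat)) * (seq (word nat) * seq (word nat)))) : bool :=
  let B := c.1 in
  let s1 := visible_copy s ++ marks 0 (s ++ t) in
  let t1 := visible_copy t ++ marks 0 (s ++ t) in
  [&& all (rule_ok l d.*2.+2) B,
      all (fun o => has (meets B o) c.2.1) (obligations l d B T),
      path (step_check (visible_rules B)) s1 c.2.2.1,
      path (step_check (visible_rules B)) t1 c.2.2.2,
      irreducible_check (visible_rules B) (last s1 c.2.2.1),
      irreducible_check (visible_rules B) (last t1 c.2.2.2) &
      ~~ perm_eq (last s1 c.2.2.1) (last t1 c.2.2.2)].

Lemma irreducible_checkP R w :
  irreducible_check R w <-> forall x, ~ word_step (nat_rules R) (nat_word w) x.
Proof.
split=> [/allP H x|H].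
  move=> [_ [F [g [/mapP[r rR ->] HF Hw _]]]]; rewrite /= in Hw.
  have [|k Ek kw] := @nat_word_sub (rename_word F (nat_word r.1)) w.
    by move=> y yr; rewrite (perm_mem Hw) mem_cat yr orbT.
  have sk : size k = size r.1 by have := congr1 size Ek; rewrite !size_map.
  have cnt_w y : count_mem y k <= count_mem y w.
    rewrite -!(count_rename _ _ nat_atom_embedding) (permP Hw) count_cat Ek.
    exact: leq_addl.
  have /allP/(_ k) := H r rR; rewrite mem_words_over sk eqxx perm_seq_diff //.
  rewrite (nat_same_type HF) // => /(_ _)/negP; apply=> //.
  by apply/allP.
apply/allP => r rR; apply/allP => k kw; apply/negP => /andP[/same_type_nat st Hw].
have [F HF EF] := same_typeP st.
apply: (H (nat_word (seq_diff w k) ++ rename_word F (nat_word r.2))).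
exists (nat_word r.1, nat_word r.2), F, (nat_word (seq_diff w k)); split=> //.
  by apply/mapP; exists r.
by rewrite /= -EF -rename_word_cat; apply: perm_map.
Qed.

Section RuleRename.
Context d d' (K : orderType d) (K' : orderType d') (F : seq K -> seq K').
Hypothesis HF : atom_embedding F.

Lemma has_marks_rename (w : word K) : has_marks (rename_word F w) = has_marks w.
Proof.
rewrite /has_marks all_map; apply: eq_all => x /=.
rewrite -[(F x.1, _)]/((fun y => (F y.1, y.2)) (x.1, odd x.2 : nat)) mem_map //.
by move=> [a p] [b q] [/(atom_embedding_inj HF) -> ->].
Qed.

Lemma rule_ok_rename l D (r : rule K) :
  rule_ok l D (rename_word F r.1, rename_word F r.2) = rule_ok l D r.
Proof.
have permE (u v : word K) : perm_eq (rename_word F u) (rename_word F v) = perm_eq u v.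
  apply/idP/idP; last exact: perm_map.
  exact: perm_rename (atom_embedding_inj HF).
rewrite /rule_ok /= !wf_word_rename // word_lt_rename // has_marks_rename.
rewrite !mark_part_rename !hidden_rename !permE.
by rewrite [hidden_marks_only (rename_word _ _)]/hidden_marks_only all_map.
Qed.
End RuleRename.

Lemma visible_rules_rename (K K' : Type) (F : seq K -> seq K') (B : seq (rule K)) :
  visible_rules [seq (rename_word F r.1, rename_word F r.2) | r <- B] =
  [seq (rename_word F r.1, rename_word F r.2) | r <- visible_rules B].
Proof.
elim: B => //= r B IHB; rewrite /visible_rules /= in IHB *.
have -> : hidden_marks_only (rename_word F r.1) = hidden_marks_only r.1.
  by rewrite /hidden_marks_only all_map.
by case: ifP => //= _; rewrite IHB !visible_rename.
Qed.

Lemma meets_joinable B o j :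
  meets B o j -> joinable (nat_rules B) (nat_word o.1) (nat_word o.2).
Proof.
move=> /and3P[/path_sound H1 /path_sound H2 E].
exists (nat_word (last o.1 j.1)); split=> //; apply: star_permr H2.
by rewrite perm_sym; apply: perm_map.
Qed.

Lemma joinable_meets B (o : rule nat) :
  (forall r : rule nat, r \in B -> {subset map fst r.2 <= map fst r.1}) ->
  joinable (nat_rules B) (nat_word o.1) (nat_word o.2) -> exists j, meets B o j.
Proof.
move=> HB [w [/(path_complete HB)[p Hp wp] /(path_complete HB)[q Hq wq]]].
exists (p, q); rewrite /meets Hp Hq /=; apply: perm_nat_word.
by apply: perm_trans wq; rewrite perm_sym.
Qed.

Lemma has_collect (X : eqType) (Y : Type) (Q : X -> Y -> bool) (L : seq X) :
  (forall x, x \in L -> exists y, Q x y) -> exists J, all (fun x => has (Q x) J) L.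
Proof.
elim: L => [|x L IHL] H; first by exists [::].
have [|J HJ] := IHL; first by move=> y yL; apply: H; rewrite in_cons yL orbT.
have [y Hy] := H x (mem_head _ _); exists (y :: J) => /=; rewrite Hy /=.
by apply: sub_all HJ => z /= ->; rewrite orbT.
Qed.

Section RenameRules.
Variables (B : seq (rule rat)) (G H : seq rat -> seq rat).
Hypotheses (HG : atom_embedding G) (HH : atom_embedding H).
Hypothesis GK : forall r : rule rat, r \in B ->
  rename_word H (rename_word G r.1) = r.1 /\ rename_word H (rename_word G r.2) = r.2.

Let B' : seq (rule rat) := [seq (rename_word G r.1, rename_word G r.2) | r <- B].

(** Steps already range over all embeddings, so replacing the rules by their images under [G] only
    composes these with [G] or, in the other direction, with [H]. *)
Lemma step_rename_rules u v : word_step B' u v <-> word_step B u v.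
Proof.
split=> [[_ [F [g [/mapP[r rB ->] HF Hu Hv]]]]|[r [F [g [rB HF Hu Hv]]]]].
  exists r, (F \o G), g; split=> //; last 2 first.
  - by rewrite -rename_word_comp.
  - by rewrite -rename_word_comp.
  by move=> a b; rewrite /= HF HG.
have [E1 E2] := GK rB.
exists (rename_word G r.1, rename_word G r.2), (F \o H), g; split.
- by apply/mapP; exists r.
- by move=> a b; rewrite /= HF HH.
- by rewrite /= -rename_word_comp E1.
- by rewrite /= -rename_word_comp E2.
Qed.

Lemma star_rename_rules u v : star B u v -> star B' u v.
Proof.
elim=> [x y xy|x x1 x2 Hx _ IH]; first exact: StarPerm.
by apply: StarStep IH; apply/step_rename_rules.
Qed.

Lemma joinable_rename_rules u v : joinable B u v -> joinable B' u v.
Proof. by move=> [w [H1 H2]]; exists w; split; apply: star_rename_rules. Qed.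
End RenameRules.

Lemma separates_rename_rules l d B T s t (G H : seq rat -> seq rat) :
  atom_embedding G -> atom_embedding H ->
  (forall r : rule rat, r \in B ->
    rename_word H (rename_word G r.1) = r.1 /\ rename_word H (rename_word G r.2) = r.2) ->
  separates l d B T s t ->
  separates l d [seq (rename_word G r.1, rename_word G r.2) | r <- B] T s t.
Proof.
move=> HG HH GK [C1 C2 C3 C4 [s0 [t0 [Hs Ht irs irt nst]]]].
have vGK (r : rule rat) : r \in visible_rules B ->
    rename_word H (rename_word G r.1) = r.1 /\ rename_word H (rename_word G r.2) = r.2.
  move=> /mapP[r0 + ->]; rewrite mem_filter => /andP[_ /GK[E1 E2]] /=.
  by rewrite -!visible_rename E1 E2.
split.
- by move=> _ /mapP[r rB ->]; rewrite rule_ok_rename //; apply: C1.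
- move=> _ _ F1 F2 /mapP[r1 rB1 ->] /mapP[r2 rB2 ->] HF1 HF2 /=.
  rewrite !rename_word_comp; apply: (joinable_rename_rules HG HH GK).
  have HF1' : atom_embedding (F1 \o G) by move=> a b; rewrite /= HF1 HG.
  have HF2' : atom_embedding (F2 \o G) by move=> a b; rewrite /= HF2 HG.
  exact: (C2 r1 r2 _ _ rB1 rB2 HF1' HF2').
- by move=> r rT; apply: (joinable_rename_rules HG HH GK); apply: C3.
- by move=> a i sa ld; apply: (joinable_rename_rules HG HH GK); apply: C4.
exists s0, t0; rewrite visible_rules_rename; split=> //.
- exact: (star_rename_rules HG HH vGK).
- exact: (star_rename_rules HG HH vGK).
- by move=> x /(step_rename_rules HG HH vGK); apply: irs.
- by move=> x /(step_rename_rules HG HH vGK); apply: irt.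
Qed.

Lemma size_coordinates l D (ws : seq (word rat)) :
  (forall w, w \in ws -> wf_word l D w) -> size (coordinates ws) = l * size (flatten ws).
Proof.
move=> H; have : wf_word l D (flatten ws).
  by apply/allP => x /flattenP[w /H/allP ww]; apply: ww.
rewrite /coordinates; elim: (flatten ws) => [|x w IHw] /=; first by rewrite muln0.
by move=> /andP[/andP[/eqP sx _] /IHw E]; rewrite size_cat E sx mulnS.
Qed.

Lemma mem_letters l D N x : (x \in letters l D N) =
  [&& size x.1 == l, all (fun n => n < N) x.1 & x.2 < D].
Proof.
have E (a : seq nat) : all (mem (iota 0 N)) a = all (fun n => n < N) a.
  by apply: eq_all => n; rewrite /= mem_iota.
apply/allpairsP/idP => [[[a p] /= [+ + ->]] /=|].
  by rewrite mem_words_over mem_iota E => /andP[-> ->].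
case: x => a p /= /and3P[sa aN pD]; exists (a, p); split=> //=.
  by rewrite mem_words_over sa E.
by rewrite mem_iota.
Qed.

Lemma mem_instances L (r k : rule nat) : (k \in instances L r) =
  [&& same_type (r.1 ++ r.2) (k.1 ++ k.2), k.1 \in words_over L (size r.1) &
      k.2 \in words_over L (size r.2)].
Proof.
rewrite mem_filter; congr andb; apply/allpairsP/andP => [[[k1 k2] /= [? ? ->]]|[]] //.
by case: k => k1 k2 /= ? ?; exists (k1, k2).
Qed.

Lemma instance_embedding L (r k : rule nat) : k \in instances L r ->
  exists2 F, atom_embedding F &
    nat_word k.1 = rename_word F (nat_word r.1) /\ nat_word k.2 = rename_word F (nat_word r.2).
Proof.
rewrite mem_instances => /and3P[/same_type_nat st + _].
rewrite mem_words_over => /andP[/eqP sz _].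
have [F HF E] := same_typeP st; exists F => //.
apply: rename_word_cat_inv; first by rewrite !size_map.
by rewrite -!rename_word_cat.
Qed.

Lemma visible_rules_nat B : visible_rules (nat_rules B) = nat_rules (visible_rules B).
Proof. exact: visible_rules_rename. Qed.

(** Infinitely many pairs of embeddings have to be covered. Ranking the four sides of an overlap
    jointly turns it into one of the listed critical pairs, and the embedding [H] carries
    joinability back. *)
Theorem negative_check_sound l d T s t c : negative_check l d T s t c ->
  separates l d (nat_rules c.1) (nat_rules T) (nat_word s) (nat_word t).
Proof.
case: c => B [J [ps pt]] /=.
move=> /and5P[/= /allP Bok /allP ob /path_sound Hs /path_sound Ht].
move=> /and3P[/irreducible_checkP irs /irreducible_checkP irt nst].
have join (o : rule nat) : o \in obligations l d B T ->
    joinable (nat_rules B) (nat_word o.1) (nat_word o.2).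
  by move=> /ob/hasP[j _ /meets_joinable].
have inj := atom_embedding_inj nat_atom_embedding.
split.
- by move=> _ /mapP[r rB ->]; rewrite rule_ok_rename ?Bok //; apply: nat_atom_embedding.
- move=> _ _ F1 F2 /mapP[r1 rB1 ->] /mapP[r2 rB2 ->] HF1 HF2 /=.
  set k1 := rename_word F1 _; set k1' := rename_word F1 _.
  set k2 := rename_word F2 _; set k2' := rename_word F2 _.
  have wf (r : rule nat) (F : seq rat -> seq rat) : r \in B -> atom_embedding F ->
      wf_word l d.*2.+2 (rename_word F (nat_word r.1)) &&
      wf_word l d.*2.+2 (rename_word F (nat_word r.2)).
    move=> /Bok/and5P[w1 w2 _ _ _] HF.
    by rewrite !wf_word_rename ?w1 ?w2 //; apply: nat_atom_embedding.
  have /andP[w1 w1'] := wf r1 F1 rB1 HF1; have /andP[w2 w2'] := wf r2 F2 rB2 HF2.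
  pose ws := [:: k1; k1'; k2; k2'].
  have wws w : w \in ws -> wf_word l d.*2.+2 w.
    by rewrite !inE => /or4P[] /eqP->.
  have [G [H [HG HH EG EH Hc]]] := compress ws; set rho := map _ in EG EH Hc.
  set N := size _ in Hc.
  (* Each letter of the four sides contributes [l] coordinates, and renaming keeps the number of
     letters; this is the bound in [critical_pairs]. *)
  have NE : N = l * (size r1.1 + size r1.2 + (size r2.1 + size r2.2)).
    rewrite /N (size_coordinates wws) /= cats0 !size_cat !size_map; congr muln; lia.
  have over w n : w \in ws -> size w = n ->
      rename_word rho w \in words_over (letters l d.*2.+2 N) n.
    move=> wws' sz; rewrite mem_words_over size_map sz eqxx; apply/allP => x xw.
    rewrite /= mem_letters (Hc w) //=.
    move: xw (wws _ wws') => /mapP[y yw ->] /allP/(_ _ yw)/andP[sy py] /=.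
    by rewrite size_map sy.
  have inst (r : rule nat) F : atom_embedding F -> 
      rename_word F (nat_word r.1) \in ws -> rename_word F (nat_word r.2) \in ws ->
      (rename_word rho (rename_word F (nat_word r.1)),
       rename_word rho (rename_word F (nat_word r.2))) \in instances (letters l d.*2.+2 N) r.
    move=> HF i1 i2; rewrite mem_instances /= !over ?size_map // !andbT.
    apply: (@nat_same_type _ _ (G \o F)); first by move=> a b; rewrite /= HG HF.
    by rewrite !rename_word_cat !EG // -!(rename_word_comp F G).
  have i1 := inst r1 F1 HF1; have i2 := inst r2 F2 HF2.
  rewrite -/k1 -/k1' -/k2 -/k2' !inE !eqxx ?orbT in i1 i2.
  pose q1 : rule nat := (rename_word rho k1, rename_word rho k1').
  pose q2 : rule nat := (rename_word rho k2, rename_word rho k2').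
  pose o : rule nat := (seq_diff q2.1 q1.1 ++ q1.2, seq_diff q1.1 q2.1 ++ q2.2).
  have oob : o \in obligations l d B T.
    rewrite mem_cat; apply/orP; left; apply/flattenP.
    exists (critical_pairs l d.*2.+2 r1 r2); first by apply/allpairsP; exists (r1, r2).
    by apply/allpairsP; exists (q1, q2); rewrite -NE; split=> //; [apply: i1|apply: i2].
  have := joinable_rename HH (join _ oob).
  have injH := atom_embedding_inj HH.
  rewrite /o /= !rename_word_cat !rename_seq_diff //.
  by rewrite !EH ?inE ?eqxx ?orbT.
- move=> _ /mapP[r rT ->] /=.
  rewrite -rename_word_cat !hidden_copy_rename !marks_rename -!rename_word_cat.
  apply: (join (_, _)); rewrite !mem_cat; apply/orP; right; apply/orP; left.
  by apply/mapP; exists r.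
- move=> a i sa ld; pose a0 := nseq l 0.
  (* Any two atoms of length [l] have the same type. *)
  have [F HF [Fa]] : exists2 F, atom_embedding F &
      [:: (a, 0)] = rename_word F [:: (nat_atom a0, 0)].
    apply: same_typeP; rewrite /same_type /= !cmp_self size_map size_nseq sa.
    by rewrite !eqxx.
  pose o : rule nat := ([:: (a0, i.*2.+3); (a0, 0); (a0, 1)],
    [:: (a0, i.*2.+2); (a0, 0); (a0, 1)]).
  have oob : o \in obligations l d B T.
    rewrite !mem_cat; apply/orP; right; apply/orP; right.
    by apply/mapP; exists i; rewrite // mem_iota.
  by have := joinable_rename HF (join o oob); rewrite /o /= -Fa.
exists (nat_word (last (visible_copy s ++ marks 0 (s ++ t)) ps)),
  (nat_word (last (visible_copy t ++ marks 0 (s ++ t)) pt)).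
rewrite visible_rules_nat; split=> //.
- by rewrite -rename_word_cat visible_copy_rename marks_rename -rename_word_cat.
- by rewrite -rename_word_cat visible_copy_rename marks_rename -rename_word_cat.
by apply: contra nst; apply: perm_nat_word.
Qed.

(** The rules of [B] are ranked jointly and generate the same steps as before. As they create no
    atom, the derivations that start from natural words are paths of natural words. *)
Theorem negative_check_complete l d T s t B :
  separates l d B (nat_rules T) (nat_word s) (nat_word t) ->
  exists c, negative_check l d T s t c.
Proof.
move=> sep; pose ws := [seq r.1 | r <- B] ++ [seq r.2 | r <- B].
have [G [H [HG HH EG EH _]]] := compress ws; set rho := map _ in EG EH.
pose Bn : seq (rule nat) := [seq (rename_word rho r.1, rename_word rho r.2) | r <- B].
have in1 (r : rule rat) : r \in B -> r.1 \in ws.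
  by move=> rB; rewrite mem_cat map_f.
have in2 (r : rule rat) : r \in B -> r.2 \in ws.
  by move=> rB; rewrite mem_cat orbC map_f.
have BnE : nat_rules Bn = [seq (rename_word G r.1, rename_word G r.2) | r <- B].
  by rewrite /nat_rules /Bn -map_comp; apply/eq_in_map => r rB /=; rewrite !EG ?in1 ?in2.
have GK (r : rule rat) : r \in B ->
    rename_word H (rename_word G r.1) = r.1 /\ rename_word H (rename_word G r.2) = r.2.
  by move=> rB; rewrite -!EG ?in1 ?in2 // !EH ?in1 ?in2.
have := separates_rename_rules HG HH GK sep.
rewrite -BnE => {sep} -[C1 C2 C3 C4 [s0 [t0 [Hs Ht irs irt nst]]]].
have Bok : all (rule_ok l d.*2.+2) Bn.
  apply/allP => r rB; rewrite -(rule_ok_rename nat_atom_embedding); apply: C1.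
  by apply/mapP; exists r.
have atoms (r : rule nat) : r \in Bn -> {subset map fst r.2 <= map fst r.1}.
  by move=> rB; apply: (rule_ok_atoms (allP Bok r rB)).
have vatoms (r : rule nat) : r \in visible_rules Bn -> {subset map fst r.2 <= map fst r.1}.
  move=> /mapP[r0 + ->]; rewrite mem_filter => /andP[_ rB].
  exact: (rule_ok_visible_atoms (allP Bok r0 rB)).
have [|J HJ] := has_collect (Q := meets Bn) (L := obligations l d Bn T).
  move=> o; rewrite !mem_cat => /or3P[].
  - move=> /flattenP[_ /allpairsP[[r1 r2] [/= rB1 rB2 ->]]].
    move=> /allpairsP[[k1 k2] [/= /instance_embedding[F1 HF1 [E1 E1']]]].
    move=> /instance_embedding[F2 HF2 [E2 E2']] ->.
    apply: joinable_meets => //=.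
    rewrite !rename_word_cat !rename_seq_diff ?E1 ?E1' ?E2 ?E2';
      try exact: (atom_embedding_inj nat_atom_embedding).
    apply: (C2 (nat_word r1.1, nat_word r1.2) (nat_word r2.1, nat_word r2.2)) => //.
      by apply/mapP; exists r1.
    by apply/mapP; exists r2.
  - move=> /mapP[r rT ->]; apply: joinable_meets => //=.
    rewrite !rename_word_cat -!hidden_copy_rename -!marks_rename rename_word_cat.
    by apply: (C3 (nat_word r.1, nat_word r.2)); apply/mapP; exists r.
  move=> /mapP[i]; rewrite mem_iota => ld ->; apply: joinable_meets => //=.
  by apply: C4 => //; rewrite size_map size_nseq.
rewrite visible_rules_nat !visible_copy_rename -!rename_word_cat marks_rename
  -!rename_word_cat in Hs Ht irs irt.
have [ps Hps Es] := path_complete vatoms Hs.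
have [pt Hpt Et] := path_complete vatoms Ht.
exists (Bn, (J, (ps, pt))); rewrite /negative_check /= Bok HJ Hps Hpt /=.
apply/and3P; split.
- apply/irreducible_checkP => x Hx; apply: (irs x); apply: step_perm Hx => //.
  by rewrite perm_sym.
- apply/irreducible_checkP => x Hx; apply: (irt x); apply: step_perm Hx => //.
  by rewrite perm_sym.
apply: contra nst => st; apply: perm_trans Es _; apply: perm_trans (perm_map _ st) _.
by rewrite perm_sym.
Qed.

(** * Petri nets as rewriting of words *)

Section MonomialWords.
Variable C : choiceType.
Implicit Types (u v w : seq C) (m : {cmonom C}).

Lemma monom_of_wordE w x : monom_of_word w x = count_mem x w.
Proof.
rewrite /monom_of_word; elim: w => [|y w IHw]; first by rewrite big_nil cm1.
by rewrite big_cons cmM cmU IHw.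
Qed.

Lemma monom_of_word_eq u v : monom_of_word u = monom_of_word v <-> perm_eq u v.
Proof.
split=> [E|/permP uv]; last by apply/eqP/cmP => x; rewrite !monom_of_wordE uv.
by apply/allP => x _; rewrite /= -!monom_of_wordE E.
Qed.

Lemma monom_of_word_cat u v :
  monom_of_word (u ++ v) = mmul (monom_of_word u) (monom_of_word v).
Proof. by rewrite /monom_of_word big_cat. Qed.

Lemma monom_of_word_surj m : exists w, m = monom_of_word w.
Proof.
exists (flatten [seq nseq (m x) x | x <- finsupp m]).
apply/eqP/cmP => y; rewrite monom_of_wordE count_flatten -map_comp.
have E (s : seq C) : uniq s ->
    sumn [seq (count_mem y \o (fun x => nseq (m x) x)) x | x <- s] = (y \in s) * m y.
  elim: s => //= x s IHs /andP[xs /IHs->]; rewrite count_nseq in_cons /=.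
  rewrite eq_sym; case: eqVneq => [->|_] /=; last by rewrite mul0n.
  by rewrite (negbTE xs) addn0.
by rewrite E ?fset_uniq //; case: mdomP => //; rewrite mul1n.
Qed.

Lemma rename_monom_of_word (f : C -> C) w :
  rename f (monom_of_word w) = monom_of_word (map f w).
Proof.
rewrite /rename [RHS]/monom_of_word big_map -(big_undup_iterop_count _ w xpredT).
rewrite (perm_big (undup w)) /=; last first.
  apply: uniq_perm; [exact: fset_uniq|exact: undup_uniq|] => x.
  by rewrite mem_undup -cmE_neq0 monom_of_wordE -lt0n -has_count has_pred1.
by apply: eq_bigr => x _; rewrite monom_of_wordE.
Qed.
End MonomialWords.

(** * Lexicographic powers of the rationals as lists *)

(** The index is one less than the number of factors, so lists have length [m.+1]. *)
Fixpoint to_seq m : iter m (lexprod ratQ) ratQ -> seq rat :=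
  match m return iter m (lexprod ratQ) ratQ -> seq rat with
  | 0 => fun q => [:: q]
  | m'.+1 => fun x => x.1 :: to_seq x.2
  end.

Fixpoint of_seq m (s : seq rat) : iter m (lexprod ratQ) ratQ :=
  match m return iter m (lexprod ratQ) ratQ with
  | 0 => head 0%R s
  | m'.+1 => (head 0%R s, of_seq m' (behead s))
  end.

Lemma size_to_seq m (x : iter m (lexprod ratQ) ratQ) : size (to_seq x) = m.+1.
Proof. by elim: m x => //= m IHm x; rewrite IHm. Qed.

Lemma to_seqK m : cancel (@to_seq m) (of_seq m).
Proof. by elim: m => //= m IHm [q x] /=; rewrite IHm. Qed.

Lemma of_seqK m s : size s = m.+1 -> to_seq (of_seq m s) = s.
Proof.
elim: m s => [|m IHm] [|q s] //=; first by case: s.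
by move=> [sz]; rewrite IHm.
Qed.

(** Tuples with entries among two points are the images of Boolean tuples; this lets one quantify
    over all relations between two points. *)
Definition select (A : Type) (a b : A) (c : bool) := if c then a else b.

Lemma map_tuple_comp n (X Y Z : Type) (f : X -> Y) (g : Y -> Z) (t : n.-tuple X) :
  map_tuple g (map_tuple f t) = map_tuple (g \o f) t.
Proof. by apply: val_inj; rewrite /= -map_comp. Qed.

Lemma eq_map_tuple n (X Y : Type) (f g : X -> Y) (t : n.-tuple X) :
  f =1 g -> map_tuple f t = map_tuple g t.
Proof. by move=> fg; apply: val_inj; apply: eq_map. Qed.

Lemma ratQ_pattern (a b a' b' : rat) :
  (forall x : 2.-tuple bool, interp (s := ratQ) (r := tt) (map_tuple (select a b) x) <->
     interp (s := ratQ) (r := tt) (map_tuple (select a' b') x)) ->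
  (a <= b)%R = (a' <= b')%R /\ (b <= a)%R = (b' <= a')%R.
Proof.
move=> H; have E c c' := H [tuple c; c'].
have H1 := E true false; have H2 := E false true.
by split; apply/idP/idP; move: H1 H2; rewrite /= !tnth_map /= /select /=; tauto.
Qed.

(** The relation of the first factor compares the heads. Those of the second factor hold only
    between points with equal heads; there they are at disposal and the induction continues. Two
    pairs of points are compared, rather than a map, because a map of the power need not come from
    maps of the factors. *)
Lemma lexpow_pattern m (a b a' b' : iter m (lexprod ratQ) ratQ) :
  (forall (r : symbol (iter m (lexprod ratQ) ratQ)) (x : (arity r).-tuple bool),
     interp (map_tuple (select a b) x) <-> interp (map_tuple (select a' b') x)) ->
  cmp (to_seq a) (to_seq b) = cmp (to_seq a') (to_seq b').
Proof.
elim: m a b a' b' => [|m IHm] a b a' b' H.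
  have [ab ba] := ratQ_pattern (H tt).
  by rewrite /= !cmp_cons !ltNge ab ba.
have [ab ba] : (a.1 <= b.1)%R = (a'.1 <= b'.1)%R /\ (b.1 <= a.1)%R = (b'.1 <= a'.1)%R.
  apply: ratQ_pattern => x.
  have := H (inl tt) x; rewrite /= !map_tuple_comp.
  have E (y z : iter m.+1 (lexprod ratQ) ratQ) :
      map_tuple (fst \o select y z) x = map_tuple (select y.1 z.1) x.
    by apply: eq_map_tuple; case.
  by rewrite !E.
rewrite /= !cmp_cons !ltNge ab ba; case: (ltgtP a'.1 b'.1) ab ba => // a'b' ab ba.
have {}ab : a.1 = b.1 by apply: le_anti; rewrite ab ba.
congr _.+3; apply: IHm => r x.
have := H (inr r) x; rewrite /= !map_tuple_comp.
have E (y z : iter m.+1 (lexprod ratQ) ratQ) :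
    map_tuple (snd \o select y z) x = map_tuple (select y.2 z.2) x.
  by apply: eq_map_tuple; case.
have F (y z : iter m.+1 (lexprod ratQ) ratQ) : y.1 = z.1 -> forall i j,
    (tnth (map_tuple (select y z) x) i).1 = (tnth (map_tuple (select y z) x) j).1.
  by move=> yz i j; rewrite !tnth_map; case: (tnth x i); case: (tnth x j).
rewrite !E => -[H1 H2]; split=> K.
  by have [] := H1 (conj (F _ _ ab) K).
by have [] := H2 (conj (F _ _ a'b') K).
Qed.

Lemma cmp_head (x y x' y' : rat) a b a' b' :
  cmp (x' :: a') (y' :: b') = cmp (x :: a) (y :: b) ->
  ((x' <= y')%R = (x <= y)%R) * (x' = y' <-> x = y).
Proof.
rewrite !cmp_cons; case: (ltgtP x' y') => H1; case: (ltgtP x y) => H2 // _; split=> //.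
all: by split=> E; move: H1 H2; rewrite E ltxx.
Qed.

(** A relation of the second factor involves only tuples over one first component [q], and over [q]
    the map acts as an embedding of the second factor, by induction. *)
Lemma lexpow_embedding m (f : iter m (lexprod ratQ) ratQ -> iter m (lexprod ratQ) ratQ) :
  (forall x y, cmp (to_seq (f x)) (to_seq (f y)) = cmp (to_seq x) (to_seq y)) ->
  embedding f.
Proof.
elim: m f => [|m IHm] f Hf r t.
  by rewrite /= !tnth_map (cmp_head (Hf _ _)).
have f1 x y : (f x).1 = (f y).1 <-> x.1 = y.1 := (cmp_head (Hf x y)).2.
case: r t => r t; rewrite /= !map_tuple_comp.
  by rewrite /= !tnth_map /= (cmp_head (Hf _ _)).
have [q Hq] : exists q, (forall i j, (tnth t i).1 = (tnth t j).1) ->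
    forall i, (tnth t i).1 = q.
  (* Without an index there is no component to read, and any [q] serves. *)
  have [i|none] := pickP (fun _ : 'I_(arity r) => true).
    by exists (tnth t i).1 => H j; apply: H.
  by exists 0%R => _ i; have := none i.
have IH := IHm (fun a => (f (q, a)).2).
have {}IH : embedding (fun a => (f (q, a)).2).
  apply: IH => x y; have := Hf (q, x) (q, y); rewrite /= cmp_consE.
  have -> : (f (q, x)).1 = (f (q, y)).1 by apply/f1.
  by rewrite cmp_consE => -[].
have E : (forall i j, (tnth t i).1 = (tnth t j).1) ->
    map_tuple (snd \o f) t = map_tuple (fun a => (f (q, a)).2) (map_tuple snd t).
  move=> /Hq H; apply: eq_from_tnth => i; rewrite !tnth_map /= -(H i).
  by rewrite -surjective_pairing.
split=> -[H1 H2].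
  have H1' i j : (tnth t i).1 = (tnth t j).1.
    by apply/f1; have := H1 i j; rewrite !tnth_map.
  by split=> //; rewrite E // in H2; apply/IH.
split; first by move=> i j; rewrite !tnth_map; apply/f1.
by rewrite E //; apply/IH.
Qed.

(** In a finite chain an order embedding moves no point down, by induction from the bottom, nor up,
    by induction from the top. Hence embeddings do not permute the places of a net. *)
Lemma ord_mono_id d (g : 'I_d -> 'I_d) : (forall i j, (g i <= g j) = (i <= j)) -> g =1 id.
Proof.
move=> Hg; have lt i j : (g i < g j) = (i < j) by rewrite !ltnNge Hg.
have le1 n (i : 'I_d) : i = n :> nat -> n <= g i.
  elim: n i => // n IHn i ni; have lt_n : n < d by rewrite -ltnS -ni ltnW // ltnS.
  have := IHn (Ordinal lt_n) erefl; move=> /leq_ltn_trans; apply.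
  by rewrite lt /= ni.
have le2 n (i : 'I_d) : d - i = n -> g i <= i.
  elim: n i => [|n IHn] i ni; first by have := ltn_ord i; lia.
  have [lt_i|le_i] := ltnP i.+1 d; last by have := ltn_ord (g i); lia.
  have := IHn (Ordinal lt_i); rewrite /= => H; rewrite -ltnS.
  apply: leq_trans (H _); last by lia.
  by rewrite lt /=.
by move=> i; apply: val_inj; apply/eqP; rewrite eqn_leq (le2 _ i erefl) (le1 _ i erefl).
Qed.

Section LetterWords.
Variables m d : nat.
Let A : structure := iter m (lexprod ratQ) ratQ.
Let C : structure := lexprod A (chain d).

Definition letter_of (x : (A * 'I_d)%type) : seq rat * nat := (to_seq x.1, x.2 : nat).
Definition word_of (w : seq C) : word rat := map letter_of w.

Lemma word_of_cat u v : word_of (u ++ v) = word_of u ++ word_of v.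
Proof. exact: map_cat. Qed.

Lemma letter_inj : injective letter_of.
Proof. by move=> [a i] [b j] /= [/(can_inj (@to_seqK m)) -> /val_inj->]. Qed.

Lemma word_of_perm u v : perm_eq (word_of u) (word_of v) <-> perm_eq u v.
Proof. by split; [apply: perm_map_inj; apply: letter_inj|apply: perm_map]. Qed.

Lemma word_of_wf w : wf_word m.+1 d (word_of w).
Proof. by apply/allP => _ /mapP[x _ ->] /=; rewrite size_to_seq eqxx ltn_ord. Qed.

Lemma word_of_surj (w : word rat) : wf_word m.+1 d w -> exists w', w = word_of w'.
Proof.
elim: w => [|[a i] w IHw] /=; first by exists [::].
move=> /andP[/andP[/eqP sa id]] /IHw[w' ->].
by exists ((of_seq m a, Ordinal id) :: w'); rewrite /= /letter_of /= of_seqK.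
Qed.

(** Since [cmp] is preserved, letters at one atom go to letters at one atom; between these two
    copies of the chain of places the embedding is the identity. *)
Lemma embedding_letters (f : A * 'I_d -> A * 'I_d) : @embedding C f ->
  (forall x y, cmp (to_seq (f x).1) (to_seq (f y).1) = cmp (to_seq x.1) (to_seq y.1)) /\
  forall x, (f x).2 = x.2.
Proof.
move=> Hf; have H1 x y : cmp (to_seq (f x).1) (to_seq (f y).1) = cmp (to_seq x.1) (to_seq y.1).
  apply: lexpow_pattern => r t.
  have := Hf (inl r) (map_tuple (select x y) t); rewrite /= !map_tuple_comp.
  rewrite (@eq_map_tuple _ _ _ _ (select (f x).1 (f y).1)); last by case.
  by rewrite (@eq_map_tuple _ _ _ (_ \o _) (select x.1 y.1)) //; case.
split=> // -[a i].
have f1 j k : (f (a, j)).1 = (f (a, k)).1.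
  apply: (can_inj (@to_seqK m)); apply: cmp_eq; first by rewrite !size_to_seq.
  by rewrite H1 cmp_self !size_to_seq.
have H2 j k : ((f (a, j)).2 <= (f (a, k)).2) = (j <= k).
  have := Hf (inr tt) (map_tuple (select (a, j) (a, k)) [tuple true; false]).
  rewrite /= !tnth_map /= => -[K1 K2].
  apply/idP/idP => le_jk.
    have [|_ +] := K1; last by rewrite ?tnth_map.
    split; last by rewrite ?tnth_map.
    by move=> i1 i2; rewrite !tnth_map; case: (tnth _ i1); case: (tnth _ i2); apply: f1.
  have [|_ +] := K2; last by rewrite ?tnth_map.
  split; last by rewrite ?tnth_map.
  by move=> i1 i2; rewrite !tnth_map; case: (tnth _ i1); case: (tnth _ i2).
exact: (ord_mono_id H2 i).
Qed.

Lemma letters_embedding (F : seq rat -> seq rat) : atom_embedding F ->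
  @embedding C (fun x : A * 'I_d => (of_seq m (F (to_seq x.1)), x.2)).
Proof.
move=> HF; pose f0 (a : A) : A := of_seq m (F (to_seq a)).
have Hf0 x y : cmp (to_seq (f0 x)) (to_seq (f0 y)) = cmp (to_seq x) (to_seq y).
  by rewrite !of_seqK ?HF // (size_atom_embedding _ HF) size_to_seq.
have inj0 : injective f0.
  move=> x y /(congr1 (@to_seq m)); rewrite !of_seqK ?(size_atom_embedding _ HF) ?size_to_seq //.
  by move=> /(atom_embedding_inj HF)/(can_inj (@to_seqK m)).
move=> [r|r] t; rewrite /= !map_tuple_comp.
  rewrite (@eq_map_tuple _ _ _ _ (f0 \o fst)) // -map_tuple_comp.
  exact: lexpow_embedding.
rewrite !tnth_map; split=> -[H1 H2]; split=> // i j.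
  by have := H1 i j; rewrite !tnth_map /=; apply: inj0.
by rewrite !tnth_map /= (H1 i j).
Qed.
End LetterWords.

Section NetWords.
Variables m d : nat.
Let A : structure := iter m (lexprod ratQ) ratQ.
Let C : structure := lexprod A (chain d).
Variable T : seq (seq C * seq C).

Definition word_rules : seq (rule rat) := [seq (word_of r.1, word_of r.2) | r <- T].

Lemma word_rules_wf (r : rule rat) : r \in word_rules ->
  wf_word m.+1 d r.1 && wf_word m.+1 d r.2.
Proof. by move=> /mapP[r0 _ ->] /=; rewrite !word_of_wf. Qed.

(** Only the action of [f] on the finitely many atoms of the rule matters; it is consistent and
    extends to an embedding of lists of rationals. *)
Lemma step_word_step u c' :
  step (presentation_of_words T) (monom_of_word u) c' ->
  exists2 v, c' = monom_of_word v & word_step word_rules (word_of u) (word_of v).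
Proof.
move=> [g [H [H' [[f [h [h' [Hf hT -> ->]]]] E ->]]]].
have /mapP[r rT [hE hE']] := hT; rewrite {}hE {}hE' in E *.
have [gw gE] := monom_of_word_surj g; rewrite gE in E *.
rewrite !rename_monom_of_word -!monom_of_word_cat in E *.
exists (gw ++ map f r.2) => //.
have {}E : perm_eq u (gw ++ map f r.1) by apply/monom_of_word_eq.
have [f1 f2] := embedding_letters Hf.
have [|F HF FE] := @extend_atom_embedding
  [seq (to_seq x.1, to_seq (f x).1) | x <- r.1 ++ r.2].
  by move=> _ _ /mapP[x _ ->] /mapP[y _ ->] /=; rewrite f1.
have EF w : {subset w <= r.1 ++ r.2} -> word_of (map f w) = rename_word F (word_of w).
  move=> sub; rewrite /rename_word /word_of -!map_comp; apply/eq_in_map => x xw.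
  rewrite /= /letter_of /= f2; congr pair.
  by apply/esym; apply: (FE (_, _)); apply/mapP; exists x; rewrite ?sub.
exists (word_of r.1, word_of r.2), F, (word_of gw); split=> //=.
- by apply/mapP; exists r.
- rewrite -EF; last by move=> x xr; rewrite mem_cat xr.
  by rewrite -word_of_cat; apply/word_of_perm.
rewrite -EF; last by move=> x xr; rewrite mem_cat xr orbT.
by rewrite -word_of_cat.
Qed.

Lemma word_step_step u w : word_step word_rules (word_of u) w ->
  exists2 v, perm_eq w (word_of v) &
    step (presentation_of_words T) (monom_of_word u) (monom_of_word v).
Proof.
move=> [_ [F [g [/mapP[r rT ->] HF Hu Hw]]]]; rewrite /= in Hu Hw.
have Hf := @letters_embedding m d _ HF; set f := (fun x => _) in Hf.
have Ef w0 : rename_word F (word_of w0) = word_of (map f w0).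
  rewrite /rename_word /word_of -!map_comp; apply: eq_map => x /=.
  by rewrite /letter_of /= of_seqK // (size_atom_embedding _ HF) size_to_seq.
have [|gw gE] := @word_of_surj m d g.
  have := word_of_wf u; rewrite (wf_word_perm _ _ Hu) wf_word_cat.
  by case/andP.
rewrite !Ef gE -!word_of_cat in Hu Hw.
exists (gw ++ map f r.2) => //.
exists (monom_of_word gw), (rename f (monom_of_word r.1)), (rename f (monom_of_word r.2)).
split; last by rewrite rename_monom_of_word monom_of_word_cat.
  exists f, (monom_of_word r.1), (monom_of_word r.2); split=> //.
  by apply/mapP; exists r.
rewrite rename_monom_of_word -monom_of_word_cat; apply/monom_of_word_eq.
by apply/word_of_perm.
Qed.

Lemma reach_star s t :
  reach (presentation_of_words T) (monom_of_word s) (monom_of_word t) <->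
  star word_rules (word_of s) (word_of t).
Proof.
split; last first.
  suff H u v : star word_rules u v -> forall s t, perm_eq (word_of s) u ->
      perm_eq v (word_of t) -> reach (presentation_of_words T) (monom_of_word s) (monom_of_word t).
    by move=> /H; apply.
  elim=> [x y xy|x x1 y Hx _ IH] {}s {}t sx yt.
    have /monom_of_word_eq-> : perm_eq s t.
      by apply/word_of_perm; apply: perm_trans (perm_trans sx xy) yt.
    exact: rt_refl.
  have {}Hx : word_step word_rules (word_of s) x1.
    by apply: step_perm Hx => //; rewrite perm_sym.
  have [w wE sw] := word_step_step Hx.
  apply: (@rt_trans _ _ _ (monom_of_word w)); first exact: rt_step.
  by apply: IH => //; rewrite perm_sym.
suff H c c' : clos_refl_trans_1n _ (step (presentation_of_words T)) c c' ->
    forall s t, monom_of_word s = c -> monom_of_word t = c' ->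
      star word_rules (word_of s) (word_of t).
  by move=> /(@clos_rt_rt1n _ _ _ _)/H; apply.
elim=> [x|x y z xy _ IH] {}s {}t Es Et.
  by apply: StarPerm; apply/word_of_perm/monom_of_word_eq; rewrite Es Et.
rewrite -Es in xy; have [v Ev sv] := step_word_step xy.
exact: StarStep sv (IH v _ (esym Ev) Et).
Qed.
End NetWords.

(** * Computability of the certificate checks *)

Lemma computable_mem (E X : countType) (x : E -> X) (s : E -> seq X) :
  computable x -> computable s -> computable (fun e => x e \in s e).
Proof.
move=> Hx Hs; apply: (computable_ext (f := fun e => has (fun y => x e == y) (s e))).
  move=> e; apply/hasP/idP => [[y ys /eqP->]//|xs].
  by exists (x e).
apply: computable_has => //; apply: computable_eq; last by computable_proj.
by apply: (computable_comp Hx); computable_proj.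
Qed.

Lemma computable_count_mem (E X : countType) (x : E -> X) (s : E -> seq X) :
  computable x -> computable s -> computable (fun e => count_mem (x e) (s e)).
Proof.
move=> Hx Hs; apply: (computable_ext (f := fun e => count (fun y => y == x e) (s e))) => //.
apply: computable_count => //; apply: computable_eq; first by computable_proj.
by apply: (computable_comp Hx); computable_proj.
Qed.

Lemma computable_perm_eq (E X : countType) (s t : E -> seq X) :
  computable s -> computable t -> computable (fun e => perm_eq (s e) (t e)).
Proof.
move=> Hs Ht; apply: (computable_all
  (f := fun e x => count_mem x (s e) == count_mem x (t e))).
  apply: computable_eqn; apply: computable_count_mem; try by computable_proj.
    by apply: (computable_comp Hs); computable_proj.
  by apply: (computable_comp Ht); computable_proj.
exact: computable_cat.
Qed.

Lemma computable_last (E X : countType) (x : E -> X) (s : E -> seq X) :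
  computable x -> computable s -> computable (fun e => last (x e) (s e)).
Proof.
move=> Hx Hs; apply: (computable_ext (f := fun e => foldl (fun _ y => y) (x e) (s e))).
  by move=> e; elim: (s e) (x e) => //=.
by apply: (computable_foldl (f := fun _ _ y => y)) => //; computable_proj.
Qed.

Lemma computable_path (E X : countType) (r : E -> rel X) (x : E -> X) (s : E -> seq X) :
  computable (fun p : E * (X * X) => r p.1 p.2.1 p.2.2) -> computable x -> computable s ->
  computable (fun e => path (r e) (x e) (s e)).
Proof.
move=> Hr Hx Hs; pose f e (st : X * bool) y := (y, st.2 && r e st.1 y).
apply: (computable_ext (f := fun e => (foldl (f e) (x e, true) (s e)).2)).
  move=> e; suff H b y t : (foldl (f e) (y, b) t).2 = b && path (r e) y t by rewrite H.
  by elim: t b y => [|z t IHt] b y /=; rewrite ?andbT // IHt andbA.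
apply: computable_snd; apply: (computable_foldl (f := f) (z := fun e => (x e, true))) => //.
  apply: computable_pair; first by computable_proj.
  apply: computable_andb; first by computable_proj.
  apply: (computable_comp Hr (f := fun p : E * (X * bool * X) => (p.1, (p.2.1.1, p.2.2)))).
  by apply: computable_pair; [|apply: computable_pair]; computable_proj.
by apply: computable_pair => //; apply: computable_const.
Qed.

Lemma computable_app2 (E X Y Z : countType) (f : X -> Y -> Z) (g : E -> X) (h : E -> Y) :
  computable (fun p : X * Y => f p.1 p.2) -> computable g -> computable h ->
  computable (fun e => f (g e) (h e)).
Proof.
move=> Hf Hg Hh; apply: (computable_comp Hf (f := fun e => (g e, h e))).
exact: computable_pair.
Qed.

(* The dispatch is syntactic because unification would see through [leq] or
   [andb] and apply the wrong closure lemma. *)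
Ltac computable_step user := cbv beta zeta; lazymatch goal with
  | H : computable ?f |- computable ?f => exact: H
  | |- computable (fun x => x) => exact: computable_id
  | |- computable (@fst _ _) => apply: (computable_fst (f := id))
  | |- computable (@snd _ _) => apply: (computable_snd (f := id))
  | |- computable id => exact: computable_id
  | |- computable (fun _ => ?c) => exact: computable_const
  | |- computable (fun e => fst (@?f e)) => apply: (computable_fst (f := f))
  | |- computable (fun e => snd (@?f e)) => apply: (computable_snd (f := f))
  | |- computable (fun e => pair (@?f e) (@?g e)) => apply: (computable_pair (f := f) (g := g))
  | |- computable (fun e => andb (@?f e) (@?g e)) => apply: (computable_andb (a := f) (b := g))
  | |- computable (fun e => orb (@?f e) (@?g e)) => apply: (computable_orb (a := f) (b := g))
  | |- computable (fun e => implb (@?f e) (@?g e)) =>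
    apply: (computable_implyb (a := f) (b := g))
  | |- computable (fun e => negb (@?f e)) => apply: (computable_negb (a := f))
  | |- computable (fun e => leq (@?f e) (@?g e)) => apply: (computable_leq (m := f) (n := g))
  | |- computable (fun e => eq_op (@?f e) (@?g e)) => first
    [apply: (computable_eqn (m := f) (n := g)) | apply: (computable_eq (f := f) (g := g))]
  | |- computable (fun e => odd (@?f e)) => apply: (computable_odd (n := f))
  | |- computable (fun e => addn (@?f e) (@?g e)) => apply: (computable_add (m := f) (n := g))
  | |- computable (fun e => muln (@?f e) (@?g e)) => apply: (computable_mul (m := f) (n := g))
  | |- computable (fun e => modn (@?f e) (@?g e)) => apply: (computable_mod (m := f) (n := g))
  | |- computable (fun e => S (@?f e)) => apply: (computable_succ (n := f))
  | |- computable (fun e => nat_of_bool (@?f e)) => apply: (computable_nat_of_bool (b := f))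
  | |- computable (fun e => perm_eq (@?f e) (@?g e)) =>
    apply: (computable_perm_eq (s := f) (t := g))
  | |- computable (fun e => count (pred_of_simpl (pred1 (@?x e))) (@?s e)) =>
    apply: (computable_count_mem (x := x) (s := s))
  | |- computable (fun e => in_mem (@?x e) (mem (@?s e))) =>
    apply: (computable_mem (x := x) (s := s))
  | |- computable (fun e => last (@?x e) (@?s e)) => apply: (computable_last (x := x) (s := s))
  | |- computable (fun e => path (@?r e) (@?x e) (@?s e)) =>
    apply: (computable_path (r := r) (x := x) (s := s))
  | |- computable (fun e => cons (@?x e) (@?s e)) => apply: (computable_cons (f := x) (s := s))
  | |- computable (fun e => cat (@?x e) (@?s e)) => apply: (computable_cat (s := x) (t := s))
  | |- computable (fun e => flatten (@?s e)) => apply: (computable_flatten (s := s))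
  | |- computable (fun e => map (@?f e) (@?s e)) => apply: (computable_map (f := f) (s := s))
  | |- computable (fun e => all (@?f e) (@?s e)) => apply: (computable_all (f := f) (s := s))
  | |- computable (fun e => has (@?f e) (@?s e)) => apply: (computable_has (f := f) (s := s))
  | |- computable (fun e => filter (@?f e) (@?s e)) =>
    apply: (computable_filter (f := f) (s := s))
  | |- computable (fun e => count (@?f e) (@?s e)) => apply: (computable_count (f := f) (s := s))
  | |- computable (fun e => size (@?s e)) => apply: (computable_size (s := s))
  | |- computable (fun e => iota (@?m e) (@?n e)) => apply: (computable_iota (m := m) (n := n))
  | |- computable (fun e => zip (@?m e) (@?n e)) => apply: (computable_zip (s := m) (t := n))
  | |- computable (fun e => rem (@?x e) (@?s e)) => apply: (computable_rem (x := x) (s := s))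
  | |- computable (fun e => foldr (@?f e) (@?z e) (@?s e)) =>
    apply: (computable_foldr (f := f) (z := z) (s := s))
  | |- computable (fun e => iter (@?n e) (@?f e) (@?z e)) =>
    apply: (computable_iter (n := n) (f := f) (z := z))
  | |- computable (fun e => if _ then _ else _) => apply: computable_if
  | |- _ => user
  end.
Tactic Notation "computability" := repeat computable_step fail.
Tactic Notation "computability" "using" tactic3(user) := repeat computable_step user.

Lemma computable_double (E : countType) (n : E -> nat) :
  computable n -> computable (fun e => (n e).*2).
Proof.
move=> Hn; apply: (computable_ext (f := fun e => n e + n e)) => [e|].
  by rewrite addnn.
by computability.
Qed.

Lemma computable_cmp (E : countType) (a b : E -> seq nat) :
  computable a -> computable b -> computable (fun e => cmp (a e) (b e)).
Proof.
move=> Ha Hb; apply: (computable_foldr (f := fun _ (p : nat * nat) r =>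
  if p.1 < p.2 then 1 else if p.2 < p.1 then 2 else r.+3) (z := fun=> 0)); last first.
- computability.
- computability.
- computability.
Qed.

Lemma computable_same_type (E : countType) (u v : E -> word nat) :
  computable u -> computable v -> computable (fun e => same_type (u e) (v e)).
Proof.
apply: (computable_app2 (f := fun u v : word nat => same_type u v)).
rewrite /same_type; computability using (apply: computable_cmp).
Qed.

Lemma computable_letter_lt (E : countType) (x y : E -> seq nat * nat) :
  computable x -> computable y -> computable (fun e => letter_lt (x e) (y e)).
Proof.
apply: (computable_app2 (f := fun x y : seq nat * nat => letter_lt x y)).
rewrite /letter_lt; computability using (apply: computable_cmp).
Qed.

Lemma computable_word_lt (E : countType) (u v : E -> word nat) :
  computable u -> computable v -> computable (fun e => word_lt (u e) (v e)).
Proof.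
apply: (computable_app2 (f := fun u v : word nat => word_lt u v)).
rewrite /word_lt; computability using (apply: computable_letter_lt).
Qed.

Lemma computable_seq_diff (E X : countType) (s t : E -> seq X) :
  computable s -> computable t -> computable (fun e => seq_diff (s e) (t e)).
Proof.
apply: (computable_app2 (f := fun s t : seq X => seq_diff s t)).
rewrite /seq_diff; computability.
Qed.

Lemma computable_words_over (E X : countType) (s : E -> seq X) (n : E -> nat) :
  computable s -> computable n -> computable (fun e => words_over (s e) (n e)).
Proof.
apply: (computable_app2 (f := fun (s : seq X) n => words_over s n)).
rewrite /words_over; computability.
Qed.

Lemma computable_step_check (E : countType) (R : E -> seq (rule nat)) (u v : E -> word nat) :
  computable R -> computable u -> computable v ->
  computable (fun e => step_check (R e) (u e) (v e)).
Proof.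
move=> HR Hu Hv; apply: (computable_app2 (f := fun R (p : word nat * word nat) =>
  step_check R p.1 p.2) (h := fun e => (u e, v e))) => //; last exact: computable_pair.
rewrite /step_check; computability using (first [apply: computable_same_type
  | apply: computable_seq_diff | apply: computable_words_over]).
Qed.

Lemma computable_visible (E : countType) (w : E -> word nat) :
  computable w -> computable (fun e => visible (w e)).
Proof. by move=> Hw; rewrite /visible; computability. Qed.

Lemma computable_hidden (E : countType) (w : E -> word nat) :
  computable w -> computable (fun e => hidden (w e)).
Proof. by move=> Hw; rewrite /hidden; computability. Qed.

Lemma computable_mark_part (E : countType) (w : E -> word nat) :
  computable w -> computable (fun e => mark_part (w e)).
Proof. by move=> Hw; rewrite /mark_part; computability. Qed.

Lemma computable_marks (E : countType) p (w : E -> word nat) :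
  computable w -> computable (fun e => marks p (w e)).
Proof. by move=> Hw; rewrite /marks; computability. Qed.

Lemma computable_hidden_marks_only (E : countType) (w : E -> word nat) :
  computable w -> computable (fun e => hidden_marks_only (w e)).
Proof.
apply: (computable_comp (g := fun w : word nat => hidden_marks_only w)).
rewrite /hidden_marks_only; computability.
Qed.

Lemma computable_has_marks (E : countType) (w : E -> word nat) :
  computable w -> computable (fun e => has_marks (w e)).
Proof.
apply: (computable_comp (g := fun w : word nat => has_marks w)).
rewrite /has_marks; computability.
Qed.

Lemma computable_visible_copy (E : countType) (w : E -> word nat) :
  computable w -> computable (fun e => visible_copy (w e)).
Proof. by move=> Hw; rewrite /visible_copy; computability using (apply: computable_double). Qed.

Lemma computable_hidden_copy (E : countType) (w : E -> word nat) :
  computable w -> computable (fun e => hidden_copy (w e)).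
Proof. by move=> Hw; rewrite /hidden_copy; computability using (apply: computable_double). Qed.

Lemma computable_visible_rules (E : countType) (B : E -> seq (rule nat)) :
  computable B -> computable (fun e => visible_rules (B e)).
Proof. by move=> HB; rewrite /visible_rules; computability using (first [apply: computable_visible
  | apply: computable_hidden_marks_only]). Qed.

Lemma computable_rule_ok (E : countType) l (D : E -> nat) (r : E -> rule nat) :
  computable D -> computable r -> computable (fun e => rule_ok l (D e) (r e)).
Proof.
apply: (computable_app2 (f := fun D (r : rule nat) => rule_ok l D r)).
rewrite /rule_ok /wf_word; computability using (first [apply: computable_word_lt
  | apply: computable_mark_part | apply: computable_has_marks | apply: computable_hidden
  | apply: computable_hidden_marks_only]).
Qed.

Lemma computable_meets (E : countType) (B : E -> seq (rule nat)) (o : E -> rule nat)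
    (j : E -> seq (word nat) * seq (word nat)) :
  computable B -> computable o -> computable j -> computable (fun e => meets (B e) (o e) (j e)).
Proof.
move=> HB Ho Hj; apply: (computable_app2 (f := fun B (p : rule nat * _) =>
  meets B p.1 p.2) (h := fun e => (o e, j e))) => //; last exact: computable_pair.
rewrite /meets; computability using (apply: computable_step_check).
Qed.

Lemma computable_irreducible_check (E : countType) (R : E -> seq (rule nat)) (w : E -> word nat) :
  computable R -> computable w -> computable (fun e => irreducible_check (R e) (w e)).
Proof.
apply: (computable_app2 (f := irreducible_check)).
rewrite /irreducible_check; computability using (first [apply: computable_same_type
  | apply: computable_seq_diff | apply: computable_words_over]).
Qed.

Lemma computable_critical_pairs (E : countType) l (D : E -> nat) (r1 r2 : E -> rule nat) :
  computable D -> computable r1 -> computable r2 ->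
  computable (fun e => critical_pairs l (D e) (r1 e) (r2 e)).
Proof.
move=> HD H1 H2; apply: (computable_app2 (f := fun D (p : rule nat * rule nat) =>
  critical_pairs l D p.1 p.2) (h := fun e => (r1 e, r2 e))) => //; last exact: computable_pair.
rewrite /critical_pairs /instances /letters; computability using (first [apply: computable_same_type
  | apply: computable_seq_diff | apply: computable_words_over]).
Qed.

Lemma computable_obligations (E : countType) l (d : E -> nat) (B T : E -> seq (rule nat)) :
  computable d -> computable B -> computable T ->
  computable (fun e => obligations l (d e) (B e) (T e)).
Proof.
move=> Hd HB HT; apply: (computable_app2 (f := fun d (p : seq (rule nat) * seq (rule nat)) =>
  obligations l d p.1 p.2) (h := fun e => (B e, T e))) => //; last exact: computable_pair.
rewrite /obligations; computability using (first [apply: computable_critical_pairs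
  | apply: computable_double | apply: computable_hidden_copy | apply: computable_marks]).
Qed.

Definition instance : countType :=
  (nat * (seq (rule nat) * (word nat * word nat)))%type.
Definition positive_certificate : countType :=
  (word nat * (seq (word nat) * word nat))%type.
Definition negative_certificate : countType :=
  (seq (rule nat) *
    (seq (seq (word nat) * seq (word nat)) * (seq (word nat) * seq (word nat))))%type.

Lemma computable_positive_check :
  computable (fun p : instance * positive_certificate =>
    positive_check p.1.2.1 p.1.2.2.1 p.1.2.2.2 p.2).
Proof. by rewrite /positive_check; computability using (first [apply: computable_same_type
  | apply: computable_step_check]). Qed.

Lemma computable_negative_check l :
  computable (fun p : instance * negative_certificate =>
    negative_check l p.1.1 p.1.2.1 p.1.2.2.1 p.1.2.2.2 p.2).
Proof.
rewrite /negative_check.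
by computability using (first [apply: computable_obligations | apply: computable_marks
  | apply: computable_double
  | apply: computable_visible_copy | apply: computable_visible_rules
  | apply: computable_rule_ok | apply: computable_meets | apply: computable_irreducible_check
  | apply: computable_step_check]).
Qed.

(** * Search for certificates *)

(** A search runs through all numbers, also those that code no certificate, where a program given by
    [computable] may diverge; hence a total surjective decoder. *)
Definition decodable (X : countType) :=
  exists2 dec : nat -> X, computable dec & forall x, exists n, dec n = x.

Lemma decodable_nat : decodable nat.
Proof. by exists id; [apply: computable_id|move=> n; exists n]. Qed.

Lemma decodable_pair (X Y : countType) :
  decodable X -> decodable Y -> decodable (X * Y)%type.
Proof.
move=> [dX cX sX] [dY cY sY].
exists (fun n => (dX (chead n), dY (chead (ctail n)))).
  have ch (f : nat -> nat) : computable f -> computable (fun n => chead (f n)).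
    exact: (computable_raw1 (g := chead) mcomputable1_chead).
  have ct (f : nat -> nat) : computable f -> computable (fun n => ctail (f n)).
    exact: (computable_raw1 (g := ctail) mcomputable1_ctail).
  have Hid := computable_id nat.
  apply: computable_pair; first by apply: (computable_comp cX); apply: ch.
  by apply: (computable_comp cY); apply: ch; apply: ct.
move=> [x y]; have [m <-] := sX x; have [n <-] := sY y.
by exists (ccons m (ccons n 0)); rewrite ctailK !cheadK.
Qed.

Lemma decodable_seq (X : countType) : decodable X -> decodable (seq X).
Proof.
move=> [dX cX sX]; exists (fun n => map dX (CodeSeq.decode n)).
  apply: (computable_map (f := fun _ => dX)).
    by apply: (computable_comp cX); computable_proj.
  apply: (computable_raw1 (r := id) (g := CodeSeq.decode) (f := id)).
  - exact: mcomputable_proj.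
  - by move=> n; rewrite -[RHS]CodeSeq.decodeK; congr CodeSeq.code; rewrite -[RHS]map_id.
  - exact: computable_id.
move=> s; suff [ns <-] : exists ns, map dX ns = s.
  by exists (CodeSeq.code ns); rewrite CodeSeq.codeK.
elim: s => [|x s [ns <-]]; first by exists [::].
by have [n <-] := sX x; exists (n :: ns).
Qed.

Lemma decodable_certificates : decodable positive_certificate /\ decodable negative_certificate.
Proof.
have w : decodable (word nat).
  by apply: decodable_seq; apply: decodable_pair; [apply: decodable_seq|]; apply: decodable_nat.
have sw := decodable_seq w.
split; first by do !apply: decodable_pair.
apply: decodable_pair; first by apply: decodable_seq; apply: decodable_pair.
by apply: decodable_pair; [apply: decodable_seq|]; apply: decodable_pair.
Qed.

Lemma computable_search (X : countType) (F : X * nat -> bool) : computable F ->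
  exists p, forall x n, F (x, n) -> (forall m, m < n -> ~~ F (x, m)) ->
    meval p [:: pickle x] n.
Proof.
move=> HF; have [f Hf] := computable_negb HF.
have [c Hc] := @mcomputable2_app 2 _ _ _ mcomputable2_ccons
  (mcomputable_proj (isT : 1 < 2)) (mcomputable2_app mcomputable2_ccons
   (mcomputable_proj (isT : 0 < 2)) (mcomputable_const _ 0)).
have ev x m : meval (MComp f [:: c]) [:: m; pickle x] (~~ F (x, m)).
  apply: (@EvComp _ _ _ [:: pickle (x, m)]); last exact: Hf (x, m).
  by constructor; [apply: (Hc [:: m; pickle x])|constructor].
exists (MMin (MComp f [:: c])) => x n Fn Hn; constructor.
  by have := ev x n; rewrite Fn.
by move=> m /Hn nF; exists 0; have := ev x m; rewrite nF.
Qed.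

(** The least number that decodes to a certificate of either kind is found, and the answer is
    whether it is a positive one. Exclusion is assumed input by input, as it is established for
    well-formed instances. *)
Lemma decidable_by_certificates (X Y Z : countType) (P : X * Y -> bool) (N : X * Z -> bool) :
  decodable Y -> decodable Z -> computable P -> computable N ->
  exists p, forall x, (forall y z, P (x, y) -> ~~ N (x, z)) ->
    ((exists y, P (x, y)) -> meval p [:: pickle x] 1) /\
    ((exists z, N (x, z)) -> meval p [:: pickle x] 0).
Proof.
move=> [dY cY sY] [dZ cZ sZ] cP cN.
pose P' (q : X * nat) := P (q.1, dY q.2); pose N' (q : X * nat) := N (q.1, dZ q.2).
have cP' : computable P'.
  apply: (computable_comp cP (f := fun q : X * nat => (q.1, dY q.2))).
  by apply: computable_pair; [|apply: (computable_comp cY)]; computable_proj.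
have cN' : computable N'.
  apply: (computable_comp cN (f := fun q : X * nat => (q.1, dZ q.2))).
  by apply: computable_pair; [|apply: (computable_comp cZ)]; computable_proj.
have [s Hs] := computable_search (computable_orb cP' cN').
have [o Ho] := cP'.
have [c Hc] := @mcomputable2_app 2 _ _ _ mcomputable2_ccons
  (mcomputable_proj (isT : 0 < 2)) (mcomputable2_app mcomputable2_ccons
   (mcomputable_proj (isT : 1 < 2)) (mcomputable_const _ 0)).
exists (MComp o [:: MComp c [:: MProj 0; s]]) => x PN.
have run n : P' (x, n) || N' (x, n) -> exists2 m, P' (x, m) || N' (x, m) &
    meval (MComp o [:: MComp c [:: MProj 0; s]]) [:: pickle x] (P' (x, m)).
  move=> Hn; have ex : exists n, P' (x, n) || N' (x, n) by exists n.
  case: (ex_minnP ex) => m Hm min_m; exists m => //.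
  apply: (@EvComp _ _ _ [:: pickle (x, m)]); last exact: Ho (x, m).
  constructor; last by constructor.
  apply: (@EvComp _ _ _ [:: pickle x; m]); last exact: (Hc [:: pickle x; m]).
  constructor; first exact: (@EvProj 0 [:: _]).
  constructor; last by constructor.
  apply: Hs => // k lt_k; apply/negP => /min_m; rewrite leqNgt lt_k //.
split=> [[y Py]|[z Nz]].
  have [n En] := sY y; have [|m Hm] := run n; first by rewrite /P' /= En Py.
  suff -> : P' (x, m) by [].
  by move: Hm; rewrite orbC => /orP[|//]; rewrite /N' /= => /(negP (PN _ _ Py)).
have [n En] := sZ z; have [|m Hm] := run n; first by rewrite /N' /= En Nz orbT.
suff /negbTE-> : ~~ P' (x, m) by [].
by apply/negP => Pm; have := PN _ z Pm; rewrite Nz.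
Qed.

(** * Comparison of rationals by arithmetic on codes *)

Definition int_parts (i : int) : nat * nat :=
  match i with Posz n => (n, 0) | Negz n => (0, n.+1) end.

Lemma int_partsE (i : int) : i = (Posz (int_parts i).1 - Posz (int_parts i).2)%R.
Proof. by case: i => n /=; rewrite ?subr0 // sub0r NegzE. Qed.

Lemma computable_int_parts (E : countType) (i : E -> int) :
  computable i -> computable (fun e => int_parts (i e)).
Proof.
(* By computation an integer has the same pickle as this pair of lists. *)
pose f (i : int) : seq nat * seq nat :=
  match i with Posz n => ([:: n], [::]) | Negz n => ([::], [:: n]) end.
move=> Hi; have Hf : computable (fun e => f (i e)).
  apply: (computable_raw1 (r := id) (g := f)) Hi; first exact: mcomputable_proj.
  by case.
apply: (computable_ext (f := fun e => (head 0 (f (i e)).1, head 0 (map succn (f (i e)).2)))).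
  by move=> e; case: (i e).
apply: computable_pair; apply: computable_head; first exact: computable_fst.
apply: (computable_map (f := fun _ => succn)); last exact: computable_snd.
by apply: computable_succ; computable_proj.
Qed.

(** Cross multiplication of reduced fractions, the negative parts being moved to the other side so
    that only natural numbers occur. *)
Lemma ltr_rat_parts (x y : rat) : (x < y)%R =
  let p := int_parts (numq x) in let q := int_parts (numq y) in
  let a := (int_parts (denq x)).1 in let b := (int_parts (denq y)).1 in
  p.1 * b + q.2 * a < q.1 * a + p.2 * b.
Proof.
have den (z : rat) : denq z = Posz (int_parts (denq z)).1.
  by have := denq_gt0 z; case: (denq z).
have -> : (x < y)%R = (numq x * denq y < numq y * denq x)%R := lt_ratE x y.
rewrite {1}(int_partsE (numq x)) {1}(int_partsE (numq y)) /= {1}(den x) {1}(den y).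
move: (int_parts (numq x)).1 (int_parts (numq x)).2 (int_parts (numq y)).1 (int_parts (numq y)).2.
move: (int_parts (denq x)).1 (int_parts (denq y)).1 => a b p1 p2 q1 q2.
by rewrite !mulrBl ltrBlDr addrAC ltrBrDr -!PoszM -!PoszD ltz_nat.
Qed.

Lemma computable_ltr_rat (E : countType) (x y : E -> rat) :
  computable x -> computable y -> computable (fun e => (x e < y e)%R).
Proof.
have Hq (F : countType) (z : F -> rat) : computable z -> computable (fun e => valq (z e)).
  by apply: (computable_raw1 (r := id) (g := valq)) => //; apply: mcomputable_proj.
move=> Hx Hy.
apply: (computable_ext (f := fun e =>
  let p := int_parts (valq (x e)).1 in let q := int_parts (valq (y e)).1 in
  let a := (int_parts (valq (x e)).2).1 in let b := (int_parts (valq (y e)).2).1 in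
  p.1 * b + q.2 * a < q.1 * a + p.2 * b)).
  by move=> e; rewrite ltr_rat_parts.
have Hx' := Hq _ _ Hx; have Hy' := Hq _ _ Hy.
by computability using (apply: computable_int_parts).
Qed.

(** * The decision procedure *)

(** Ranks are taken among the coordinates of the rules and of both words together, so that the joint
    order type of the instance is kept. *)
Definition normalize (p : nat * (seq (rule rat) * (word rat * word rat))) : instance :=
  let T := p.2.1 in let s := p.2.2.1 in let t := p.2.2.2 in
  let L := coordinates (s :: t :: [seq r.1 | r <- T] ++ [seq r.2 | r <- T]) in
  let n w := rename_word (map (rank L)) w in
  (p.1, ([seq (n r.1, n r.2) | r <- T], (n s, n t))).

Lemma normalize_star d (T : seq (rule rat)) s t (x := normalize (d, (T, (s, t)))) :
  [/\ forall u v, star (nat_rules x.2.1) u v <-> star T u v,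
      star (nat_rules x.2.1) (nat_word x.2.2.1) (nat_word x.2.2.2) <-> star T s t &
      exists2 G, atom_embedding G &
        [/\ nat_rules x.2.1 = [seq (rename_word G r.1, rename_word G r.2) | r <- T],
            nat_word x.2.2.1 = rename_word G s & nat_word x.2.2.2 = rename_word G t]].
Proof.
set ws := s :: t :: [seq r.1 | r <- T] ++ [seq r.2 | r <- T].
have [G [H [HG HH EG EH _]]] := compress ws.
have in1 (r : rule rat) : r \in T -> r.1 \in ws.
  by move=> rT; rewrite !in_cons mem_cat map_f ?orbT.
have in2 (r : rule rat) : r \in T -> r.2 \in ws.
  by move=> rT; rewrite !in_cons mem_cat (map_f snd) ?orbT.
have ins : s \in ws by rewrite mem_head.
have int : t \in ws by rewrite !in_cons eqxx orbT.
have E1 : nat_rules x.2.1 = [seq (rename_word G r.1, rename_word G r.2) | r <- T].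
  by rewrite /nat_rules /x /= -map_comp; apply/eq_in_map => r rT /=; rewrite !EG ?in1 ?in2.
have GK (r : rule rat) : r \in T ->
    rename_word H (rename_word G r.1) = r.1 /\ rename_word H (rename_word G r.2) = r.2.
  by move=> rT; rewrite -!EG ?in1 ?in2 // !EH ?in1 ?in2.
have E2 : nat_word x.2.2.1 = rename_word G s by rewrite EG.
have E3 : nat_word x.2.2.2 = rename_word G t by rewrite EG.
have S u v : star (nat_rules x.2.1) u v <-> star T u v.
  rewrite E1; split; last exact: (star_rename_rules HG HH GK).
  elim=> [y z yz|y y1 z Hy _ IH]; first exact: StarPerm.
  by apply: StarStep IH; apply/(step_rename_rules HG HH GK).
split=> //; last by exists G.
rewrite S E2 E3; split; last exact: star_rename.
by move=> /(star_rename HH); rewrite -E2 -E3 !EH.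
Qed.

Lemma computable_normalize : computable normalize.
Proof.
rewrite /normalize /coordinates /rename_word /rank.
by computability using (apply: computable_ltr_rat).
Qed.

Section Input.
Variable m : nat.
Let A : structure := iter m (lexprod ratQ) ratQ.

(** In an instance the type of places depends on [d], so instances do not form one countable type.
    Places are therefore read as natural numbers, which leaves all pickles unchanged. *)
Definition raw_word : countType := seq (A * nat)%type.
Definition raw_input : countType :=
  (nat * (seq (raw_word * raw_word) * (raw_word * raw_word)))%type.

Definition read_word (w : seq (A * nat)) : word rat := [seq (to_seq x.1, x.2) | x <- w].

Definition read_input (p : nat * (seq (raw_word * raw_word) * (raw_word * raw_word))) :=
  (p.1, ([seq (read_word r.1, read_word r.2) | r <- p.2.1],
         (read_word p.2.2.1, read_word p.2.2.2))).

Definition strip_word d (w : seq (A * 'I_d)) : raw_word :=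
  map (fun x : A * 'I_d => (x.1, nat_of_ord x.2)) w.

Lemma read_strip_word d (w : seq (A * 'I_d)) : read_word (strip_word w) = word_of w.
Proof. by rewrite /read_word /strip_word /word_of -map_comp. Qed.

Lemma pickle_strip_word d (w : seq (lexprod A (chain d))) :
  choice.pickle (strip_word w) = choice.pickle w.
Proof.
congr CodeSeq.code; rewrite /strip_word -map_comp; apply: eq_map => x /=.
by [].
Qed.

Lemma pickle_strip_rules d (T : seq (seq (lexprod A (chain d)) * seq (lexprod A (chain d)))) :
  choice.pickle [seq (strip_word r.1, strip_word r.2) | r <- T] = choice.pickle T.
Proof.
congr CodeSeq.code; rewrite -map_comp; apply: eq_map => -[u v] /=.
by rewrite !pickle_pair !pickle_strip_word.
Qed.
End Input.

Lemma computable_to_seq m : computable (@to_seq m).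
Proof.
elim: m => [|m IHm].
  apply: (@computable_cons rat rat id (fun=> [::])); first exact: computable_id.
  exact: computable_const.
pose A : countType := iter m (lexprod ratQ) ratQ.
have H : computable (fun x : rat * A => x.1 :: to_seq x.2).
  apply: computable_cons; first by computable_proj.
  by apply: (computable_comp IHm); computable_proj.
exact: H.
Qed.

Lemma computable_read_input m : computable (@read_input m).
Proof.
have Hw (E : countType) (w : E -> raw_word m) : computable w ->
    computable (fun e => read_word (w e)).
  move=> Hw; apply: (computable_map (f := fun _ x => (to_seq x.1, x.2))) => //.
  apply: computable_pair; last by computable_proj.
  by apply: (computable_comp (computable_to_seq m)); computable_proj.
apply: computable_pair; first by computable_proj.
apply: computable_pair.
  apply: (computable_map (f := fun _ r => (read_word r.1, read_word r.2))).
    by apply: computable_pair; apply: Hw; computable_proj.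
  by computable_proj.
by apply: computable_pair; apply: Hw; computable_proj.
Qed.

Theorem theorem8p3 (l : nat) (hl : 1 <= l) :
  reversible_reachability_decidable (lexpow ratQ l).
Proof.
case: l hl => // m _; rewrite /lexpow [m.+1.-1]/=.
have [dP dN] := decodable_certificates.
have [p Hp] := decidable_by_certificates dP dN computable_positive_check
  (computable_negative_check m.+1).
have [q Hq] := computable_comp computable_normalize (computable_read_input m).
have [c Hc] : mcomputable 4 (fun xs =>
    ccons (nth 0 xs 0) (ccons (ccons (nth 0 xs 1)
      (ccons (ccons (nth 0 xs 2) (ccons (nth 0 xs 3) 0)) 0)) 0)).
  have pr i : i < 4 -> mcomputable 4 (fun xs => nth 0 xs i) := @mcomputable_proj 4 i.
  have pair F G : mcomputable 4 F -> mcomputable 4 G ->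
      mcomputable 4 (fun xs => ccons (F xs) (ccons (G xs) 0)).
    move=> HF HG; apply: (mcomputable2_app mcomputable2_ccons) => //.
    exact: (mcomputable2_app mcomputable2_ccons HG (mcomputable_const _ _)).
  exact: (pair _ _ (pr 0 isT) (pair _ _ (pr 1 isT) (pair _ _ (pr 2 isT) (pr 3 isT)))).
exists (MComp p [:: MComp q [:: c]]) => d T s t N input rev.
pose x0 : raw_input m := (d, ([seq (strip_word r.1, strip_word r.2) | r <- T],
  (strip_word s, strip_word t))).
pose x := normalize (read_input x0).
have Ex : read_input x0 = (d, (word_rules T, (word_of s, word_of t))).
  rewrite /read_input /x0 /= !read_strip_word; congr (_, (_, _)).
  by rewrite -map_comp; apply: eq_map => r /=; rewrite !read_strip_word.
have run b : meval p [:: choice.pickle x] b -> meval (MComp p [:: MComp q [:: c]]) input b.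
  move=> Hb; apply: (@EvComp _ _ _ [:: choice.pickle x]) => //.
  constructor; last by constructor.
  apply: (@EvComp _ _ _ [:: choice.pickle x0]); last exact: Hq.
  constructor; last by constructor.
  have := Hc input erefl; rewrite /input /=.
  by rewrite !pickle_pair pickle_strip_rules !pickle_strip_word.
have [S Sst [G HG [ET Es Et]]] := normalize_star d (word_rules T) (word_of s) (word_of t).
rewrite -Ex -/x in S Sst ET Es Et.
have wfT (r : rule rat) : r \in nat_rules x.2.1 ->
    wf_word m.+1 d r.1 && wf_word m.+1 d r.2.
  rewrite ET => /mapP[r0 /word_rules_wf/andP[w1 w2] ->] /=.
  by rewrite !wf_word_rename ?w1.
have wfs : wf_word m.+1 d (nat_word x.2.2.1) by rewrite Es wf_word_rename // word_of_wf.
have wft : wf_word m.+1 d (nat_word x.2.2.2) by rewrite Et wf_word_rename // word_of_wf.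
(* Well-formed words come from words over the structure, so reversibility of the net passes to
   rewriting. *)
have sym u v : wf_word m.+1 d u -> wf_word m.+1 d v ->
    star (nat_rules x.2.1) u v -> star (nat_rules x.2.1) v u.
  move=> /word_of_surj[u' ->] /word_of_surj[v' ->] /S/reach_star/rev H.
  by apply/S/reach_star.
have excl y z : positive_check x.2.1 x.2.2.1 x.2.2.2 y ->
    ~~ negative_check m.+1 x.1 x.2.1 x.2.2.1 x.2.2.2 z.
  move=> Hy; apply/negP => /negative_check_sound.
  have -> : x.1 = d by rewrite /x Ex.
  move=> /(separates_not_star wfT wfs wft); apply.
  by apply/positive_checkP; exists y.
have [Hpos Hneg] := Hp x excl.
split=> [/reach_star/Sst/positive_checkP H|nreach].
  by apply: run; apply: Hpos.
apply: run; apply: Hneg => /=.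
have nstar : ~ star (nat_rules x.2.1) (nat_word x.2.2.1) (nat_word x.2.2.2).
  by move=> /Sst/reach_star.
have [B HB] := separates_complete wfT sym wfs wft nstar.
exact: negative_check_complete HB.
Qed.
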